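(* Let $\mathcal T$ be an admissible mesh of $\Omega$. For all $\overline u\in H^1_0(\Omega)$ and all $u\in X_{\mathcal T}$, $$\|\widehat\nabla_{\mathcal T}u-\nabla\overline u\|_{L^2(\Omega)^d}\le\frac d{\theta_{\mathcal T}}\Big(\|G_{\mathcal T}u-\mathcal G_{\mathcal T}\overline u\|_{L^2(\Omega)}+\Theta_{\mathcal T}(\nabla\overline u)\Big),$$ where, for any $\boldsymbol\varphi\in L^2(\Omega)^d$, $$\Theta_{\mathcal T}(\boldsymbol\varphi)^2=\sum_{K\in\mathcal T}\int_K\int_K\frac1{|K|}|\boldsymbol\varphi(y)-\boldsymbol\varphi(x)|^2\,\mathrm dx\,\mathrm dy .$$ As a consequence, if $f\in L^2(\Omega)$, $\boldsymbol F\in L^2(\Omega)^d$, $\overline u\in H^1_0(\Omega)$ is the solution of $$\forall \varphi\in H^1_0(\Omega),\quad \int_\Omega \nabla\overline u\cdot\nabla\varphi\,\mathrm dx=\int_\Omega (f\varphi-\boldsymbol F\cdot\nabla\varphi)\,\mathrm dx$$ and $u\in X_{\mathcal T}$ is the solution of $$\forall v\in X_{\mathcal T},\quad d\int_\Omega G_{\mathcal T}u\,G_{\mathcal T}v\,\mathrm dx=\int_\Omega (f v-\boldsymbol F\cdot\nabla_{\mathcal T}v)\,\mathrm dx ,$$ then $$\|\widehat\nabla_{\mathcal T}u-\nabla\overline u\|_{L^2(\Omega)^d}\le\frac d{\theta_{\mathcal T}}\Big(2(1+\mathrm{diam}(\Omega))\big(\zeta_{\mathcal T}(\nabla\overline u+\boldsymbol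 F)+\inf_{v\in X_{\mathcal T}}\delta_{\mathcal T}(\overline u,v)\big)+\Theta_{\mathcal T}(\nabla\overline u)\Big).$$
   Context: Let $d\in\{2,3\}$ and let $\Omega\subset\mathbb R^d$ be a bounded open polytopal domain (polygonal if $d=2$, polyhedral if $d=3$). $|A|$ denotes the $d$- or $(d-1)$-dimensional measure of $A$, as appropriate. Admissible mesh. An admissible mesh $\mathcal T$ of $\Omega$ consists of: a finite family (also denoted $\mathcal T$) of disjoint open polytopal convex subsets of $\Omega$ (control volumes); a finite family $\mathcal E$ of disjoint subsets of $\overline\Omega$ contained in hyperplanes of $\mathbb R^d$, with strictly positive $(d-1)$-dimensional measure (the edges or faces); and a family of points $(x_K)_{K\in\mathcal T}$; such that: (i) the closure of the union of all control volumes is $\overline\Omega$; (ii) for each $K\in\mathcal T$ there is $\mathcal E_K\subset\mathcal E$ with $\partial K=\overline K\setminus K=\bigcup_{\sigma\in\mathcal E_K}\overline\sigma$, and $\mathcal E=\bigcup_{K}\mathcal E_K$; (iii) $x_K\in K$ for all $K\in\mathcal T$; (iv) $\mathcal E$ is partitioned into $\mathcal E_{\rm ext}\cup\mathcal E_{\rm int}$: if $\sigma\in\mathcal E_{\rm ext}$, there is exactly one $K\in\mathcal T$ with $\sigma\in\mathcal E_K$, $\sigma\subset\partial\Omega$, and the straight line through $x_K$ orthogonal to $\sigma$ intersects $\sigma$; if $\sigma\in\mathcal E_{\rm int}$, there are exactly two elements $K,L$ of $\mathcal T$ with $\sigma\in\mathcal E_K\cap\mathcal E_L$, $\partial K\cap\partial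 L=\overline\sigma$, and the straight line through $x_K$ and $x_L$ is orthogonal to $\sigma$ (this line is not required to meet $\overline\sigma$). For $K\in\mathcal T$, $\sigma\in\mathcal E_K$: $\overline x_\sigma$ is the center of gravity of $\sigma$; $d_{K,\sigma}>0$ is the orthogonal distance from $x_K$ to (the hyperplane containing) $\sigma$; $D_{K,\sigma}$ is the cone with vertex $x_K$ and basis $\sigma$, so $|D_{K,\sigma}|=|\sigma|d_{K,\sigma}/d$; $\boldsymbol n_{K,\sigma}$ is the unit normal to $\sigma$ outward to $K$. Mesh regularity parameter: $\theta_{\mathcal T}=\inf\{d_{K,\sigma}/\mathrm{diam}(K):\ K\in\mathcal T,\ \sigma\in\mathcal E_K\}$. Discrete space and operators. $X_{\mathcal T}$ is the set of real families $u=((u_K)_{K\in\mathcal T},(u_\sigma)_{\sigma\in\mathcal E})$ with $u_\sigma=0$ for $\sigma\in\mathcal E_{\rm ext}$; $u$ also denotes the function in $L^2(\Omega)$ equal to $u_K$ a.e. in each $K$. For $u\in X_{\mathcal T}$ and a.e. $x\in D_{K,\sigma}$, $$G_{\mathcal T}u(x)=\frac{u_\sigma-u_K}{d_{K,\sigma}},\qquad \nabla_{\mathcal T}u(x)=d\,\frac{u_\sigma-u_K}{d_{K,\sigma}}\boldsymbol n_{K,\sigma},$$ and the consistent discrete gradient is, for a.e. $x\in K$, $$\widehat\nabla_{\mathcal T}u(x)=\frac1{|K|}\sum_{\sigma\in\mathcal E_K}|\sigma|(\overline x_\sigma-x_K)\frac{u_\sigma-u_K}{d_{K,\sigma}}.$$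 Norm on $X_{\mathcal T}$: $\|u\|_{\mathcal T}^2=d\|G_{\mathcal T}u\|_{L^2(\Omega)}^2$. $\boldsymbol H_{\rm div}(\Omega)=\{\boldsymbol\varphi\in L^2(\Omega)^d:\ \mathrm{div}\boldsymbol\varphi\in L^2(\Omega)\}$. For $\boldsymbol\varphi\in\boldsymbol H_{\rm div}(\Omega)$, $$\zeta_{\mathcal T}(\boldsymbol\varphi)=\sup\Big\{\int_\Omega(\mathrm{div}\boldsymbol\varphi\, v+\boldsymbol\varphi\cdot\nabla_{\mathcal T}v)\,\mathrm dx:\ v\in X_{\mathcal T},\ \|v\|_{\mathcal T}=1\Big\}.$$ For $\varphi\in H^1_0(\Omega)$, $\mathcal G_{\mathcal T}\varphi\in L^2(\Omega)$ is equal a.e. in $D_{K,\sigma}$ to $\frac1{|D_{K,\sigma}|}\int_{D_{K,\sigma}}\nabla\varphi(y)\cdot\boldsymbol n_{K,\sigma}\,\mathrm dy$. For $\varphi\in H^1_0(\Omega)$ and $v\in X_{\mathcal T}$, $$\delta_{\mathcal T}(\varphi,v)=\frac1{\mathrm{diam}(\Omega)}\|\varphi-v\|_{L^2(\Omega)}+\sqrt d\,\|\mathcal G_{\mathcal T}\varphi-G_{\mathcal T}v\|_{L^2(\Omega)}.$$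
   Formalization: The edges or faces of the mesh are assumed to be polytopal (finite unions of polyhedral pieces); otherwise a face could be a dense subset of a facet with smaller measure, and the cones D_{K,σ} would not cover Ω up to a null set. *)

(* Defs.v *)
From HB Require Import structures.
From mathcomp Require Import all_boot all_order all_algebra.
From mathcomp Require Import all_classical all_reals all_analysis.
Import Order.TTheory GRing.Theory Num.Theory.
Import numFieldNormedType.Exports.

Set Implicit Arguments.
Unset Strict Implicit.
Unset Printing Implicit Defensive.

Local Open Scope classical_set_scope.
Local Open Scope ring_scope.

(* The sigma-algebra generated by the coordinates, as for [n.-tuple R]; it is
   the Borel sigma-algebra. *)
Section rV_measurable.
Context {R : realType} {n : nat}.

Let coords : 'I_n -> 'rV[R]_n -> R := fun i x => x ord0 i.

Let rV_set0 : g_sigma_preimage coords set0.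
Proof. exact: sigma_algebra0. Qed.

Let rV_setC A : g_sigma_preimage coords A -> g_sigma_preimage coords (~` A).
Proof. exact: sigma_algebraC. Qed.

Let rV_bigcup (F : (set 'rV[R]_n)^nat) :
  (forall i, g_sigma_preimage coords (F i)) ->
  g_sigma_preimage coords (\bigcup_i (F i)).
Proof. exact: sigma_algebra_bigcup. Qed.

HB.instance Definition _ :=
  @isMeasurable.Build (measure_tuple_display default_measure_display)
    'rV[R]_n (g_sigma_preimage coords) rV_set0 rV_setC rV_bigcup.

End rV_measurable.

Section lebesgue_rV.
Context {R : realType}.
Local Open Scope ereal_scope.

Lemma measurable_coord n (i : 'I_n) :
  measurable_fun [set: 'rV[R]_n] (fun x : 'rV[R]_n => x ord0 i).
Proof.
move=> _ Y mY; rewrite setTI; apply: sub_sigma_algebra => /=.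
rewrite -bigcup_seq/=; exists i => /=; first by rewrite mem_index_enum.
by exists Y => //; rewrite setTI.
Qed.

Lemma measurable_fun_rV d (T : measurableType d) n (f : T -> 'rV[R]_n) :
  (forall i, measurable_fun [set: T] (fun t => f t ord0 i)) ->
  measurable_fun [set: T] f.
Proof.
move=> mf; apply: (@measurability _ _ _ _ _ _
  (\big[setU/set0]_(i < n) preimage_set_system setT
     (fun x : 'rV[R]_n => x ord0 i) measurable)) => //.
move=> _ [A + <-]; rewrite -bigcup_seq => -[i _ [B mB <-]].
by rewrite setTI -comp_preimage; exact: mf.
Qed.

Definition rV_cons n (p : measurableTypeR R * 'rV[R]_n) : 'rV[R]_n.+1 :=
  row_mx (p.1 : R)%:M p.2.

Definition rV_uncons n (v : 'rV[R]_n.+1) : measurableTypeR R * 'rV[R]_n :=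
  (v ord0 ord0, \row_j v ord0 (lift ord0 j)).

Lemma rV_cons0 n p : @rV_cons n p ord0 ord0 = p.1.
Proof.
rewrite -(_ : lshift n (ord0 : 'I_1) = ord0); last exact/val_inj.
by rewrite [LHS]row_mxEl mxE eqxx mulr1n.
Qed.

Lemma rV_consS n p j : @rV_cons n p ord0 (lift ord0 j) = p.2 ord0 j.
Proof.
rewrite -(_ : rshift 1 j = lift ord0 j); last exact/val_inj.
by rewrite [LHS]row_mxEr.
Qed.

Lemma rV_consK n : cancel (@rV_cons n) (@rV_uncons n).
Proof.
move=> p; rewrite [RHS]surjective_pairing /rV_uncons rV_cons0; congr pair.
by apply/rowP => j; rewrite mxE rV_consS.
Qed.

Lemma measurable_rV_cons n : measurable_fun setT (@rV_cons n).
Proof.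
apply: measurable_fun_rV => i.
have [j ->|->] := unliftP ord0 i.
  under eq_fun do rewrite rV_consS.
  exact: (measurableT_comp (measurable_coord j) measurable_snd).
by under eq_fun do rewrite rV_cons0; exact: measurable_fst.
Qed.

Lemma measurable_rV_uncons n : measurable_fun setT (@rV_uncons n).
Proof.
apply: measurable_fun_pair; first exact: measurable_coord.
apply: measurable_fun_rV => i; under eq_fun do rewrite mxE.
exact: measurable_coord.
Qed.

Section step.
Context {n : nat} (mu : {sigma_finite_measure set 'rV[R]_n -> \bar R}).

Let m : {measure set (measurableTypeR R * 'rV[R]_n)%type -> \bar R} :=
  (@lebesgue_measure R \x mu)%E.

Definition leb_step : set 'rV[R]_n.+1 -> \bar R := pushforward m (@rV_cons n).

Let leb_step0 : leb_step set0 = 0.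
Proof. by rewrite /leb_step /pushforward preimage_set0 measure0. Qed.

Let leb_step_ge0 A : 0 <= leb_step A.
Proof. by rewrite /leb_step /pushforward measure_ge0. Qed.

Let leb_step_sigma_additive : semi_sigma_additive leb_step.
Proof.
have mc A : measurable A -> measurable (@rV_cons n @^-1` A).
  by move=> mA; rewrite -[X in measurable X]setTI; exact: measurable_rV_cons.
move=> F mF tF mUF; rewrite /leb_step /pushforward preimage_bigcup.
apply: measure_semi_sigma_additive.
- by move=> k; exact: mc.
- apply/trivIsetP => /= i j _ _ ij; rewrite -preimage_setI.
  by move/trivIsetP : tF => /(_ _ _ _ _ ij) ->//; rewrite preimage_set0.
- by rewrite -preimage_bigcup; exact: mc.
Qed.

HB.instance Definition _ := isMeasure.Build _ _ _ leb_step
  leb_step0 leb_step_ge0 leb_step_sigma_additive.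

Let leb_step_sigma_finite : sigma_finite setT leb_step.
Proof.
have /sigma_finiteP[F [TF ndF Foo]] := sigma_finiteT (@lebesgue_measure R).
have /sigma_finiteP[G [TG ndG Goo]] := sigma_finiteT mu.
exists (fun k => @rV_uncons n @^-1` (F k `*` G k)).
  rewrite -preimage_bigcup (_ : \bigcup_k _ = setT) ?preimage_setT//.
  rewrite -setXTT TF TG predeqE => -[x y]; split.
    by move=> [k _ []/= ? ?]; split; exists k.
  move=> [/= [k _ Fkx] [l _ Gly]]; exists (maxn k l) => //; split.
  - by move: x Fkx; exact/subsetPset/ndF/leq_maxl.
  - by move: y Gly; exact/subsetPset/ndG/leq_maxr.
move=> k; have [mF Fk] := Foo k; have [mG Gk] := Goo k; split.
  rewrite -[X in measurable X]setTI; apply: measurable_rV_uncons => //.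
  exact: measurableX.
rewrite /leb_step /pushforward -comp_preimage.
rewrite (_ : _ \o _ = id); last by apply/funext => p; exact: rV_consK.
by rewrite preimage_id [X in X < _]product_measure1E// lte_mul_pinfty// ge0_fin_numE.
Qed.

HB.instance Definition _ := Measure_isSigmaFinite.Build _ _ _ leb_step
  leb_step_sigma_finite.

End step.

(* n-dimensional Lebesgue measure: Dirac mass if n = 0, then products. *)
Fixpoint leb n : {sigma_finite_measure set 'rV[R]_n -> \bar R} :=
  match n with
  | 0 => \d_(0%R : 'rV[R]_0)
  | k.+1 => leb_step (leb k)
  end.

End lebesgue_rV.

Section euclidean.
Context {R : realType} {d : nat}.
Implicit Types (x y n : 'rV[R]_d) (A : set 'rV[R]_d).

Definition dot x y : R := \sum_(i < d) x ord0 i * y ord0 i.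

(* MathComp-Analysis norms ['rV[R]_d] by the maximum of the coordinates, which
   has the same topology but not the same distances. *)
Definition enorm x : R := Num.sqrt (dot x x).

Definition diam A : R := sup [set enorm (x - y) | x in A & y in A].

Definition dist_to x A : R := inf [set enorm (x - y) | y in A].

Definition is_hyperplane (H : set 'rV[R]_d) : Prop :=
  exists n, n != 0 /\ exists b : R, H = [set x | dot n x = b].

(* Finite intersections of half-spaces, each of them open ([h.2 = true]) or
   closed ([h.2 = false]). *)
Definition polyhedron A : Prop :=
  exists s : seq ('rV[R]_d * R * bool),
    A = [set x | forall h, h \in s ->
                   dot h.1.1 x < h.1.2 ?<= if ~~ h.2].

(* A polytopal set need not be convex, open or closed. *)
Definition polytopal A : Prop :=
  bounded_set A /\
  exists (k : nat) (P : 'I_k -> set 'rV[R]_d),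
    (forall i, polyhedron (P i)) /\ A = \bigcup_(i in setT) P i.

Definition volume A : R := fine (leb d A).

(* The (d-1)-dimensional measure of a subset of a hyperplane is the Lebesgue
   measure of R^(d-1) carried by an isometric parametrization of that
   hyperplane, y |-> p + y *m Q with Q *m Q^T = 1%:M. *)
Definition param (pQ : 'rV[R]_d * 'M[R]_(d.-1, d)) (y : 'rV[R]_(d.-1)) :
  'rV[R]_d := pQ.1 + y *m pQ.2.

Definition is_param A (pQ : 'rV[R]_d * 'M[R]_(d.-1, d)) : Prop :=
  pQ.2 *m pQ.2^T = 1%:M /\ A `<=` range (param pQ).

(* [get] selects a parametrization; the choice does not affect [surface] and
   [barycenter], because Lebesgue measure is invariant under isometries. *)
Definition face_param A : 'rV[R]_d * 'M[R]_(d.-1, d) :=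
  get [set pQ | is_param A pQ].

Definition face_hyperplane A : set 'rV[R]_d := range (param (face_param A)).

Definition surface A : \bar R := leb d.-1 (param (face_param A) @^-1` A).

Definition area A : R := fine (surface A).

Definition barycenter A : 'rV[R]_d :=
  \row_i ((area A)^-1 *
          \int[leb d.-1]_(y in param (face_param A) @^-1` A)
            param (face_param A) y ord0 i).

Definition orthogonal_to x A : Prop :=
  forall y z, A y -> A z -> dot x (y - z) = 0.

End euclidean.

Section sobolev.
Context {R : realType} {d : nat}.
Implicit Types (Omega : set 'rV[R]_d) (u psi : 'rV[R]_d -> R)
               (phi g : 'rV[R]_d -> 'rV[R]_d).

(* [u \_ Omega] extends the restriction of [u] to [Omega] by 0. *)
Definition L2 Omega u : Prop := u \_ Omega \in Lfun (leb d) 2%:E.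

Definition L2v Omega phi : Prop := forall i, L2 Omega (fun x => phi x ord0 i).

Definition L2norm Omega u : \bar R := 'N[leb d]_2%:E [EFin \o (u \_ Omega)]%E.

Definition L2normv Omega phi : \bar R := L2norm Omega (fun x => enorm (phi x)).

Definition partial (i : 'I_d) u : 'rV[R]_d -> R :=
  fun x => 'D_(delta_mx ord0 i) u x.

Fixpoint partials (s : seq 'I_d) u : 'rV[R]_d -> R :=
  if s is i :: s' then partial i (partials s' u) else u.

Definition smooth u : Prop :=
  forall s : seq 'I_d, continuous (partials s u) /\
    forall i x, derivable (partials s u) x (delta_mx ord0 i).

Definition grad psi : 'rV[R]_d -> 'rV[R]_d := fun x => \row_i partial i psi x.

Definition test_function Omega psi : Prop :=
  smooth psi /\ exists2 C, compact C & C `<=` Omega /\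
                           forall x, ~ C x -> psi x = 0.

Definition is_weak_grad Omega u g : Prop :=
  L2v Omega g /\
  forall psi, test_function Omega psi -> forall i,
    \int[leb d]_(x in Omega) (u x * partial i psi x) =
    - \int[leb d]_(x in Omega) (g x ord0 i * psi x).

(* Weak gradients are unique almost everywhere in [Omega]; [get] selects a
   representative, and an arbitrary value if there is none. *)
Definition weak_grad Omega u : 'rV[R]_d -> 'rV[R]_d :=
  get [set g | is_weak_grad Omega u g].

Definition H1 Omega u : Prop :=
  L2 Omega u /\ exists g, is_weak_grad Omega u g.

(* H^1_0 is the closure of the test functions in H^1. *)
Definition H10 Omega u : Prop :=
  H1 Omega u /\
  exists psi : nat -> 'rV[R]_d -> R,
    [/\ forall k, test_function Omega (psi k),
        L2norm Omega (fun x => psi k x - u x) @[k --> \oo] --> 0%E &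
        L2normv Omega (fun x => grad (psi k) x - weak_grad Omega u x)
          @[k --> \oo] --> 0%E].

Definition is_weak_div Omega phi u : Prop :=
  L2 Omega u /\
  forall psi, test_function Omega psi ->
    \int[leb d]_(x in Omega) dot (phi x) (grad psi x) =
    - \int[leb d]_(x in Omega) (u x * psi x).

Definition weak_div Omega phi : 'rV[R]_d -> R :=
  get [set u | is_weak_div Omega phi u].

End sobolev.

(* [faces K] is E_K, [ext] is E_ext, and E_int is the complement of [ext]. *)
Record mesh (R : realType) (d : nat) := Mesh {
  cell : finType;
  face : finType;
  cellset : cell -> set 'rV[R]_d;
  faceset : face -> set 'rV[R]_d;
  cellpt : cell -> 'rV[R]_d;
  faces : cell -> {set face};
  ext : {set face}
}.

Section discrete.
Context {R : realType} {d : nat}.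
Variables (Omega : set 'rV[R]_d) (T : mesh R d).
Implicit Types (K L : cell T) (s : face T).

(* Faces are required to be polytopal: a relatively open dense subset of a
   facet may have a smaller measure than the facet. *)
Record admissible : Prop := {
  cell_open : forall K, open (cellset K);
  cell_convex : forall K, convex_set (cellset K);
  cell_polytopal : forall K, polytopal (cellset K);
  cell_sub : forall K, cellset K `<=` Omega;
  cell_disjoint : trivIset setT (@cellset _ _ T);
  face_polytopal : forall s, polytopal (faceset s);
  face_sub : forall s, faceset s `<=` closure Omega;
  face_flat : forall s, exists2 H, is_hyperplane H & faceset s `<=` H;
  face_pos : forall s, (0 < surface (faceset s))%E;
  face_disjoint : trivIset setT (@faceset _ _ T);
  mesh_closure : closure (\bigcup_(K in [set: cell T]) cellset K) = closure Omega;
  cell_boundary : forall K,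
    closure (cellset K) `\` cellset K =
    \bigcup_(s in [set` faces K]) closure (faceset s);
  face_cover : forall s, exists K, s \in faces K;
  cellpt_in : forall K, cellset K (cellpt K);
  ext_face : forall s, s \in ext T ->
    [/\ exists! K, s \in faces K,
        faceset s `<=` closure Omega `\` Omega &
        forall K, s \in faces K ->
          exists2 y, faceset s y &
            orthogonal_to (y - cellpt K) (faceset s)];
  int_face : forall s, s \notin ext T ->
    exists K L, [/\ K != L,
      [set M | s \in faces M]%SET = [set K; L]%SET,
      (closure (cellset K) `\` cellset K) `&`
      (closure (cellset L) `\` cellset L) = closure (faceset s) &
      orthogonal_to (cellpt L - cellpt K) (faceset s)]
}.

Definition is_normal K s (n : 'rV[R]_d) : Prop :=
  [/\ enorm n = 1, orthogonal_to n (faceset s) &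
      forall x y, cellset K x -> faceset s y -> dot n (x - y) < 0].

Definition normal K s : 'rV[R]_d := get [set n | is_normal K s n].

Definition dKs K s : R := dist_to (cellpt K) (face_hyperplane (faceset s)).

Definition cone K s : set 'rV[R]_d :=
  [set cellpt K + t *: (y - cellpt K) | t in `]0%R, 1%R[ & y in faceset s].

Definition theta : R :=
  inf [set r | exists K s, s \in faces K /\ r = dKs K s / diam (cellset K)].

(* ((u_K)_K, (u_s)_s) *)
Definition discrete : Type := ((cell T -> R) * (face T -> R))%type.

Definition XT : set discrete := [set u | forall s, s \in ext T -> u.2 s = 0].

(* The cells, and the cones [cone K s], are pairwise disjoint, so that at most
   one term of each of the following sums is nonzero at a given point; they
   cover [Omega] up to a null set. *)
Definition reconstruct (u : discrete) (x : 'rV[R]_d) : R :=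
  \sum_K u.1 K * \1_(cellset K) x.

Definition slope (u : discrete) K s : R := (u.2 s - u.1 K) / dKs K s.

Definition GT (u : discrete) (x : 'rV[R]_d) : R :=
  \sum_K \sum_(s in faces K) slope u K s * \1_(cone K s) x.

Definition nablaT (u : discrete) (x : 'rV[R]_d) : 'rV[R]_d :=
  \sum_K \sum_(s in faces K)
    (d%:R * slope u K s * \1_(cone K s) x) *: normal K s.

Definition nablahatT (u : discrete) (x : 'rV[R]_d) : 'rV[R]_d :=
  \sum_K \1_(cellset K) x *:
    ((volume (cellset K))^-1 *:
     \sum_(s in faces K)
       (area (faceset s) * slope u K s) *:
         (barycenter (faceset s) - cellpt K)).

Definition normT (u : discrete) : \bar R :=
  ((Num.sqrt d%:R)%:E * L2norm Omega (GT u))%E.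

Definition zeta (phi : 'rV[R]_d -> 'rV[R]_d) : \bar R :=
  ereal_sup [set (\int[leb d]_(x in Omega)
                    (weak_div Omega phi x * reconstruct v x
                     + dot (phi x) (nablaT v x)))%:E
            | v in [set v | XT v /\ normT v = 1%E]].

Definition calGT (u : 'rV[R]_d -> R) (x : 'rV[R]_d) : R :=
  \sum_K \sum_(s in faces K)
    ((volume (cone K s))^-1 *
     \int[leb d]_(y in cone K s) dot (weak_grad Omega u y) (normal K s))
    * \1_(cone K s) x.

Definition delta (u : 'rV[R]_d -> R) (v : discrete) : \bar R :=
  ((diam Omega)^-1%:E * L2norm Omega (fun x => (u x - reconstruct v x)%R)
   + (Num.sqrt d%:R)%:E * L2norm Omega (fun x => (calGT u x - GT v x)%R))%E.

Definition Theta (phi : 'rV[R]_d -> 'rV[R]_d) : \bar R :=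
  ((\sum_(K : cell T)
      \int[leb d]_(y in cellset K) \int[leb d]_(x in cellset K)
        ((volume (cellset K))^-1 * enorm (phi y - phi x) ^+ 2)%:E)
   `^ 2^-1)%E.

Definition weak_solution (f : 'rV[R]_d -> R) (F : 'rV[R]_d -> 'rV[R]_d)
    (u : 'rV[R]_d -> R) : Prop :=
  H10 Omega u /\
  forall phi, H10 Omega phi ->
    \int[leb d]_(x in Omega) dot (weak_grad Omega u x) (weak_grad Omega phi x)
    = \int[leb d]_(x in Omega)
        (f x * phi x - dot (F x) (weak_grad Omega phi x)).

Definition scheme_solution (f : 'rV[R]_d -> R) (F : 'rV[R]_d -> 'rV[R]_d)
    (u : discrete) : Prop :=
  XT u /\
  forall v, XT v ->
    d%:R * \int[leb d]_(x in Omega) (GT u x * GT v x) =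
    \int[leb d]_(x in Omega)
      (f x * reconstruct v x - dot (F x) (nablaT v x)).

End discrete.

(* Main.v *)
Require Import Defs.
From mathcomp Require Import all_boot all_order all_algebra.
From mathcomp Require Import all_classical all_reals all_analysis.
From mathcomp Require Import measurable_realfun ring lra.
Import Order.TTheory GRing.Theory Num.Theory.
Import numFieldNormedType.Exports.
Set Implicit Arguments.
Unset Strict Implicit.
Unset Printing Implicit Defensive.
Local Open Scope classical_set_scope.
Local Open Scope ring_scope.

(* Splitting a cell K into the cones over its faces from two different apices
   and comparing the integrals of an affine function gives
   Sum_s |s| (n_s . w) (e . (xbar_s - x_K)) = |K| e . w. Hence, at x in K,
   nablahat u - grad ubar is |K|^-1 times the sum over the faces of
   |s| (slope_s - n_s . grad ubar(x)) (xbar_s - x_K). Since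
   |xbar_s - x_K| <= diam K <= d_{K,s} / theta and |s| d_{K,s} = d |D_{K,s}|,
   its norm is at most d / theta times the sum of the mean over K of
   |G u - calG ubar| and of the mean over y in K of |grad ubar(y) - grad ubar(x)|;
   the Cauchy-Schwarz and Minkowski inequalities conclude.

   For the second estimate, let phi = grad ubar + F. The two variational
   problems give, for v in X_T,
   d int (calG ubar - G u) G v = int (div phi v + phi . nabla_T v)
   <= zeta(phi) |v|_T; taking v = w - u bounds |G u - calG ubar| by
   zeta(phi) + 2 |calG ubar - G w|. The weak gradient and divergence being
   chosen representatives, this uses their uniqueness almost everywhere, that
   is the fundamental lemma of the calculus of variations, and the fact that
   the classical gradient of a test function is its weak gradient, which follows
   from the translation invariance of the Lebesgue measure. *)


(** * Lebesgue measure on row vectors *)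

(** The first identity takes the place of Gauss's formula on a polytope. For an affine g and any
    apex x in K, (d+1) int_K g = |K| g(x) + Sum_s |s| h_s(x) g(xbar_s), where h_s(x) is the distance
    from x to the hyperplane of s. The left side does not depend on x, and h_s(x) - h_s(y) = n_s .
    (y - x), so moving the apex by -t w and dividing by t yields the identity. The formula requires
    the cones over the faces to fill K up to a null set. The mesh only provides closure K minus K as
    a union of closed faces; the gap between a face and its closure is null because a finite union
    of polyhedra differs from its closure by a null set. The same fact prevents the hyperplane of a
    face from cutting its cell, so that heights are positive at every apex. The factor 2 (1 + diam
    Omega) is reached from |G u - calG ubar| <= zeta + 2 e with e = |calG ubar - G w|: since sqrt d
    >= 1, e is at most delta(ubar, w), and 2 is at most the factor. *)

Section measurability.
Context {R : realType}.

Lemma measurable_mulmx m n (M : 'M[R]_(m, n)) :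
  measurable_fun setT (fun x : 'rV[R]_m => x *m M).
Proof.
apply: measurable_fun_rV => i; under eq_fun do rewrite mxE.
by apply: measurable_sum => j; apply: measurable_funM => //; exact: measurable_coord.
Qed.

Lemma measurable_funD_rV d (T : measurableType d) n (f g : T -> 'rV[R]_n) :
  measurable_fun setT f -> measurable_fun setT g ->
  measurable_fun setT (fun x => f x + g x).
Proof.
move=> mf mg; apply: measurable_fun_rV => i; under eq_fun do rewrite mxE.
apply: measurable_funD.
  exact: (measurableT_comp (measurable_coord i) mf).
exact: (measurableT_comp (measurable_coord i) mg).
Qed.

Lemma measurable_funZ_rV d (T : measurableType d) n (c : T -> R) (f : T -> 'rV[R]_n) :
  measurable_fun setT c -> measurable_fun setT f ->
  measurable_fun setT (fun x => c x *: f x).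
Proof.
move=> mf mg; apply: measurable_fun_rV => i; under eq_fun do rewrite mxE.
apply: measurable_funM => //.
exact: (measurableT_comp (measurable_coord i) mg).
Qed.

Lemma measurable_fun_dot d (T : measurableType d) n (f g : T -> 'rV[R]_n) :
  measurable_fun setT f -> measurable_fun setT g ->
  measurable_fun setT (fun x => dot (f x) (g x)).
Proof.
move=> mf mg; apply: measurable_sum => i; apply: measurable_funM.
  exact: (measurableT_comp (measurable_coord i) mf).
exact: (measurableT_comp (measurable_coord i) mg).
Qed.

Lemma measurable_affine m n (c : 'rV[R]_n) (M : 'M[R]_(m, n)) :
  measurable_fun setT (fun x : 'rV[R]_m => c + x *m M).
Proof. by apply: measurable_funD_rV => //; exact: measurable_mulmx. Qed.

End measurability.

(** * Translations and linear changes of variables for [leb] *)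

Section change_of_variables.
Context {R : realType}.
Local Open Scope ereal_scope.
Local Opaque leb.

(** The preimage of a half-open interval is an interval whose length is divided by |a|, so |a| times
    the pushforward agrees with the Lebesgue measure on intervals, hence everywhere by
    uniqueness. *)
Lemma ge0_integral_lebesgue_affine (a b : R) (f : R -> \bar R) : a != 0%R ->
  measurable_fun setT f -> (forall x, 0 <= f x) ->
  \int[@lebesgue_measure R]_x f (a * x + b)%R =
  `|a|^-1%:E * \int[@lebesgue_measure R]_x f x.
Proof.
move=> a0 mf f0.
pose h (x : measurableTypeR R) : measurableTypeR R := (a * x + b)%R.
have mh : measurable_fun setT h.
  by apply: measurable_funD => //; exact: measurable_funM.
have ia0 : (0 <= `|a|)%R by [].
have hm : forall A, measurable A ->
    @lebesgue_measure R A = mscale (NngNum ia0) (pushforward lebesgue_measure h) A.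
  move=> mm; apply: lebesgue_measure_unique => _ [[u v] /= _ <-].
  rewrite /mscale /= /pushforward lebesgue_measure_itv /=.
  have [ap|an|a00] := ltgtP 0%R a; last by rewrite a00 eqxx in a0.
    rewrite (_ : h @^-1` _ = `](u - b) / a, (v - b) / a]%classic%R); last first.
      apply/seteqP; split => x /=; rewrite !in_itv /= /h.
        by rewrite ltr_pdivrMr// ler_pdivlMr// (mulrC x); lra.
      by rewrite ltr_pdivrMr// ler_pdivlMr// (mulrC x); lra.
    rewrite lebesgue_measure_itv /= gtr0_norm// !lte_fin ltr_pM2r ?invr_gt0//.
    rewrite ltrD2r; case: ifPn => _; last by rewrite mule0.
    by rewrite -!EFinD -EFinM; congr EFin; field.
  (* A negative slope exchanges the open and the closed end. *)
  rewrite (_ : h @^-1` _ = `[(v - b) / a, (u - b) / a[%classic%R); last first.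
    apply/seteqP; split => x /=; rewrite !in_itv /= /h.
      by rewrite ltr_ndivlMr// ler_ndivrMr// (mulrC x); lra.
    by rewrite ltr_ndivlMr// ler_ndivrMr// (mulrC x); lra.
  rewrite lebesgue_measure_itv /= ltr0_norm// !lte_fin ltr_nM2r ?invr_lt0//.
  rewrite ltrD2r; case: ifPn => _; last by rewrite mule0.
  by rewrite -!EFinD -EFinM; congr EFin; field.
rewrite [in RHS](eq_measure_integral (mscale (NngNum ia0) (pushforward lebesgue_measure h))); last first.
  by move=> A mA _; exact: (hm mh).
rewrite ge0_integral_mscale//= ge0_integral_pushforward//=.
by rewrite muleA -EFinM mulVf ?normr_eq0// mul1e preimage_setT.
Qed.

Lemma ge0_integral_leb_cons n (f : 'rV[R]_n.+1 -> \bar R) :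
  measurable_fun setT f -> (forall x, 0 <= f x) ->
  \int[leb n.+1]_x f x =
  \int[lebesgue_measure]_t \int[leb n]_v f (rV_cons (t, v)).
Proof.
move=> mf f0.
have mfc := measurableT_comp mf (@measurable_rV_cons R n).
Local Transparent leb.
transitivity (\int[pushforward (lebesgue_measure \x leb n)%E (@rV_cons R n)]_x f x); first by [].
Local Opaque leb.
rewrite ge0_integral_pushforward//=; last exact: measurable_rV_cons.
by rewrite preimage_setT (fubini_tonelli1 (f \o @rV_cons R n))// => x; exact: f0.
Qed.

Lemma ge0_integral_leb_cons2 n (f : 'rV[R]_n.+1 -> \bar R) :
  measurable_fun setT f -> (forall x, 0 <= f x) ->
  \int[leb n.+1]_x f x =
  \int[leb n]_v \int[lebesgue_measure]_t f (rV_cons (t, v)).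
Proof.
move=> mf f0.
have mfc := measurableT_comp mf (@measurable_rV_cons R n).
by rewrite ge0_integral_leb_cons// (fubini_tonelli (f \o @rV_cons R n))// => x; exact: f0.
Qed.

Lemma ge0_integral_lebesgue_shift (b : R) (f : R -> \bar R) :
  measurable_fun setT f -> (forall x, 0 <= f x) ->
  \int[@lebesgue_measure R]_x f (x + b)%R = \int[@lebesgue_measure R]_x f x.
Proof.
move=> mf f0; have := @ge0_integral_lebesgue_affine 1 b f (oner_neq0 R) mf f0.
by rewrite normr1 invr1 mul1e => <-; apply: eq_integral => x _; rewrite mul1r.
Qed.

Lemma measurable_rV_section n (f : 'rV[R]_n.+1 -> \bar R) t :
  measurable_fun setT f -> measurable_fun setT (fun v => f (rV_cons (t, v))).
Proof.
move=> mf; apply: (measurableT_comp mf).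
exact: (measurableT_comp (@measurable_rV_cons R n) (pair1_measurable t)).
Qed.

Lemma measurable_rV_section2 n (f : 'rV[R]_n.+1 -> \bar R) v :
  measurable_fun setT f -> measurable_fun setT (fun t => f (rV_cons (t, v))).
Proof.
move=> mf; apply: (measurableT_comp mf).
exact: (measurableT_comp (@measurable_rV_cons R n) (pair2_measurable v)).
Qed.

Lemma rV_consD n t u (v w : 'rV[R]_n) :
  rV_cons (t + u, v + w)%R = (rV_cons (t, v) + rV_cons (u, w))%R.
Proof. by rewrite /rV_cons /= raddfD -add_row_mx. Qed.

Lemma rV_unconsK n (c : 'rV[R]_n.+1) : rV_cons (rV_uncons c) = c.
Proof.
apply/rowP => i; have [j ->|->] := unliftP ord0 i; last by rewrite rV_cons0.
by rewrite rV_consS mxE.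
Qed.

Lemma ge0_integral_leb_shift n (c : 'rV[R]_n) (f : 'rV[R]_n -> \bar R) :
  measurable_fun setT f -> (forall x, 0 <= f x) ->
  \int[leb n]_x f (x + c)%R = \int[leb n]_x f x.
Proof.
elim: n c f => [|n IH] c f mf f0.
  by apply: eq_integral => x _; rewrite (thinmx0 c) addr0.
have msh : measurable_fun setT (fun x : 'rV[R]_n.+1 => (x + c)%R).
  by apply: measurable_funD_rV.
rewrite (ge0_integral_leb_cons (measurableT_comp mf msh) (fun x => f0 _)).
rewrite (ge0_integral_leb_cons mf f0).
pose F t := \int[leb n]_v f (rV_cons (t, v)).
have F0 x : 0 <= F x by apply: integral_ge0.
have mF : measurable_fun setT F.
  apply: (measurable_fun_fubini_tonelli_F (f \o @rV_cons R n)) => //.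
    exact: (measurableT_comp mf (@measurable_rV_cons R n)).
  by move=> x; exact: f0.
rewrite -[RHS](ge0_integral_lebesgue_shift (rV_uncons c).1 mF F0).
apply: eq_integral => t _; rewrite /F.
rewrite -[RHS](IH (rV_uncons c).2)//; last exact: measurable_rV_section.
apply: eq_integral => v _; rewrite rV_consD -surjective_pairing.
by rewrite rV_unconsK.
Qed.

(** The change of variables for one matrix, as a property stable under products; it is checked on
    triangular block factors. *)
Let covP n (M : 'M[R]_n) := forall f, measurable_fun setT f -> (forall x, 0 <= f x) ->
  \int[leb n]_x f (x *m M)%R = `|\det M|^-1%:E * \int[leb n]_x f x.

Let covP_mul n (M N : 'M[R]_n) : covP M -> covP N -> covP (M *m N).
Proof.
move=> PM PN f mf f0; under eq_integral do rewrite mulmxA.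
rewrite (PM (fun x => f (x *m N)%R))//; last exact: (measurableT_comp mf (measurable_mulmx N)).
by rewrite PN// muleA -EFinM det_mulmx normrM invfM.
Qed.

(** With the last coordinates v fixed, the map translates the first coordinate by v c. Integrating
    the first coordinate innermost reduces to one-dimensional translation invariance. *)
Let covP_shear n (c : 'cV[R]_n) : covP (block_mx 1%:M 0 c 1%:M : 'M[R]_(1 + n)).
Proof.
move=> f mf f0; set M := block_mx _ _ _ _.
have mfM : measurable_fun setT (fun x => f (x *m M)) := measurableT_comp mf (measurable_mulmx M).
rewrite det_lblock !det1 mulr1 normr1 invr1 mul1e.
rewrite (ge0_integral_leb_cons2 mfM (fun x => f0 _)) (ge0_integral_leb_cons2 mf f0).
apply: eq_integral => v _.
rewrite -[RHS](ge0_integral_lebesgue_shift ((v *m c) ord0 ord0)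
  (measurable_rV_section2 v mf) (fun t => f0 _)).
apply: eq_integral => t _; congr f.
rewrite /rV_cons /= /M mul_row_block !mulmx1 mulmx0 add0r raddfD /=.
by rewrite -[in RHS]mx11_scalar.
Qed.

(** The first coordinate t is scaled by a; with t fixed, the others undergo v |-> v S + t b, handled
    by [S] and a translation. *)
Let covP_ublock n (a : R) (b : 'rV[R]_n) (S : 'M[R]_n) : a != 0%R -> covP S ->
  covP (block_mx a%:M b 0 S : 'M[R]_(1 + n)).
Proof.
move=> a0 PS f mf f0; set M := block_mx _ _ _ _.
have mfM : measurable_fun setT (fun x => f (x *m M)) := measurableT_comp mf (measurable_mulmx M).
rewrite det_ublock det_scalar1 normrM invfM EFinM.
rewrite (ge0_integral_leb_cons mfM (fun x => f0 _)) (ge0_integral_leb_cons mf f0).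
pose F t := \int[leb n]_v f (rV_cons (t, v)).
have F0 x : 0 <= F x by apply: integral_ge0.
have mF : measurable_fun setT F.
  apply: (measurable_fun_fubini_tonelli_F (f \o @rV_cons R n)) => //.
    exact: (measurableT_comp mf (@measurable_rV_cons R n)).
  by move=> x; exact: f0.
rewrite [X in _ * X]/(\int[lebesgue_measure]_t F t).
rewrite muleAC -(ge0_integral_lebesgue_affine 0 a0 mF F0).
have mFa : measurable_fun setT (fun t => F (a * t + 0)%R).
  apply: (measurableT_comp mF); exact: measurable_funD.
rewrite muleC -(ge0_integralZl lebesgue_measure measurableT mFa) => [|t _|]; last 2 first.
- exact: F0.
- by rewrite lee_fin invr_ge0.
apply: eq_integral => t _.
pose g w := f (rV_cons ((a * t)%R, (w + t *: b)%R)).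
have mg : measurable_fun setT g.
  apply: (measurableT_comp (measurable_rV_section (a * t)%R mf)).
  exact: measurable_funD_rV.
transitivity (\int[leb n]_v g (v *m S)).
  apply: eq_integral => v _; congr f.
  by rewrite /rV_cons /= /M mul_row_block mulmx0 addr0 mul_scalar_mx scale_scalar_mx
    mul_scalar_mx mulrC addrC.
rewrite (PS g mg (fun x => f0 _)); congr (_ * _).
rewrite (ge0_integral_leb_shift (t *: b) (measurable_rV_section (a * t)%R mf)
  (fun x => f0 _)).
by rewrite /F addr0.
Qed.

(** One step of Gaussian elimination: M is a shear times an upper block matrix whose lower block is
    the Schur complement of the corner, invertible since M is. *)
Let covP_corner n (M : 'M[R]_(1 + n)) : M ord0 ord0 != 0%R -> \det M != 0%R ->
  (forall S : 'M[R]_n, \det S != 0%R -> covP S) -> covP M.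
Proof.
move=> a0 dM PS; set a := M ord0 ord0 in a0.
set b := ursubmx M; set c := dlsubmx M; set D := drsubmx M.
have Ea : ulsubmx M = a%:M.
  rewrite [LHS]mx11_scalar; congr (_%:M).
  by rewrite /ulsubmx !mxE; congr (M _ _); apply/val_inj.
have EM : M = block_mx 1%:M 0 (a^-1 *: c) 1%:M *m
              block_mx a%:M b 0 (D - a^-1 *: (c *m b)).
  rewrite mulmx_block !mul1mx !mul0mx !addr0 mul_mx_scalar scalerA divff//.
  by rewrite scale1r -scalemxAl subrKC -[LHS]submxK Ea.
rewrite EM; apply: covP_mul; first exact: covP_shear.
apply: covP_ublock => //; apply: PS; apply: contra_neq dM => dS.
by rewrite EM det_mulmx det_ublock dS !mulr0.
Qed.

Let shear_corner n (M : 'M[R]_(1 + n)) (c : 'cV[R]_n) :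
  (M *m (block_mx 1%:M 0 c 1%:M : 'M[R]_(1 + n))) (lshift n ord0) (lshift n ord0) =
  (M (lshift n ord0) (lshift n ord0) + (ursubmx M *m c) ord0 ord0)%R.
Proof.
rewrite -[in LHS](submxK M) mulmx_block block_mxEul mulmx1 mxE.
by rewrite /ulsubmx !mxE.
Qed.

(** Induction on the dimension by elimination of the first row and column, after making the corner
    nonzero if necessary. *)
Theorem ge0_integral_leb_mulmx n (M : 'M[R]_n) (f : 'rV[R]_n -> \bar R) :
  \det M != 0%R -> measurable_fun setT f -> (forall x, 0 <= f x) ->
  \int[leb n]_x f (x *m M)%R = `|\det M|^-1%:E * \int[leb n]_x f x.
Proof.
move=> + mf f0; move: f mf f0 => + + + dM; rewrite -/(covP M); move: dM.
elim: n M => [|n IH] M dM; rewrite -/(covP M).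
  move=> f mf f0; rewrite det_mx00 normr1 invr1 mul1e.
  by apply: eq_integral => x _; congr f; rewrite [RHS]thinmx0 thinmx0.
have [a0|] := eqVneq ((M : 'M[R]_(1 + n)) ord0 ord0) 0%R; last by move=> a0; exact: covP_corner.
have dM' : \det (M : 'M[R]_(1 + n)) != 0%R by [].
(* When the corner vanishes, the shear of column b^T, with b the rest of the first row, turns it
   into b b^T. This is nonzero, since otherwise the whole first row would be zero. The opposite
   shear restores M. *)
pose b := ursubmx (M : 'M[R]_(1 + n)).
pose L (s : R) : 'M[R]_(1 + n) := block_mx 1%:M 0 (s *: b^T) 1%:M.
have EM : (M : 'M[R]_(1 + n)) = (M *m L 1%R) *m L (-1)%R.
  suff LL : L 1%R *m L (-1)%R = 1%:M by rewrite -[RHS]mulmxA LL mulmx1.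
  rewrite /L mulmx_block !mul1mx !mul0mx !mulmx0 !mulmx1 !addr0 add0r.
  by rewrite -scalerDl subrr scale0r -scalar_mx_block.
have dL s : \det (L s) = 1%R by rewrite det_lblock !det1 mulr1.
rewrite EM; apply: covP_mul; last exact: covP_shear.
apply: covP_corner => //; last by rewrite det_mulmx dL mulr1.
have b0 : b != 0%R.
  apply: contra_neq dM' => b0; rewrite -(submxK (M : 'M[R]_(1 + n))) -/b b0.
  rewrite det_lblock det_mx11 /ulsubmx !mxE.
  rewrite (_ : (M : 'M[R]_(1 + n)) _ _ = 0%R) ?mul0r// -[RHS]a0.
  by congr (M _ _); apply/val_inj.
have -> : (M *m L 1%R) ord0 ord0 = (b *m b^T) ord0 ord0.
  have -> : ord0 = lshift n ord0 :> 'I_(1 + n) by exact/val_inj.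
  rewrite [LHS]shear_corner scale1r -[RHS]add0r; congr (_ + _)%R.
  by rewrite -[RHS]a0; congr (M _ _); apply/val_inj.
apply: contra_neq b0 => bb; apply/rowP => j; rewrite [RHS]mxE.
move: bb; rewrite mxE => /eqP; rewrite psumr_eq0 => [/allP/(_ j)|i _]; last first.
  by rewrite [b^T _ _]mxE -expr2 sqr_ge0.
by rewrite mem_index_enum [b^T _ _]mxE mulf_eq0 orbb => /(_ isT)/eqP.
Qed.

Lemma leb_affine_preimage n (c : 'rV[R]_n) (M : 'M[R]_n) A : \det M != 0%R ->
  measurable A ->
  leb n [set x | A (c + x *m M)%R] = `|\det M|^-1%:E * leb n A.
Proof.
move=> dM mA.
have mB : measurable [set x | A (c + x *m M)%R].
  by rewrite -[X in measurable X]setTI; exact: measurable_affine.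
rewrite -[LHS]mul1e -[in LHS](setIT [set x | _]) -[RHS]mul1e -[in RHS](setIT A).
rewrite -!integral_indic// mul1e muleCA mul1e.
have mi : measurable_fun setT (fun x => (\1_A x)%:E : \bar R).
  by apply/measurable_EFinP; exact: measurable_indic.
rewrite -(ge0_integral_leb_shift c mi)//.
rewrite -(@ge0_integral_leb_mulmx n M (fun x => (\1_A (x + c))%:E))//.
  by apply: eq_integral => x _; rewrite addrC !indicE.
by apply: (measurableT_comp mi); exact: measurable_funD_rV.
Qed.

End change_of_variables.

(** * Finiteness of the measure of bounded sets *)

Section leb_sets.
Context {R : realType}.
Local Opaque leb.

Lemma measurable_coord_preimage n (i : 'I_n) (B : set R) : measurable B ->
  measurable [set x : 'rV[R]_n | B (x ord0 i)].
Proof. by move=> mB; rewrite -[X in measurable X]setTI; exact: measurable_coord. Qed.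

Definition box n (P : 'I_n -> set R) : set 'rV[R]_n := [set x | forall i, P i (x ord0 i)].

Lemma measurable_box n (P : 'I_n -> set R) : (forall i, measurable (P i)) ->
  measurable (box P).
Proof.
move=> mP; have -> : box P = \bigcap_(i in [set: 'I_n]) [set x | P i (x ord0 i)].
  by apply/seteqP; split => [x Px i _|x Px i]; exact: Px.
by apply: fin_bigcap_measurable => [|i _]; [exact: finite_finset|exact: measurable_coord_preimage].
Qed.

Lemma leb_integral_indic n (A : set 'rV[R]_n) : measurable A ->
  (leb n A = \int[leb n]_x (\1_A x)%:E)%E.
Proof. by move=> mA; rewrite integral_indic// setIT. Qed.

Lemma leb_box_lty n (P : 'I_n -> set R) : (forall i, measurable (P i)) ->
  (forall i, (lebesgue_measure (P i) < +oo)%E) -> (leb n (box P) < +oo)%E.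
Proof.
elim: n P => [|n IH] P mP Poo.
  Local Transparent leb.
  rewrite /= diracE; exact: ltry.
  Local Opaque leb.
have mB := measurable_box mP.
rewrite leb_integral_indic// ge0_integral_leb_cons//; last first.
  by apply/measurable_EFinP; exact: measurable_indic.
have mB' : measurable (box (fun i => P (lift ord0 i))) by exact: measurable_box.
rewrite (_ : (fun t => _) = (fun t => (\1_(P ord0) t)%:E *
   leb n (box (fun i => P (lift ord0 i))))%E); last first.
  apply/funext => t; rewrite leb_integral_indic//.
  rewrite -ge0_integralZl//; last first.
    by apply/measurable_EFinP; exact: measurable_indic.
  apply: eq_integral => v _; rewrite -EFinM !indicE; congr EFin.
  rewrite -natrM mulnb; congr (_%:R); congr nat_of_bool.
  apply/idP/andP => [/set_mem Bx|[/set_mem H1 /set_mem H2]].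
    split; apply/mem_set; first by have := Bx ord0; rewrite rV_cons0.
    by move=> i; have := Bx (lift ord0 i); rewrite rV_consS.
  apply/mem_set => i; have [j ->|->] := unliftP ord0 i; last by rewrite rV_cons0.
  by rewrite rV_consS; exact: H2.
have mi : measurable_fun setT (fun t : R => ((\1_(P ord0) t)%:E : \bar R)).
  by apply/measurable_EFinP; exact: measurable_indic.
rewrite (ge0_integralZr lebesgue_measure measurableT mi)//.
have -> : (\int[lebesgue_measure]_x (\1_(P ord0) x)%:E = lebesgue_measure (P ord0))%E.
  rewrite integral_indic; last exact: mP.
    by congr (lebesgue_measure _); exact: setIT.
  exact: measurableT.
rewrite lte_mul_pinfty//; last exact: IH.
by rewrite ge0_fin_numE.
Qed.

Lemma norm_coord_le n (x : 'rV[R]_n) i : `|x ord0 i| <= `|x|.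
Proof.
rewrite [leRHS]/Num.norm /= mx_normrE.
by apply: (le_bigmax _ (fun ij => `|x ij.1 ij.2|) (ord0, i)).
Qed.

Lemma bounded_leb_lty n (A : set 'rV[R]_n) : bounded_set A -> measurable A ->
  (leb n A < +oo)%E.
Proof.
move=> [M [_ /(_ (M + 1))]]; rewrite ltrDl ltr01 => /(_ isT) HM mA.
pose P (i : 'I_n) := `[- (M + 1), M + 1]%classic : set R.
have mP i : measurable (P i) by exact: measurable_itv.
apply: (@le_lt_trans _ _ (leb n (box P))).
  apply: le_measure; rewrite ?inE//; first exact: measurable_box.
  move=> x Ax i; rewrite /P /= in_itv /= -ler_norml.
  exact: le_trans (norm_coord_le _ _) (HM _ Ax).
apply: leb_box_lty => // i; rewrite /P lebesgue_measure_itv /=.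
by case: ifP => // _; rewrite -EFinD ltry.
Qed.

End leb_sets.

(** * Scalar product and Euclidean norm *)

Section dot_theory.
Context {R : realType} {n : nat}.
Implicit Types x y z : 'rV[R]_n.

Lemma dotC x y : dot x y = dot y x.
Proof. by apply: eq_bigr => i _; rewrite mulrC. Qed.

Lemma dotDl x y z : dot (x + y) z = dot x z + dot y z.
Proof. by rewrite /dot -big_split; apply: eq_bigr => i _; rewrite mxE mulrDl. Qed.

Lemma dotDr x y z : dot z (x + y) = dot z x + dot z y.
Proof. by rewrite !(dotC z) dotDl. Qed.

Lemma dotZl a x y : dot (a *: x) y = a * dot x y.
Proof. by rewrite /dot mulr_sumr; apply: eq_bigr => i _; rewrite mxE mulrA. Qed.

Lemma dotZr a x y : dot x (a *: y) = a * dot x y.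
Proof. by rewrite dotC dotZl dotC. Qed.

Lemma dotNl x y : dot (- x) y = - dot x y.
Proof. by rewrite -scaleN1r dotZl mulN1r. Qed.

Lemma dotNr x y : dot x (- y) = - dot x y.
Proof. by rewrite dotC dotNl dotC. Qed.

Lemma dotBl x y z : dot (x - y) z = dot x z - dot y z.
Proof. by rewrite dotDl dotNl. Qed.

Lemma dotBr x y z : dot z (x - y) = dot z x - dot z y.
Proof. by rewrite dotDr dotNr. Qed.

Lemma dot0l x : dot 0 x = 0.
Proof. by rewrite -(scale0r 0) dotZl mul0r. Qed.

Lemma dot0r x : dot x 0 = 0. Proof. by rewrite dotC dot0l. Qed.

Lemma dot_suml I (r : seq I) P (F : I -> 'rV[R]_n) y :
  dot (\sum_(i <- r | P i) F i) y = \sum_(i <- r | P i) dot (F i) y.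
Proof.
by apply: (big_morph (fun x => dot x y)) => [? ?|]; [rewrite dotDl|rewrite dot0l].
Qed.

Lemma dotxx_ge0 x : 0 <= dot x x.
Proof. by apply: sumr_ge0 => i _; rewrite -expr2 sqr_ge0. Qed.

Lemma dotxx_eq0 x : (dot x x == 0) = (x == 0).
Proof.
apply/idP/eqP => [|->]; last by rewrite dot0l.
rewrite psumr_eq0 => [/allP h|i _]; last by rewrite -expr2 sqr_ge0.
apply/rowP => i; have := h i; rewrite mem_index_enum => /(_ isT).
by rewrite mulf_eq0 orbb mxE => /eqP.
Qed.

Lemma dotxx_gt0 x : (0 < dot x x) = (x != 0).
Proof. by rewrite lt_neqAle dotxx_ge0 andbT eq_sym dotxx_eq0. Qed.

Lemma mulmx_tr_dot x y : x *m y^T = (dot x y)%:M.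
Proof.
rewrite [LHS]mx11_scalar; congr (_%:M); rewrite mxE; apply: eq_bigr => i _.
by rewrite [y^T _ _]mxE.
Qed.

Lemma enorm_ge0 x : 0 <= enorm x. Proof. exact: sqrtr_ge0. Qed.

Lemma enorm_sqr x : enorm x ^+ 2 = dot x x.
Proof. by rewrite sqr_sqrtr ?dotxx_ge0. Qed.

Lemma enorm0 : enorm (0 : 'rV[R]_n) = 0. Proof. by rewrite /enorm dot0l sqrtr0. Qed.

Lemma enorm_eq0 x : (enorm x == 0) = (x == 0).
Proof. by rewrite sqrtr_eq0 le_eqVlt ltNge dotxx_ge0 orbF dotxx_eq0. Qed.

Lemma enorm_gt0 x : (0 < enorm x) = (x != 0).
Proof. by rewrite lt_neqAle enorm_ge0 andbT eq_sym enorm_eq0. Qed.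

Lemma enormN x : enorm (- x) = enorm x.
Proof. by rewrite /enorm dotNl dotNr opprK. Qed.

Lemma enormZ a x : enorm (a *: x) = `|a| * enorm x.
Proof. by rewrite /enorm dotZl dotZr mulrA -expr2 sqrtrM ?sqr_ge0// sqrtr_sqr. Qed.

Lemma cauchy_schwarz x y : `|dot x y| <= enorm x * enorm y.
Proof.
have [->|y0] := eqVneq y 0; first by rewrite dot0r normr0 enorm0 mulr0.
have yp : 0 < dot y y by rewrite dotxx_gt0.
rewrite -(@ler_pXn2r _ 2)// ?nnegrE ?mulr_ge0 ?enorm_ge0//.
rewrite real_normK ?num_real// exprMn !enorm_sqr.
(* The square of this multiple of the component of x orthogonal to y is (y.y) ((x.x) (y.y) -
   (x.y)^2). *)
have := dotxx_ge0 (dot y y *: x - dot x y *: y).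
rewrite !(dotBl, dotBr, dotZl, dotZr) (dotC y x).
set a := dot x x; set b := dot x y; set c := dot y y.
rewrite (_ : _ - _ = c * (a * c - b ^+ 2)); last by ring.
by rewrite pmulr_rge0// subr_ge0.
Qed.

Lemma dot_le_enorm x y : dot x y <= enorm x * enorm y.
Proof. exact: le_trans (ler_norm _) (cauchy_schwarz x y). Qed.

Lemma enorm_le_norm x : enorm x <= Num.sqrt n%:R * `|x|.
Proof.
rewrite -(@ler_pXn2r _ 2)// ?nnegrE ?mulr_ge0 ?enorm_ge0// ?sqrtr_ge0//.
rewrite enorm_sqr exprMn sqr_sqrtr//.
apply: (@le_trans _ _ (\sum_(i < n) `|x| ^+ 2)).
  apply: ler_sum => i _; rewrite -expr2 -real_normK ?num_real//.
  by rewrite ler_pXn2r ?nnegrE// norm_coord_le.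
by rewrite sumr_const card_ord mulr_natl.
Qed.

Lemma norm_le_enorm x : `|x| <= enorm x.
Proof.
rewrite [leLHS]/Num.norm /= mx_normrE; apply/bigmax_leP; split; first exact: enorm_ge0.
move=> [i j] _ /=; rewrite -(@ler_pXn2r _ 2)// ?nnegrE ?enorm_ge0// enorm_sqr.
rewrite real_normK ?num_real// (ord1 i) /dot (bigD1 j)//= -expr2 lerDl.
by apply: sumr_ge0 => k _; rewrite -expr2 sqr_ge0.
Qed.

End dot_theory.

Lemma orthogonal_completion (R : realType) n (u : 'rV[R]_n.+1) : dot u u = 1 ->
  exists2 O : 'M[R]_n.+1, O *m O^T = 1%:M & row ord0 O = u.
Proof.
move=> u1; pose e : 'rV[R]_n.+1 := delta_mx 0 ord0.
have rowE (M : 'M[R]_n.+1) : row ord0 M = e *m M by rewrite rowE.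
have ee : dot e e = 1.
  rewrite /dot (bigD1 ord0)//= big1 ?addr0 => [|i i0]; rewrite !mxE ?eqxx ?mul1r//.
  by rewrite (negbTE i0) mul0r.
have [->|ue] := eqVneq u e.
  by exists 1%:M; rewrite ?trmx1 ?mul1mx// rowE mulmx1.
(* Householder reflection exchanging [e] and [u] *)
pose w := e - u; pose s := dot w w.
have s0 : s != 0 by rewrite dotxx_eq0 subr_eq0 eq_sym.
pose O : 'M[R]_n.+1 := 1%:M - (2 / s) *: (w^T *m w).
have OT : O^T = O.
  by rewrite /O linearB /= linearZ /= trmx1 trmx_mul trmxK.
have ww : w *m w^T = s%:M by rewrite mulmx_tr_dot.
exists O.
  rewrite OT {1}/O mulmxBl mul1mx -scalemxAl.
  have -> : w^T *m w *m O = - (w^T *m w).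
    rewrite /O mulmxBr mulmx1 -scalemxAr -mulmxA (mulmxA w) ww mul_scalar_mx.
    rewrite -scalemxAr scalerA mulfVK// -[X in X - _]scale1r -scalerBl.
    by rewrite (_ : 1 - 2 = -1 :> R) ?scaleN1r//; ring.
  by rewrite scalerN opprK subrK.
rewrite rowE /O mulmxBr mulmx1 -scalemxAr mulmxA mulmx_tr_dot mul_scalar_mx scalerA.
rewrite (_ : 2 / s * dot e w = 1); first by rewrite scale1r subKr.
have : s = 2 * dot e w.
  rewrite /s /w !(dotBl, dotBr) (dotC u e) ee u1; ring.
by move=> es; rewrite mulrAC -es divff.
Qed.

(** * Null hyperplanes and the measurability of open sets *)

Section null_sets.
Context {R : realType}.
Local Opaque leb.

Lemma leb_coord_hyperplane n (b : R) : leb n.+1 [set x | x ord0 ord0 = b] = 0%E.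
Proof.
have mA : measurable [set x : 'rV[R]_n.+1 | x ord0 ord0 = b].
  exact: (@measurable_coord_preimage _ _ _ [set b]).
rewrite leb_integral_indic//.
rewrite ge0_integral_leb_cons2//; last first.
  by apply/measurable_EFinP; exact: measurable_indic.
rewrite integral0_eq// => v _.
rewrite (_ : (fun t => _) = (fun t => (\1_[set b] t)%:E)); last first.
  by apply/funext => t; rewrite !indicE; congr (_%:R%:E); congr nat_of_bool;
    apply/idP/idP => /set_mem /= h; apply/mem_set; move: h; rewrite /= rV_cons0.
rewrite integral_indic; last exact: measurable_set1.
  by rewrite setIT; exact: lebesgue_measure_set1.
exact: measurableT.
Qed.

Lemma measurable_hyperplane n (m : 'rV[R]_n) (b : R) : measurable [set x | dot m x = b].
Proof.
have mm : measurable_fun setT (dot m).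
  by apply: (measurable_fun_dot (f := cst m) (g := id)).
by rewrite -[X in measurable X]setTI; exact: (mm measurableT [set b] (measurable_set1 b)).
Qed.

(** An orthogonal matrix whose first row is the unit normal carries the hyperplane to a level set of
    the first coordinate. *)
Lemma leb_hyperplane n (m : 'rV[R]_n) (b : R) : m != 0 ->
  leb n [set x | dot m x = b] = 0%E.
Proof.
case: n m => [|n] m m0; first by rewrite (thinmx0 m) eqxx in m0.
have m1 : dot ((enorm m)^-1 *: m) ((enorm m)^-1 *: m) = 1.
  rewrite dotZl dotZr -enorm_sqr .
  by field; rewrite enorm_eq0.
have [Q QQ Q0] := orthogonal_completion m1.
have dO : \det Q^T != 0.
  apply/eqP => d0; have /(congr1 determinant) := QQ.
  by rewrite det_mulmx d0 mulr0 det1 => /eqP; rewrite eq_sym oner_eq0.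
rewrite (_ : [set x | _] =
  [set x | [set y : 'rV_n.+1 | y ord0 ord0 = b / enorm m] (0 + x *m Q^T)]).
  rewrite leb_affine_preimage//; first by rewrite leb_coord_hyperplane mule0.
  exact: (@measurable_coord_preimage _ _ _ [set b / enorm m]).
have E x : (0 + x *m Q^T) ord0 ord0 = dot m x / enorm m.
  rewrite add0r mxE mulrC -dotZl -Q0 /dot; apply: eq_bigr => i _.
  by rewrite !mxE mulrC.
apply/seteqP; split => x /=; rewrite E; first by move->.
by move/(congr1 ( *%R^~ (enorm m))); rewrite !mulfVK// enorm_eq0.
Qed.

Lemma norm_lt_coord n (x : 'rV[R]_n) r : 0 < r -> (`|x| < r <-> forall i, `|x ord0 i| < r).
Proof.
move=> r0; split=> [xr i|xr]; first exact: le_lt_trans (norm_coord_le _ _) xr.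
rewrite [ltLHS]/Num.norm /= mx_normrE; apply/bigmax_ltP; split=> // -[i j] _ /=.
by rewrite (ord1 i).
Qed.

Lemma measurable_norm_lt n (c : 'rV[R]_n) r : measurable [set x | `|x - c| < r].
Proof.
have [r0|r0] := ltP 0 r; last first.
  rewrite (_ : [set x | _] = set0)//; apply/seteqP; split => x //=.
  by apply/negP; rewrite -leNgt (le_trans r0).
rewrite (_ : [set x | _] = box (fun i => `]c ord0 i - r, c ord0 i + r[%classic)).
  by apply: measurable_box => i; exact: measurable_itv.
apply/seteqP; split => x /=.
  by move/(norm_lt_coord _ r0) => h i; have := h i; rewrite !mxE /= in_itv /= ltr_distl.
by move=> h; apply/(norm_lt_coord _ r0) => i; have := h i; rewrite !mxE /= in_itv /= ltr_distl.
Qed.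

(** Rational centres and radii 1/(j+1) make the family countable. The closed balls are also kept
    inside U, since they later contain the supports of test functions. *)
Lemma open_bigcup_ball n (U : set 'rV[R]_n) : open U ->
  exists (c : nat -> 'rV[R]_n) (r : nat -> R),
    (forall k, [set x | `|x - c k| <= r k] `<=` U) /\
    U = \bigcup_k [set x | `|x - c k| < r k].
Proof.
move=> oU.
(* Codes of no ball, or of a ball leaving U, receive the radius -1, hence the empty ball. *)
pose cr k : 'rV[R]_n * R := if unpickle k is Some (q, j) then
  let c := map_mx (@ratr R) (q : 'rV[rat]_n) in
  if `[< [set x | `|x - c| <= (j : nat).+1%:R^-1] `<=` U >] then (c, j.+1%:R^-1) else (0, -1)
  else (0, -1).
have neg x : ~ `|x - 0 : 'rV[R]_n| <= -1.
  by apply/negP; rewrite -ltNge (lt_le_trans _ (normr_ge0 _))// ltrN10.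
have H k : [set x | `|x - (cr k).1| <= (cr k).2] `<=` U.
  rewrite /cr; case: unpickle => [[q j]|] /=; last by move=> x /= /neg.
  by case: asboolP => //= _ x /= /neg.
exists (fun k => (cr k).1), (fun k => (cr k).2); split => //.
apply/seteqP; split => [x Ux|x [k _ /= h]]; last by apply: (H k); exact: ltW.
have [e /= e0 He] : nbhs_ball x U by apply/nbhs_ballP; exact: oU.
have [j jP] : exists j : nat, j.+1%:R^-1 < e / 2.
  have e20 : 0 < e / 2 by rewrite divr_gt0.
  by have [j] := ltr_add_invr e20; rewrite add0r; exists j.
have r0 : 0 < j.+1%:R^-1 :> R by rewrite invr_gt0.
have qP i : exists q : rat, `|x ord0 i - ratr q| < j.+1%:R^-1.
  have lr : x ord0 i - j.+1%:R^-1 < x ord0 i + j.+1%:R^-1.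
    by rewrite ltrBlDr -addrA ltrDl addr_gt0.
  have [q] := rat_in_itvoo lr.
  by rewrite in_itv /= => h; exists q; rewrite distrC ltr_distl.
have {qP}[q qP] := choice qP.
pose Q : 'rV[rat]_n := \row_i q i.
have xQ : `|x - map_mx ratr Q| < j.+1%:R^-1.
  by apply/(norm_lt_coord _ r0) => i; rewrite !mxE.
exists (pickle (Q, j)) => //=.
rewrite /cr pickleK /=; case: asboolP => //= nU; exfalso; apply: nU => y /= yQ.
apply: He; rewrite -ball_normE /= .
rewrite -(subrK (map_mx ratr Q) x) -addrA (le_lt_trans (ler_normD _ _))//.
rewrite (distrC _ y) (splitr e) ltrD// ?(lt_trans xQ)//.
by apply: le_lt_trans jP.
Qed.

Lemma open_measurable_rV n (U : set 'rV[R]_n) : open U -> measurable U.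
Proof.
move=> /open_bigcup_ball[c [r [_ ->]]].
by apply: bigcupT_measurable => k; exact: measurable_norm_lt.
Qed.

Lemma closed_measurable_rV n (U : set 'rV[R]_n) : closed U -> measurable U.
Proof.
by move=> cU; rewrite -(setCK U); apply: measurableC; apply: open_measurable_rV; exact: closed_openC.
Qed.

Lemma continuous_measurable_rV n (f : 'rV[R]_n -> R) : continuous f -> measurable_fun setT f.
Proof.
move=> cf; apply: (measurability _ (RGenOpens.measurableE R)) => _ [_ [a [b ->] <-]].
rewrite setTI; apply: open_measurable_rV; move/continuousP : cf; apply.
exact: interval_open.
Qed.

End null_sets.

(** * Cones, convex sets and polyhedra *)

Definition cone_over (R : realType) n (x : 'rV[R]_n) (F : set 'rV[R]_n) : set 'rV[R]_n :=
  [set x + t *: (y - x) | t in `]0%R, 1%R[ & y in F].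

(** * Integration over a cone by slices parallel to its base *)

Section cone_integral.
Context {R : realType}.
Local Opaque leb.

Lemma integral_itv01_exprn m :
  (\int[@lebesgue_measure R]_(t in `]0%R, 1%R[) (t ^+ m)%:E = (m.+1%:R^-1)%:E)%E.
Proof.
have mf : measurable_fun (`]0%R, 1%R[%classic : set R) (fun t : R => (t ^+ m)%:E).
  by apply/measurable_EFinP; apply: measurable_funTS; exact: exprn_measurable.
have DF (t : R) : is_derive t (1 : R) (fun t => m.+1%:R^-1 * t ^+ m.+1) (t ^+ m).
  have := is_deriveZ m.+1%:R^-1 (DeriveDef (@exprn_derivable R m.+1 t 1) (@exp_derive R m.+1 t 1)).
  by rewrite /GRing.scale /= mulr1 mulrA mulVf ?mul1r.
have dF (t : R) : derivable (fun t : R => m.+1%:R^-1 * t ^+ m.+1 : R) t 1 by [].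
have cF (t : R) : {for t, continuous (fun t : R => m.+1%:R^-1 * t ^+ m.+1 : R)}.
  exact/differentiable_continuous/derivable1_diffP.
rewrite -[LHS](@integral_itv_bndoo R 0 1 (fun t => (t ^+ m)%:E) true false)//.
rewrite (@continuous_FTC2 _ (fun t => t ^+ m) (fun t => m.+1%:R^-1 * t ^+ m.+1))//.
- by rewrite expr1n mulr1 expr0n mulr0 sube0.
- by apply: continuous_subspaceT => x; exact: exprn_continuous.
- by split => [t _||]; [exact: dF|exact/cvg_at_right_filter/cF|exact/cvg_at_left_filter/cF].
- by move=> t _; rewrite derive1E derive_val.
Qed.

Lemma integral_itv01_exprn_onem m :
  (\int[@lebesgue_measure R]_(t in `]0%R, 1%R[) (t ^+ m * (1 - t))%:E =
   (m.+1%:R^-1 - m.+2%:R^-1)%:E)%E.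
Proof.
have mf j : measurable_fun (`]0%R, 1%R[%classic : set R) (fun t : R => (t ^+ j)%:E).
  by apply/measurable_EFinP; apply: measurable_funTS; exact: exprn_measurable.
have mg : measurable_fun (`]0%R, 1%R[%classic : set R) (fun t : R => (t ^+ m * (1 - t))%:E).
  apply/measurable_EFinP; apply: measurable_funTS; apply: measurable_funM.
    exact: exprn_measurable.
  exact: measurable_funB.
have := integral_itv01_exprn m; rewrite (_ : (fun t : R => (t ^+ m)%:E) =
  (fun t => (t ^+ m * (1 - t))%:E + (t ^+ m.+1)%:E)%E); last first.
  by apply/funext => t; rewrite -EFinD; congr EFin; rewrite exprSr; ring.
have p1 (t : R) : (`]0%R, 1%R[%classic : set R) t -> (0 <= (t ^+ m * (1 - t))%:E)%E.
  rewrite /= in_itv /= lee_fin => /andP[/ltW t0 /ltW t1].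
  by rewrite mulr_ge0 ?exprn_ge0// subr_ge0.
have p2 (t : R) : (`]0%R, 1%R[%classic : set R) t -> (0 <= (t ^+ m.+1)%:E)%E.
  by rewrite /= in_itv /= lee_fin => /andP[/ltW t0 _]; exact: exprn_ge0.
rewrite (ge0_integralD lebesgue_measure _ p1 mg p2 (mf _))//.
rewrite integral_itv01_exprn EFinB => <-.
by rewrite addeK.
Qed.

Lemma mul_col_tr_col k n (a b : 'rV[R]_n) (A : 'M[R]_(k, n)) :
  col_mx a A *m (col_mx b A)^T =
  block_mx (a *m b^T) (a *m A^T) (A *m b^T) (A *m A^T).
Proof. by rewrite tr_col_mx mul_col_row. Qed.

Variables (k : nat) (x : 'rV[R]_k.+1) (pQ : 'rV[R]_k.+1 * 'M[R]_(k, k.+1)).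
Variables (n : 'rV[R]_k.+1).
Hypotheses (QQ : pQ.2 *m pQ.2^T = 1%:M) (n1 : dot n n = 1)
  (Qn : pQ.2 *m n^T = 0).

Let q := pQ.1 - x.
Let h := dot n q.
Let M : 'M[R]_(k.+1) := col_mx (q : 'M[R]_(1, k.+1)) pQ.2.
Let O : 'M[R]_(k.+1) := col_mx (n : 'M[R]_(1, k.+1)) pQ.2.

Let OO : O *m O^T = 1%:M.
Proof.
apply: etrans (mul_col_tr_col _ _ _) _.
rewrite mulmx_tr_dot n1 QQ Qn (_ : n *m pQ.2^T = 0) -?scalar_mx_block//.
by rewrite -[LHS]trmxK trmx_mul trmxK Qn trmx0.
Qed.

(** M sends (t, z) to t q + z Q. Its product with the transpose of the orthogonal matrix O, of rows
    n and Q, is block triangular with diagonal h, 1. *)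
Let detM : `|\det M| = `|h|.
Proof.
have MO : M *m O^T = block_mx h%:M (q *m pQ.2^T) 0 1%:M.
  apply: etrans (mul_col_tr_col _ _ _) _.
  by rewrite mulmx_tr_dot dotC QQ Qn.
have := congr1 determinant MO; rewrite det_mulmx (det_ublock (n1 := 1)) det_scalar1 det1 mulr1 => <-.
have := congr1 determinant OO; rewrite det_mulmx det_tr det1 -expr2 => /eqP.
rewrite sqrf_eq1 normrM => /orP[]/eqP ->; first by rewrite normr1 mulr1.
by rewrite normrN1 mulr1.
Qed.

Let mulM t z : rV_cons (t, z) *m M = t *: q + z *m pQ.2.
Proof.
by rewrite /rV_cons /M (mul_row_col (t%:M : 'M[R]_1)) mul_scalar_mx.
Qed.

Variable F : set 'rV[R]_k.+1.
Hypotheses (h0 : 0 < h) (FQ : F `<=` range (param pQ)).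
Let S : set 'rV[R]_k := param pQ @^-1` F.
Hypothesis mS : measurable S.

Let detM0 : \det M != 0.
Proof. by rewrite -normr_gt0 detM gtr0_norm. Qed.

Let Muni : M \in unitmx. Proof. by rewrite unitmxE unitfE. Qed.

Let E : set 'rV[R]_k.+1 := [set w : 'rV[R]_k.+1 | (w ord0 ord0 \in `]0%R, 1%R[) /\
  S ((w ord0 ord0)^-1 *: (rV_uncons w).2)].

Let mE : measurable E.
Proof.
pose D0 := [set w : 'rV[R]_k.+1 | w ord0 ord0 \in `]0%R, 1%R[].
have mD0 : measurable D0.
  exact: (@measurable_coord_preimage _ _ _ `]0%R, 1%R[%classic).
(* The inverse is written as a real power to obtain measurability; the two agree for the nonnegative
   first coordinates considered here. *)
have mi : measurable_fun setT (fun w : 'rV[R]_k.+1 =>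
    powR (w ord0 ord0) (-1) *: (rV_uncons w).2).
  apply: measurable_funZ_rV.
      exact: (measurableT_comp (measurable_powR (-1)) (@measurable_coord R k.+1 ord0)).
  exact: (measurableT_comp measurable_snd (@measurable_rV_uncons R k)).
have -> : E = D0 `&` (fun w : 'rV[R]_k.+1 =>
    powR (w ord0 ord0) (-1) *: (rV_uncons w).2) @^-1` S.
  apply/seteqP; split => w [wD Sw]; have w0 : 0 <= w ord0 ord0.
  - by move: wD; rewrite in_itv /= => /andP[/ltW].
  - by split=> //=; rewrite powR_inv1.
  - by move: wD; rewrite /D0 /= in_itv /= => /andP[/ltW].
  - by split=> //; rewrite /= powR_inv1 in Sw.
apply: measurableI => //; rewrite -[X in measurable X]setTI; exact: mi.
Qed.

Let EE (t : measurableTypeR R) z : E (rV_cons (t, z)) = ((t \in `]0%R, 1%R[) /\ S (t^-1 *: z)).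
Proof. by rewrite /E /mkset rV_cons0 rV_consK. Qed.

(** In the coordinates (t, z) given by M from the apex x, the slice of the cone at parameter t is
    the homothetic image t S. *)
Let coneE w : cone_over x F (x + w *m M) <-> E w.
Proof.
rewrite -(rV_unconsK w); case: (rV_uncons w) => t z; rewrite mulM EE; split.
  move=> [s + [z' Fz']]; rewrite /= in_itv /= => /andP[s0 s1].
  have [y _ yE] := FQ Fz'; rewrite -yE in Fz' * => /addrI.
  have -> : s *: (param pQ y - x) = rV_cons (s : measurableTypeR R, s *: y) *m M.
    by rewrite mulM /param addrAC scalerDr scalemxAl.
  rewrite -mulM => /(can_inj (mulmxK Muni)) /(can_inj (@rV_consK R k)) [<- <-].
  rewrite in_itv /= s0 s1; split=> //.
  by rewrite /S /= scalerA mulVf ?gt_eqF// scale1r.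
rewrite in_itv /= => -[/andP[t0 t1]]; rewrite /S /= => Ft.
exists t; first by rewrite /= in_itv /= t0.
exists (param pQ (t^-1 *: z)) => //.
rewrite /param addrAC scalerDr -/q scalemxAl scalerA divff ?gt_eqF// scale1r//.
Qed.

Lemma measurable_cone_over : measurable (cone_over x F).
Proof.
have -> : cone_over x F = (fun v => (- x *m invmx M) + v *m invmx M) @^-1` E.
  apply/seteqP; split => v /=; rewrite -mulmxDl.
    by move=> Dv; apply/coneE; rewrite mulmxKV// addrA subrr add0r.
  by move/coneE; rewrite mulmxKV// addrA subrr add0r.
by rewrite -[X in measurable X]setTI; have := @measurable_affine R _ _ (- x *m invmx M) (invmx M) measurableT E mE.
Qed.

(** The factor h is the determinant of the linear coordinates, and t^k that of the homothety from S
    onto the slice at t. *)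
Lemma ge0_integral_cone (f : 'rV[R]_k.+1 -> \bar R) :
  measurable_fun setT f -> (forall z, cone_over x F z -> 0 <= f z)%E ->
  (\int[leb k.+1]_(z in cone_over x F) f z =
   h%:E * \int[lebesgue_measure]_(t in `]0%R, 1%R[)
     ((t ^+ k)%:E * \int[leb k]_(y in S) f (x + t *: (param pQ y - x))%R))%E.
Proof.
move=> mf f0; have mD := measurable_cone_over.
rewrite integral_mkcond; set g := f \_ _.
have mg : measurable_fun setT g.
  by apply/(measurable_restrictT _ mD) => //; exact: measurable_funTS.
have g0 z : (0 <= g z)%E by rewrite /g patchE; case: ifPn => // /set_mem /f0.
pose G w := g (w *m M + x).
have mG : measurable_fun setT G.
  apply: (measurableT_comp mg); apply: measurable_funD_rV => //; exact: measurable_mulmx.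
have GE w : G w = if w \in E then f (x + w *m M) else 0%E.
  rewrite /G /g patchE addrC; congr (if _ then _ else _).
  by apply/idP/idP => /set_mem /coneE /mem_set.
transitivity (h%:E * \int[leb k.+1]_w G w)%E.
  rewrite -(ge0_integral_leb_shift x mg g0).
  rewrite (@ge0_integral_leb_mulmx R _ M (fun w => g (w + x)) detM0); last 2 first.
  - by apply: (measurableT_comp mg); exact: measurable_funD_rV.
  - by move=> z; exact: g0.
  by rewrite muleA -EFinM detM gtr0_norm// divff ?mul1e// gt_eqF.
congr (_ * _)%E; rewrite (ge0_integral_leb_cons mG (fun w => g0 _)).
rewrite [RHS]integral_mkcond; apply: eq_integral => t _; rewrite patchE.
case: ifPn => [|tn]; last first.
  rewrite integral0_eq// => v _; rewrite GE; case: ifPn => // /set_mem [].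
  by rewrite rV_cons0 => tn'; move: tn; rewrite mem_set.
move=> /set_mem /= t01; move: (t01); rewrite in_itv /= => /andP[t0 t1].
pose G' v := G (rV_cons (t, v)).
have mG' : measurable_fun setT G' by exact: measurable_rV_section.
have dt : \det (t%:M : 'M[R]_k) != 0.
  by rewrite det_scalar expf_neq0// gt_eqF.
have := ge0_integral_leb_mulmx dt mG' (fun w => g0 _).
move/(congr1 (mule (t ^+ k)%:E)).
rewrite det_scalar ger0_norm ?exprn_ge0 ?(ltW t0)// muleA -EFinM divff ?mul1e; last first.
  by rewrite expf_neq0// gt_eqF.
move=> <-; congr (_ * _)%E; rewrite [RHS]integral_mkcond; apply: eq_integral => v _.
rewrite /G' GE patchE mul_mx_scalar.
have -> : (rV_cons (t : measurableTypeR R, t *: v) \in E) = (v \in S).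
  apply/idP/idP => /set_mem vE; apply/mem_set; move: vE; rewrite EE scalerA mulVf ?scale1r ?gt_eqF//.
  by case.
case: ifPn => // _; congr f; rewrite mulM /param [in RHS]addrAC [in RHS]scalerDr.
by rewrite -scalemxAl.
Qed.

(** On the segment from x to z the affine function is (1 - t) times its value at x plus t times its
    value at z. The weights are the integrals of t^k (1 - t) and t^(k+1) over ]0, 1[; nonnegativity
    allows the terms to be split in extended reals. *)
Lemma integral_cone_affine (e : 'rV[R]_k.+1) (c : R) :
  0 <= dot e x + c -> (forall z, F z -> 0 <= dot e z + c) ->
  (\int[leb k.+1]_(z in cone_over x F) (dot e z + c)%:E =
   h%:E * ((k.+1%:R^-1 - k.+2%:R^-1)%:E * ((dot e x + c)%:E * leb k S) +
     k.+2%:R^-1%:E * \int[leb k]_(y in S) (dot e (param pQ y) + c)%:E))%E.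
Proof.
move=> fx fF.
have mphi : measurable_fun setT (fun z : 'rV[R]_k.+1 => dot e z + c).
  by apply: measurable_funD => //; apply: (measurable_fun_dot (f := cst e) (g := id)).
have mpar : measurable_fun setT (fun y : 'rV[R]_k => dot e (param pQ y) + c).
  exact: (measurableT_comp mphi (measurable_affine pQ.1 pQ.2)).
have mparS : measurable_fun S (fun y : 'rV[R]_k => (dot e (param pQ y) + c)%:E).
  by apply/measurable_EFinP; exact: measurable_funTS.
have phit z t : dot e (x + t *: (z - x)) + c = (1 - t) * (dot e x + c) + t * (dot e z + c).
  by rewrite dotDr dotZr dotBr; ring.
rewrite (ge0_integral_cone (f := fun z => (dot e z + c)%:E)); last 2 first.
- exact/measurable_EFinP.
- move=> _ [t + [z Fz <-]]; rewrite /= in_itv /= => /andP[/ltW t0 /ltW t1].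
  by rewrite lee_fin phit addr_ge0 ?mulr_ge0 ?subr_ge0// fF.
congr (_ * _)%E.
set a := ((dot e x + c)%:E * leb k S)%E; set I := (\int[leb k]_(y in S) _)%E.
have a0 : (0 <= a)%E by rewrite mule_ge0.
have I0 : (0 <= I)%E by apply: integral_ge0 => y Sy; rewrite lee_fin fF.
transitivity (\int[lebesgue_measure]_(t in `]0%R, 1%R[)
   ((t ^+ k * (1 - t))%:E * a + (t ^+ k.+1)%:E * I))%E.
  apply: eq_integral => t; rewrite inE /= in_itv /= => /andP[t0 t1].
  under eq_integral do rewrite phit EFinD.
  have omt : 0 <= 1 - t by rewrite subr_ge0 ltW.
  have q1 y : S y -> (0 <= ((1 - t) * (dot e x + c))%:E)%E by rewrite lee_fin mulr_ge0.
  have q0 y : S y -> (0 <= (dot e (param pQ y) + c)%:E)%E by move=> Sy; rewrite lee_fin fF.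
  have q2 y : S y -> (0 <= (t * (dot e (param pQ y) + c))%:E)%E.
    by move=> /q0; rewrite !lee_fin => ?; rewrite mulr_ge0 ?(ltW t0).
  have q3 : measurable_fun S (fun y : 'rV[R]_k => (t * (dot e (param pQ y) + c))%:E).
    by apply/measurable_EFinP; apply: measurable_funTS; apply: measurable_funM.
  rewrite (ge0_integralD (leb k) mS q1 _ q2 q3)//.
  rewrite integral_cst//.
  under [X in (_ + X)%E]eq_integral do rewrite EFinM.
  rewrite ge0_integralZl//; last by rewrite lee_fin ltW.
  rewrite ge0_muleDr ?mule_ge0 ?lee_fin ?mulr_ge0 ?(ltW t0)//.
  by rewrite exprSr !EFinM !muleA.
have mpol1 : measurable_fun (`]0%R, 1%R[%classic : set R) (fun t : R => (t ^+ k * (1 - t))%:E).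
  apply/measurable_EFinP; apply: measurable_funTS; apply: measurable_funM.
    exact: exprn_measurable.
  exact: measurable_funB.
have mpol2 : measurable_fun (`]0%R, 1%R[%classic : set R) (fun t : R => (t ^+ k.+1)%:E).
  by apply/measurable_EFinP; apply: measurable_funTS; exact: exprn_measurable.
have p1 (t : R) : (`]0%R, 1%R[%classic : set R) t -> (0 <= (t ^+ k * (1 - t))%:E)%E.
  rewrite /= in_itv /= lee_fin => /andP[/ltW t0 /ltW t1].
  by rewrite mulr_ge0 ?exprn_ge0// subr_ge0.
have p2 (t : R) : (`]0%R, 1%R[%classic : set R) t -> (0 <= (t ^+ k.+1)%:E)%E.
  by rewrite /= in_itv /= lee_fin => /andP[/ltW t0 _]; exact: exprn_ge0.
have p1a (t : R) : (`]0%R, 1%R[%classic : set R) t -> (0 <= (t ^+ k * (1 - t))%:E * a)%E.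
  by move=> t01; rewrite mule_ge0// p1.
have p2a (t : R) : (`]0%R, 1%R[%classic : set R) t -> (0 <= (t ^+ k.+1)%:E * I)%E.
  by move=> t01; rewrite mule_ge0// p2.
rewrite (ge0_integralD lebesgue_measure _ p1a _ p2a)//; try exact: emeasurable_funM.
rewrite ge0_integralZr// ge0_integralZr//.
by rewrite integral_itv01_exprn integral_itv01_exprn_onem.
Qed.

End cone_integral.

(** * Rays from an interior point of a bounded open convex set *)

Section convex_geometry.
Context {R : realType} {n : nat}.
Implicit Types (x y z v : 'rV[R]_n) (K F : set 'rV[R]_n).

Lemma convex_segment K x y t : convex_set K -> K x -> K y -> 0 <= t <= 1 ->
  K (x + t *: (y - x)).
Proof.
move=> cK Kx Ky /andP[t0 t1].
have := cK y x (Itv01 t0 t1) (mem_set Ky) (mem_set Kx).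
rewrite inE; congr K; rewrite /conv /=.
by apply/rowP => i; rewrite !mxE /unstable.onem; ring.
Qed.

Lemma open_ball_sub K x : open K -> K x -> exists2 e, 0 < e & forall y, `|y - x| < e -> K y.
Proof.
move=> oK Kx; have [e /= e0 He] : nbhs_ball x K by apply/nbhs_ballP; exact: oK.
by exists e => // y yx; apply: He; rewrite -ball_normE /= distrC.
Qed.

Lemma closure_normP K x : closure K x <-> forall e, 0 < e -> exists2 y, K y & `|y - x| < e.
Proof.
split=> [cl e e0|H B /nbhs_ballP[e /= e0 eB]].
  have [] := cl (ball x e); first exact: nbhsx_ballx.
  by move=> y [Ky]; rewrite -ball_normE /= distrC; exists y.
have [y Ky yx] := H _ e0; exists y; split => //; apply: eB.
by rewrite -ball_normE /= distrC.
Qed.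

Lemma convex_open_segment K x y t : convex_set K -> open K -> K x ->
  closure K y -> 0 <= t < 1 -> K (x + t *: (y - x)).
Proof.
move=> cK oK Kx /closure_normP cly /andP[t0 t1].
have [e e0 He] := open_ball_sub oK Kx.
have omt : 0 < 1 - t by rewrite subr_gt0.
have [y' Ky' yy'] := cly (e * (1 - t)) (mulr_gt0 e0 omt).
(* The limit point y is replaced by a nearby y' of K. Moving x by this amount compensates exactly,
   so that the target stays at parameter t on the segment from x' to y'. *)
pose x' := x - (t / (1 - t)) *: (y' - y).
have Kx' : K x'.
  apply: He; rewrite /x' addrC addKr normrN normrZ ger0_norm ?divr_ge0// ?(ltW omt)//.
  apply: (@le_lt_trans _ _ ((1 - t)^-1 * `|y' - y|)).
    by rewrite ler_wpM2r// ler_piMl ?invr_ge0 ?(ltW omt) ?(ltW t1).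
  by rewrite mulrC ltr_pdivrMr.
have -> : x + t *: (y - x) = x' + t *: (y' - x').
  rewrite /x'; apply/rowP => i; rewrite !mxE; field.
  by rewrite gt_eqF.
by apply: convex_segment => //; rewrite t0 ltW.
Qed.

Lemma cone_over_sub K F x : convex_set K -> open K -> K x -> F `<=` closure K ->
  cone_over x F `<=` K.
Proof.
move=> cK oK Kx FK _ [t + [y Fy <-]]; rewrite /= in_itv /= => /andP[t0 t1].
by apply: convex_open_segment => //; [exact: FK|rewrite ltW].
Qed.

(** If t < s, the point z lies strictly between x and y, where all points belong to K. Two boundary
    points on one ray therefore coincide. *)
Let ray_disjoint K x y z s t : convex_set K -> open K -> K x -> closure K y -> ~ K z ->
  0 < t -> t < s -> x + t *: (y - x) = x + s *: (z - x) -> False.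
Proof.
move=> cK oK Kx Ky Kz t0 ts /addrI E; apply: Kz.
have s0 : 0 < s := lt_trans t0 ts.
have -> : z = x + (t / s) *: (y - x).
  rewrite mulrC -scalerA E scalerA mulVf ?gt_eqF// scale1r addrC subrK//.
by apply: convex_open_segment => //; rewrite divr_ge0 ?ltW//= ltr_pdivrMr// mul1r.
Qed.

Lemma cone_over_disjoint K F G x : convex_set K -> open K -> K x ->
  F `<=` closure K `\` K -> G `<=` closure K `\` K -> F `&` G = set0 ->
  cone_over x F `&` cone_over x G = set0.
Proof.
move=> cK oK Kx FK GK FG; rewrite -subset0 => v [].
move=> [t + [y Fy <-]] [s + [z Gz E]]; rewrite /= !in_itv /= => /andP[t0 t1] /andP[s0 s1].
have [[cy ny] [cz nz]] := (FK _ Fy, GK _ Gz).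
have [ts|st|ts] := ltgtP t s.
- by apply: (ray_disjoint cK oK Kx cy nz t0 ts).
- by apply: (ray_disjoint cK oK Kx cz ny s0 st).
- move: E; rewrite ts => /addrI /(scalerI (lt0r_neq0 s0)) /addIr zy.
  by rewrite -[False]/(set0 y) -FG; split=> //; rewrite -zy.
Qed.

(** The ray from x through v leaves K at the supremum s of its parameters in K, finite because K is
    bounded. The exit point is a boundary point and s > 1, so v lies on the cone at parameter
    1/s. *)
Lemma cone_over_cover K x : convex_set K -> open K -> bounded_set K -> K x ->
  K `<=` [set x] `|` cone_over x (closure K `\` K).
Proof.
move=> cK oK bK Kx v Kv; have [->|vx] := eqVneq v x; [by left|right].
pose S := [set s : R | 0 <= s /\ K (x + s *: (v - x))].
have S1 : S 1 by split=> //; rewrite scale1r addrC subrK.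
have nvx : 0 < `|v - x| by rewrite normr_gt0 subr_eq0.
have [M HM] : exists M, forall y, K y -> `|y| <= M.
  by have [M [_ /(_ (M + 1))]] := bK; rewrite ltrDl ltr01 => /(_ isT) HM; exists (M + 1).
have hS : has_sup S.
  split; first by exists 1.
  exists ((M + `|x|) / `|v - x|) => s [s0 /HM Ks].
  rewrite ler_pdivlMr// -[X in X * _](ger0_norm s0) -normrZ.
  rewrite -(addKr x (s *: _)) (le_trans (ler_normD _ _))// normrN addrC.
  exact: lerD.
pose s := sup S.
have s1 : 1 <= s by apply: ub_le_sup => //; case: hS.
have s0 : 0 < s := lt_le_trans ltr01 s1.
have KS r : 0 <= r -> r < s -> K (x + r *: (v - x)).
  move=> r0 rs; have srp : 0 < s - r by rewrite subr_gt0.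
  have [r' [r'0 Kr']] := sup_adherent srp hS; rewrite subKr => rr'.
  have r'p : 0 < r' := le_lt_trans r0 rr'.
  have := @convex_segment K x _ (r / r') cK Kx Kr'.
  rewrite [_ - x]addrC addKr scalerA divfK ?gt_eqF//; apply.
  by apply/andP; split; [rewrite divr_ge0// ltW|rewrite ler_pdivrMr// mul1r ltW].
pose y := x + s *: (v - x).
have cy : closure K y.
  apply/closure_normP => e e0.
  pose r := Num.max 0 (s - e / 2 / `|v - x|).
  exists (x + r *: (v - x)).
    by apply: KS; rewrite /r ?le_max ?lexx// gt_max s0/= ltrBlDr ltrDl !divr_gt0.
  rewrite /y opprD addrACA subrr add0r -scalerBl normrZ -ltr_pdivlMr//.
  have rs : r <= s by rewrite /r ge_max (ltW s0)/= gerBl !divr_ge0 ?ltW.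
  rewrite distrC ger0_norm ?subr_ge0//.
  apply: (@le_lt_trans _ _ (e / 2 / `|v - x|)).
    by rewrite lerBlDr -lerBlDl /r le_max lexx orbT.
  by rewrite ltr_pM2r ?invr_gt0// ltr_pdivrMr// ltr_pMr// ltr1n.
have nKy : ~ K y.
  move=> Ky; have [e e0 He] := open_ball_sub oK Ky.
  (* If the exit point were in the open set K, the ray would stay in K slightly beyond the
     supremum. *)
  have : S (s + e / 2 / `|v - x|).
    split; first by rewrite addr_ge0 ?ltW// !divr_gt0.
    apply: He; rewrite /y opprD addrACA subrr add0r -scalerBl [s + _]addrC addrK normrZ.
    rewrite ger0_norm ?divr_ge0// ?divr_ge0 ?ltW// divfK ?gt_eqF//.
    by rewrite ltr_pdivrMr// ltr_pMr// ltr1n.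
  move=> /(ub_le_sup hS.2); rewrite -/s gerDl leNgt; apply/negP; rewrite negbK.
  by rewrite !divr_gt0.
have s1' : 1 < s.
  rewrite lt_neqAle s1 andbT; apply/eqP => E; apply: nKy.
  by rewrite /y -E scale1r addrC subrK.
exists s^-1; first by rewrite /= in_itv /= invr_gt0 s0 invf_lt1.
exists y => //; rewrite /y [_ - x]addrC addKr scalerA mulVf ?gt_eqF// scale1r.
by rewrite addrC subrK.
Qed.

End convex_geometry.

Lemma closure_sub_closed (T : topologicalType) (A B : set T) : closed B ->
  A `<=` B -> closure A `<=` B.
Proof. by move=> cB AB; rewrite closureE; exact: smallest_sub. Qed.

(** * Polyhedra differ from their closures by null sets *)

Section polyhedra.
Context {R : realType}.
Local Opaque leb.

Lemma continuous_dot n (a : 'rV[R]_n) : continuous (dot a).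
Proof.
apply: (@continuous_big _ _ +%R 0 _ _ _ _ (fun i (y : 'rV[R]_n) => a ord0 i * y ord0 i)).
  exact: add_continuous.
move=> i _ x; apply: (@continuous_comp _ _ _ (fun y : 'rV[R]_n => y ord0 i) ( *%R (a ord0 i))).
  exact: coord_continuous.
exact: mulrl_continuous.
Qed.

Lemma measurable_dotl n (a : 'rV[R]_n) : measurable_fun setT (dot a).
Proof. by apply: continuous_measurable_rV; exact: continuous_dot. Qed.

Lemma measurable_polyhedron n (A : set 'rV[R]_n) : polyhedron A -> measurable A.
Proof.
move=> [s ->].
rewrite (_ : [set x | _] = \bigcap_(h in [set` s])
   (dot h.1.1 @^-1` (if h.2 then `]-oo, h.1.2[%classic else `]-oo, h.1.2]%classic))).
  apply: fin_bigcap_measurable; first exact: finite_seq.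
  move=> h _; rewrite -[X in measurable X]setTI; apply: measurable_dotl => //.
  by case: ifP.
apply/seteqP; split => [x Hx h /= hs|x Hx h hs].
  by have := Hx h hs; case: h.2 => /=; rewrite in_itv.
by have := Hx h hs; case: h.2 => /=; rewrite in_itv.
Qed.

(** A point of the closure satisfies every inequality in its weak form, so if it is not in A it lies
    on the hyperplane of some strict one. *)
Lemma closure_polyhedron n (A : set 'rV[R]_n) : polyhedron A ->
  (leb n).-negligible (closure A `\` A).
Proof.
move=> [s EA].
have [->|/set0P[x0 Ax0]] := eqVneq A set0.
  by rewrite closure0 set0D; exact: negligible_set0.
(* The default entry beyond the end of [s] has a zero normal and so contributes the empty set. *)
pose N (k : nat) := let h := nth (0, 0, false) s k in
  if h.1.1 == 0 then set0 else [set x | dot h.1.1 x = h.1.2].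
apply: (@negligibleS _ _ _ _ (\bigcup_k N k)).
  move=> x [cx nAx].
  have le h : h \in s -> dot h.1.1 x <= h.1.2.
    move=> hs; pose B := dot h.1.1 @^-1` [set r | r <= h.1.2].
    have cB : closed B.
      by apply: preimage_closed; [move=> y _; exact: continuous_dot|exact: closed_le].
    apply: (closure_sub_closed cB _ cx) => y; rewrite EA => /(_ h hs).
    by rewrite /B /=; case: h.2 => //= /ltW.
  have [h hs nh] : exists2 h, h \in s & ~ (dot h.1.1 x < h.1.2 ?<= if ~~ h.2).
    apply/not_exists2P => H; apply: nAx; rewrite EA => h hs.
    by have [//|/contrapT] := H h.
  have [h2 hx] : h.2 /\ dot h.1.1 x = h.1.2.
    move: nh (le h hs); case: h.2 => /=; last by move=> /[apply].
    by move=> /negP; rewrite -leNgt => h1 h3; split=> //; apply/eqP; rewrite eq_le h1 h3.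
  (* A zero normal would make the strict inequality read 0 < 0, which fails at the point [x0] of
     A. *)
  have h0 : h.1.1 != 0.
    apply/eqP => h0; have := Ax0; rewrite EA => /(_ h hs); rewrite h2 /= -hx h0 !dot0l.
    by rewrite ltxx.
  exists (index h s) => //; rewrite /N nth_index// (negbTE h0).
  exact: hx.
apply: negligible_bigcup => k; rewrite /N; case: ifPn => h0; first exact: negligible_set0.
exists [set x | dot (nth (0, 0, false) s k).1.1 x = (nth (0, 0, false) s k).1.2].
by split=> //; [exact: measurable_hyperplane|exact: leb_hyperplane].
Qed.

Lemma polyhedron_preimage n m (p : 'rV[R]_m) (Q : 'M[R]_(n, m)) A : polyhedron A ->
  polyhedron ((fun y => p + y *m Q) @^-1` A).
Proof.
move=> [s ->].
exists [seq (h.1.1 *m Q^T, h.1.2 - dot h.1.1 p, h.2) | h <- s].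
have E (h : 'rV[R]_m * R * bool) y : (dot (h.1.1 *m Q^T) y < h.1.2 - dot h.1.1 p ?<= if ~~ h.2) =
    (dot h.1.1 (p + y *m Q) < h.1.2 ?<= if ~~ h.2).
  have -> : dot (h.1.1 *m Q^T) y = dot h.1.1 (y *m Q).
    have := mulmx_tr_dot (h.1.1 *m Q^T) y.
    rewrite -mulmxA -trmx_mul mulmx_tr_dot => /matrixP/(_ ord0 ord0).
    by rewrite !mxE eqxx !mulr1n.
  by rewrite dotDr; case: h.2 => /=; [rewrite ltrBrDl|rewrite lerBrDl].
apply/seteqP; split => y Hy h.
  by move=> /mapP[h' hs ->] /=; have := E h' y; rewrite /= => ->; exact: Hy.
move=> hs; have := E h y; rewrite /= => <-; apply: (Hy (_, _, _)).
by apply/mapP; exists h.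
Qed.

(** The part of [polytopal] that survives preimages under affine maps, which may be unbounded. *)
Definition finite_union_polyhedra n (A : set 'rV[R]_n) :=
  exists (k : nat) (P : 'I_k -> set 'rV[R]_n),
    (forall i, polyhedron (P i)) /\ A = \bigcup_(i in setT) P i.

Lemma measurable_fup n (A : set 'rV[R]_n) : finite_union_polyhedra A -> measurable A.
Proof.
move=> [k [P [hP ->]]]; apply: fin_bigcup_measurable; first exact: finite_finset.
by move=> i _; exact: measurable_polyhedron.
Qed.

Lemma closure_fup n (A : set 'rV[R]_n) : finite_union_polyhedra A ->
  (leb n).-negligible (closure A `\` A).
Proof.
move=> [k [P [hP ->]]].
pose N (j : nat) := if insub j is Some i then closure (P i) `\` P i else set0.
apply: (@negligibleS _ _ _ _ (\bigcup_j N j)).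
  move=> x [cx nx].
  have [i _ cPi] : (\bigcup_(i in setT) closure (P i)) x.
    apply: (closure_sub_closed _ _ cx).
      apply: closed_bigcup; first exact: finite_finset.
      by move=> i _; exact: closed_closure.
    by move=> y [i _ Piy]; exists i => //; exact: subset_closure.
  by exists (val i) => //; rewrite /N valK; split => // Pix; apply: nx; exists i.
apply: negligible_bigcup => j; rewrite /N; case: insubP => [i _ _|_]; last exact: negligible_set0.
exact: closure_polyhedron.
Qed.

Lemma fup_preimage n m (p : 'rV[R]_m) (Q : 'M[R]_(n, m)) A : finite_union_polyhedra A ->
  finite_union_polyhedra ((fun y => p + y *m Q) @^-1` A).
Proof.
move=> [k [P [hP ->]]]; exists k, (fun i => (fun y => p + y *m Q) @^-1` P i).
by split=> [i|]; [exact: polyhedron_preimage|rewrite preimage_bigcup].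
Qed.

End polyhedra.

(** * Isometric parametrizations of hyperplanes *)

Section parametrization.
Context {R : realType} {k : nat}.
Implicit Types (pQ : 'rV[R]_k.+1 * 'M[R]_(k, k.+1)) (n x y z : 'rV[R]_k.+1).
Local Opaque leb.

Lemma dot_mulmx_tr m (u : 'rV[R]_m) p (v : 'rV[R]_p) (Q : 'M[R]_(m, p)) :
  dot (u *m Q) v = dot u (v *m Q^T).
Proof.
have := mulmx_tr_dot (u *m Q) v; rewrite -mulmxA -[Q *m v^T]trmxK trmx_mul trmxK.
by rewrite mulmx_tr_dot => /matrixP/(_ ord0 ord0); rewrite !mxE eqxx !mulr1n.
Qed.

Definition unit_normal pQ n : Prop := dot n n = 1 /\ pQ.2 *m n^T = 0.

Lemma dot_mulmxK pQ (u v : 'rV[R]_k) : pQ.2 *m pQ.2^T = 1%:M ->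
  dot (u *m pQ.2) (v *m pQ.2) = dot u v.
Proof. by move=> QQ; rewrite dot_mulmx_tr -mulmxA QQ mulmx1. Qed.

Lemma unit_normal_exists pQ : exists n, unit_normal pQ n.
Proof.
(* The k rows of Q cannot span a space of dimension k + 1. *)
have k0 : kermx pQ.2^T != 0.
  by rewrite kermx_eq0 /row_free neq_ltn ltnS rank_leq_col.
pose u := nz_row (kermx pQ.2^T).
have u0 : u != 0 by rewrite nz_row_eq0.
have uQ : u *m pQ.2^T = 0 by apply/sub_kermxP; exact: nz_row_sub.
exists ((enorm u)^-1 *: u); split.
  by rewrite dotZl dotZr -enorm_sqr; field; rewrite enorm_eq0.
by rewrite linearZ /= -scalemxAr -[_ *m _]trmxK trmx_mul trmxK uQ trmx0 scaler0.
Qed.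

(** The square matrix of rows n and Q is orthogonal on both sides, hence n^T n + Q^T Q is the
    identity: z - p splits into its normal and tangential parts. *)
Lemma unit_normal_decomp pQ n z : pQ.2 *m pQ.2^T = 1%:M -> unit_normal pQ n ->
  z = param pQ ((z - pQ.1) *m pQ.2^T) + dot n (z - pQ.1) *: n.
Proof.
move=> QQ [n1 Qn].
pose O : 'M[R]_k.+1 := col_mx (n : 'M[R]_(1, k.+1)) pQ.2.
have OO : O *m O^T = 1%:M.
  apply: etrans (mul_col_tr_col _ _ _) _.
  rewrite mulmx_tr_dot n1 QQ Qn (_ : n *m pQ.2^T = 0) -?scalar_mx_block//.
  by rewrite -[LHS]trmxK trmx_mul trmxK Qn trmx0.
have O'O : n^T *m n + pQ.2^T *m pQ.2 = 1%:M.
  have := mulmx1C OO; rewrite /O (tr_col_mx (n : 'M[R]_(1, k.+1)) pQ.2).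
  by rewrite (mul_row_col (n^T : 'M[R]_(k.+1, 1))).
rewrite /param -addrA -mulmxA dotC -mul_scalar_mx -mulmx_tr_dot -mulmxA -mulmxDr.
by rewrite [_ + n^T *m n]addrC O'O mulmx1 addrC subrK.
Qed.

Lemma dot_normal_param pQ n (y : 'rV[R]_k) : unit_normal pQ n -> dot n (param pQ y) = dot n pQ.1.
Proof.
move=> [_ Qn]; rewrite /param dotDr (dotC n (_ *m _)) dot_mulmx_tr.
by rewrite -[n *m _]trmxK trmx_mul trmxK Qn trmx0 dot0r addr0.
Qed.

Lemma range_paramP pQ n z : pQ.2 *m pQ.2^T = 1%:M -> unit_normal pQ n ->
  range (param pQ) z <-> dot n z = dot n pQ.1.
Proof.
move=> QQ nn; split=> [[y _ <-]|nz]; first exact: dot_normal_param.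
exists ((z - pQ.1) *m pQ.2^T) => //.
by rewrite [RHS](unit_normal_decomp _ QQ nn) dotBr nz subrr scale0r addr0.
Qed.

Lemma paramK pQ (y : 'rV[R]_k) : pQ.2 *m pQ.2^T = 1%:M ->
  (param pQ y - pQ.1) *m pQ.2^T = y.
Proof. by move=> QQ; rewrite /param addrC addKr -mulmxA QQ mulmx1. Qed.

(** The infimum is attained at the orthogonal projection x + h n; Cauchy-Schwarz against n bounds
    every other distance from below. *)
Lemma dist_to_range pQ n x : pQ.2 *m pQ.2^T = 1%:M -> unit_normal pQ n ->
  dist_to x (range (param pQ)) = `|dot n (pQ.1 - x)|.
Proof.
move=> QQ nn; set h := dot n (pQ.1 - x).
have lb y : range (param pQ) y -> `|h| <= enorm (x - y).
  move=> /(range_paramP y QQ nn) ny.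
  have -> : h = dot n (y - x) by rewrite /h !dotBr ny.
  rewrite -(enormN (x - y)) opprB (le_trans (cauchy_schwarz _ _))//.
  by rewrite /enorm nn.1 sqrtr1 mul1r.
apply/eqP; rewrite eq_le; apply/andP; split.
  have ay : range (param pQ) (x + h *: n).
    by apply/(range_paramP _ QQ nn); rewrite dotDr dotZr nn.1 mulr1 /h dotBr addrC subrK.
  have e1 : enorm (x - (x + h *: n)) = `|h|.
    by rewrite opprD addNKr enormN enormZ [enorm n]/enorm nn.1 sqrtr1 mulr1.
  rewrite -e1; apply: ge_inf; last by exists (x + h *: n).
  by exists 0 => _ [y _ <-]; exact: enorm_ge0.
apply: lb_le_inf; first by exists (enorm (x - param pQ 0)); exists (param pQ 0) => //; exists 0.
by move=> _ [y ry <-]; exact: lb.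
Qed.

(** Completing the unit normal into an orthogonal matrix and deleting that row leaves an orthonormal
    basis of the directions of the hyperplane. *)
Lemma is_param_exists (A : set 'rV[R]_k.+1) H : is_hyperplane H -> A `<=` H ->
  exists pQ, is_param A pQ.
Proof.
move=> [n [n0 [b ->]]] AH.
have n1 : dot ((enorm n)^-1 *: n) ((enorm n)^-1 *: n) = 1.
  by rewrite dotZl dotZr -enorm_sqr; field; rewrite enorm_eq0.
have [U UU U0] := orthogonal_completion n1.
pose Q : 'M[R]_(k, k.+1) := row' ord0 U.
pose p := (b / dot n n) *: n.
have nn0 : dot n n != 0 by rewrite dotxx_eq0.
have rows i j : dot (row i U) (row j U) = (i == j)%:R.
  have := congr1 (fun M : 'M[R]__ => M i j) UU; rewrite !mxE => <-.
  by apply: eq_bigr => l _; rewrite !mxE.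
have QQ : Q *m Q^T = 1%:M.
  apply/matrixP => i j; rewrite !mxE.
  have := rows (lift ord0 i) (lift ord0 j); rewrite (inj_eq lift_inj) => <-.
  by apply: eq_bigr => l _; rewrite !mxE.
have Qn : unit_normal (p, Q) ((enorm n)^-1 *: n).
  split=> //=; apply/colP => i; rewrite !mxE -U0.
  have E := rows (lift ord0 i) ord0; rewrite eq_sym (negbTE (neq_lift _ _)) in E.
  by apply: etrans E; apply: eq_bigr => l _; rewrite !mxE.
exists (p, Q); split=> // z /AH /= nz; apply/(@range_paramP (p, Q) _ z QQ Qn) => /=.
by rewrite !dotZl nz /p dotZr divfK.
Qed.

Lemma closure_param_preimage pQ (F : set 'rV[R]_k.+1) (y : 'rV[R]_k) : pQ.2 *m pQ.2^T = 1%:M ->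
  F `<=` range (param pQ) -> closure F (param pQ y) -> closure (param pQ @^-1` F) y.
Proof.
move=> QQ FQ /closure_normP cl; apply/closure_normP => e e0.
(* The parametrization is isometric for the Euclidean norm while neighbourhoods use the maximum
   norm; this factor compares them. *)
have ep : 0 < e / (Num.sqrt k.+1%:R) by rewrite divr_gt0// sqrtr_gt0.
have [z Fz zy] := cl _ ep; have [y' _ Ey] := FQ _ Fz.
exists y'; first by rewrite /= Ey.
rewrite (le_lt_trans (norm_le_enorm _))// /enorm -(dot_mulmxK _ _ QQ) mulmxBl.
have -> : y' *m pQ.2 - y *m pQ.2 = z - param pQ y.
  by rewrite -Ey /param opprD addrACA subrr add0r.
rewrite -/(enorm _) (le_lt_trans (enorm_le_norm _))//.
by rewrite mulrC -ltr_pdivlMr// sqrtr_gt0.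
Qed.

End parametrization.

(** * Geometry of an admissible mesh *)

Section mesh_geometry.
Context {R : realType} {k : nat}.
Variables (Omega : set 'rV[R]_k.+1) (T : mesh R k.+1).
Hypothesis hT : admissible Omega T.
Implicit Types (K : cell T) (s : face T) (n x y z : 'rV[R]_k.+1).
Local Opaque leb.

Lemma cellset_open K : open (cellset K). Proof. exact: (cell_open hT). Qed.

Lemma cellset_convex K : convex_set (cellset K). Proof. exact: (cell_convex hT). Qed.

Lemma face_paramP s : (face_param (faceset s)).2 *m (face_param (faceset s)).2^T = 1%:M /\
  faceset s `<=` range (param (face_param (faceset s))).
Proof.
have [H hH sH] := face_flat hT s.
have [pQ hp] := is_param_exists hH sH.
exact: (@getPex _ [set pQ | is_param (faceset s) pQ] (ex_intro _ pQ hp)).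
Qed.

Definition face_coords s : set 'rV[R]_k := param (face_param (faceset s)) @^-1` faceset s.

Lemma measurable_face_coords s : measurable (face_coords s).
Proof.
by apply: measurable_fup; apply: fup_preimage; case: (face_polytopal hT s).
Qed.

Lemma bounded_face_coords s : bounded_set (face_coords s).
Proof.
have [[M [_ HM]] _] := face_polytopal hT s; have [QQ _] := face_paramP s.
set pQ := face_param _ in QQ *.
have {}HM z : faceset s z -> `|z| <= M + 1 by apply: HM; rewrite ltrDl.
exists (Num.sqrt k.+1%:R * (M + 1 + `|pQ.1|)); split; first exact: num_real.
move=> r Mr y Fy; apply: (le_trans _ (ltW Mr)); apply: (le_trans (norm_le_enorm _)).
rewrite /enorm -(dot_mulmxK _ _ QQ) -/(enorm _) (le_trans (enorm_le_norm _))//.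
rewrite ler_wpM2l ?sqrtr_ge0// -(addKr pQ.1 (y *m _)) addrC.
by rewrite (le_trans (ler_normD _ _))// normrN lerD//; exact: HM.
Qed.

Lemma surface_fin s : surface (faceset s) = (area (faceset s))%:E.
Proof.
rewrite /area fineK// ge0_fin_numE//.
exact: (bounded_leb_lty (bounded_face_coords s) (measurable_face_coords s)).
Qed.

Lemma area_gt0 s : 0 < area (faceset s).
Proof. by rewrite -lte_fin -surface_fin; exact: (face_pos hT). Qed.

Lemma face_nonempty s : faceset s !=set0.
Proof.
apply/set0P/eqP => s0; have := face_pos hT s.
by rewrite /surface s0 preimage_set0 measure0 ltxx.
Qed.

Lemma face_sub_boundary K s : s \in faces K ->
  faceset s `<=` closure (cellset K) `\` cellset K.
Proof.
move=> sK; rewrite (cell_boundary hT) => x sx; exists s => //.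
exact: subset_closure.
Qed.

Lemma face_pos_not_negligible s : ~ (leb k).-negligible (face_coords s).
Proof.
move/(negligibleP _ (measurable_face_coords s)) => s0.
by have := face_pos hT s; rewrite /surface [leb _ _]s0 ltxx.
Qed.

(** If x in K were on the hyperplane, then for any point of the face the segment towards x would lie
    in K and in the hyperplane. The face would thus consist of limit points, outside K, of the trace
    of K on the hyperplane. Such points form a null set, but the face has positive measure. *)
Lemma cell_face_disjoint K s x : s \in faces K -> cellset K x ->
  ~ range (param (face_param (faceset s))) x.
Proof.
move=> sK Kx [y0 _ yx]; have [QQ sQ] := face_paramP s.
set pQ := face_param _ in QQ sQ yx *.
apply: (@face_pos_not_negligible s).
have Kfup : finite_union_polyhedra (param pQ @^-1` cellset K).
  by apply: fup_preimage; case: (cell_polytopal hT K).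
apply: negligibleS (closure_fup Kfup) => y sy.
have [cy ny] := face_sub_boundary sK sy; split=> //.
apply/closure_normP => e e0.
have cK := cellset_convex (K := K); have oK := @cellset_open K.
pose D := 1 + `|y - y0|.
have D0 : 0 < D by rewrite ltr_pwDl.
(* Here 1 - t is at most e / D with D larger than the distance from y0 to y, so the point at
   parameter t is within e of y. *)
pose t := Num.max 0 (1 - e / D).
have t01 : 0 <= t < 1.
  by rewrite /t le_max lexx/= gt_max ltr01/= ltrBlDr ltrDl divr_gt0.
exists (y0 + t *: (y - y0)).
  rewrite /= (_ : param pQ _ = x + t *: (param pQ y - x)).
    exact: convex_open_segment.
  rewrite -yx /param opprD addrACA subrr add0r -mulmxBl.
  by rewrite mulmxDl addrA -scalemxAl.
have -> : y0 + t *: (y - y0) - y = (1 - t) *: (y0 - y).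
  by apply/rowP => i; rewrite !mxE; ring.
have [_ t1] := andP t01.
rewrite normrZ (distrC y0) ger0_norm ?subr_ge0 ?(ltW t1)//.
apply: (@le_lt_trans _ _ (e / D * `|y - y0|)).
  by rewrite ler_wpM2r// lerBlDr -lerBlDl /t le_max lexx orbT.
by rewrite mulrAC ltr_pdivrMr// ltr_pM2l// /D ltrDr.
Qed.

(** By convexity K cannot have points on both sides of a hyperplane that it does not meet. The side
    of [cellpt K] decides between n and -n. *)
Lemma is_normal_exists K s : s \in faces K -> exists n, is_normal K s n.
Proof.
move=> sK; have [QQ sQ] := face_paramP s.
set pQ := face_param _ in QQ sQ *.
have [n nn] := unit_normal_exists pQ.
have ns y : faceset s y -> dot n y = dot n pQ.1.
  by move=> /sQ /(range_paramP _ QQ nn).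
have nK x : cellset K x -> dot n x != dot n pQ.1.
  by move=> Kx; apply/eqP => /(range_paramP x QQ nn); apply: cell_face_disjoint Kx.
suff [m [mm mK]] : exists m, unit_normal pQ m /\ forall x, cellset K x -> dot m x < dot m pQ.1.
  exists m; split.
  - by rewrite /enorm mm.1 sqrtr1.
  - move=> y z /sQ /(range_paramP _ QQ mm) my /sQ /(range_paramP _ QQ mm) mz.
    by rewrite dotBr my mz subrr.
  - move=> x y Kx /sQ /(range_paramP _ QQ mm) my.
    by rewrite dotBr my subr_lt0 mK.
have conn x y : cellset K x -> cellset K y -> dot n x < dot n pQ.1 -> dot n pQ.1 < dot n y -> False.
  move=> Kx Ky nx ny.
  have nxy : 0 < dot n y - dot n x by rewrite subr_gt0 (lt_trans nx).
  have nz : dot n y - dot n x != 0 by rewrite gt_eqF.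
  pose t := (dot n pQ.1 - dot n x) / (dot n y - dot n x).
  have := nK (x + t *: (y - x)); rewrite dotDr dotZr dotBr /t divfK ?nz//.
  rewrite subrKC eqxx => H; suff : ~~ true by []; apply: H.
  apply: convex_segment => //; first exact: cellset_convex.
  apply/andP; split; first by apply: divr_ge0; [rewrite subr_ge0 ltW|exact: ltW].
  by rewrite ler_pdivrMr// mul1r lerD2r ltW.
have [nx|] := ltP (dot n (cellpt K)) (dot n pQ.1).
  exists n; split=> // x Kx; rewrite ltNge le_eqVlt eq_sym (negbTE (nK _ Kx))/=.
  by apply/negP; exact: (conn _ _ (cellpt_in hT K)).
rewrite le_eqVlt eq_sym (negbTE (nK _ (cellpt_in hT K)))/= => nx.
exists (- n); split.
  split; first by rewrite dotNl dotNr opprK nn.1.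
  by rewrite linearN /= mulmxN nn.2 oppr0.
move=> x Kx; rewrite !dotNl ltrN2 ltNge le_eqVlt (negbTE (nK _ Kx))/=.
by apply/negP => h; exact: (conn _ _ Kx (cellpt_in hT K)).
Qed.

Lemma normalP K s : s \in faces K -> is_normal K s (normal K s).
Proof.
move=> sK; have [n hn] := is_normal_exists sK.
exact: (@getPex _ [set n | is_normal K s n] (ex_intro _ n hn)).
Qed.

(** [is_normal] only gives orthogonality to differences of points of the face. If n were not
    orthogonal to all directions of the hyperplane, the face would lie in a proper affine subspace
    of it and have measure zero. *)
Lemma normal_unit K s : s \in faces K ->
  unit_normal (face_param (faceset s)) (normal K s).
Proof.
move=> sK; have [n1 ns nK] := normalP sK; have [QQ sQ] := face_paramP s.
set pQ := face_param _ in QQ sQ *; set n := normal K s in n1 ns nK *.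
split; first by rewrite -enorm_sqr n1 expr1n.
apply/eqP; apply: contraT => Qn; exfalso.
have [z sz] := face_nonempty s; have [z' _ zE] := sQ _ sz.
apply: (@face_pos_not_negligible s).
have m0 : n *m pQ.2^T != 0.
  by apply: contra_neq Qn => E; rewrite -[LHS]trmxK trmx_mul trmxK E trmx0.
exists [set y | dot (n *m pQ.2^T) y = dot (n *m pQ.2^T) z']; split.
- exact: measurable_hyperplane.
- exact: leb_hyperplane.
move=> y sy /=; have E := ns _ _ sy sz.
have : dot n ((y - z') *m pQ.2) = 0.
  by rewrite -[RHS]E -zE /param opprD addrACA subrr add0r mulmxBl.
rewrite dotC dot_mulmx_tr dotC dotBr => /eqP.
by rewrite subr_eq0 => /eqP.
Qed.

(** Signed distance to the hyperplane of [s] from a variable apex. Unlike [dKs], it is visibly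
    affine in x, which the comparison of two apices requires. *)
Definition height K s x : R := dot (normal K s) ((face_param (faceset s)).1 - x).

Lemma height_gt0 K s x : s \in faces K -> cellset K x -> 0 < height K s x.
Proof.
move=> sK Kx; have [n1 ns nK] := normalP sK; have [QQ sQ] := face_paramP s.
have [z sz] := face_nonempty s; have := nK _ _ Kx sz.
have [z' _ zE] := sQ _ sz; rewrite /height !dotBr -zE (dot_normal_param _ (normal_unit sK)).
by rewrite subr_lt0 subr_gt0.
Qed.

Lemma dKsE K s : s \in faces K -> dKs K s = height K s (cellpt K).
Proof.
move=> sK; rewrite /dKs /face_hyperplane (dist_to_range _ (face_paramP s).1 (normal_unit sK)).
by rewrite ger0_norm// ltW// height_gt0//; exact: (cellpt_in hT).
Qed.

Lemma dKs_gt0 K s : s \in faces K -> 0 < dKs K s.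
Proof. by move=> sK; rewrite dKsE// height_gt0//; exact: (cellpt_in hT). Qed.

Lemma cone_measurable K s x : s \in faces K -> cellset K x ->
  measurable (cone_over x (faceset s)).
Proof.
move=> sK Kx; have [QQ sQ] := face_paramP s; have [n1 Qn] := normal_unit sK.
apply: (measurable_cone_over QQ n1 Qn _ sQ); first exact: height_gt0.
exact: measurable_face_coords.
Qed.

(** N is enlarged to the image of a measurable null set of parameters; the cone formula applied to
    the constant 1 then gives volume zero. *)
Lemma cone_null K s x N : s \in faces K -> cellset K x ->
  N `<=` range (param (face_param (faceset s))) ->
  (leb k).-negligible (param (face_param (faceset s)) @^-1` N) ->
  (leb k.+1).-negligible (cone_over x N).
Proof.
move=> sK Kx NQ [B [mB B0 NB]]; have [QQ sQ] := face_paramP s; have [n1 Qn] := normal_unit sK.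
set pQ := face_param _ in NQ NB QQ sQ n1 Qn *.
pose N' := param pQ @` B.
have N'Q : N' `<=` range (param pQ) by move=> _ [y _ <-]; exists y.
have EB : param pQ @^-1` N' = B.
  apply/seteqP; split => y /=; last by exists y.
  by move=> [z Bz /(congr1 (fun v => (v - pQ.1) *m pQ.2^T))]; rewrite !paramK// => <-.
have mS : measurable (param pQ @^-1` N') by rewrite EB.
have h0 : 0 < dot (normal K s) (pQ.1 - x) by exact: height_gt0.
exists (cone_over x N'); split.
- exact: (measurable_cone_over QQ n1 Qn h0 N'Q mS).
- rewrite leb_integral_indic; last exact: (measurable_cone_over QQ n1 Qn h0 N'Q mS).
  have := integral_cone_affine QQ n1 Qn h0 N'Q mS (e := 0) (c := 1).
  rewrite !dot0l add0r ler01 => /(_ isT).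
  under eq_integral do rewrite dot0l add0r.
  under [in RHS]eq_integral do rewrite dot0l add0r.
  rewrite EB !integral_cst//=; last exact: (measurable_cone_over QQ n1 Qn h0 N'Q mS).
  rewrite [leb k B]B0 !mule0 adde0 mule0 mul1e => H.
  rewrite integral_indic//; last exact: (measurable_cone_over QQ n1 Qn h0 N'Q mS).
  by rewrite setIT; apply: H => z _; rewrite dot0l add0r.
move=> _ [t t01 [y Ny <-]]; exists t => //; exists y => //.
by have [y' _ yE] := NQ _ Ny; exists y' => //; apply: NB; rewrite /= yE.
Qed.

End mesh_geometry.

(** * Finite sums of integrals and finite unions of null sets *)

Section integral_tools.
Context d (X : measurableType d) (R : realType) (mu : {measure set X -> \bar R}).

Lemma integrable_sumr (D : set X) I (s : seq I) (P : pred I) (f : I -> X -> R) :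
  measurable D -> (forall i, P i -> mu.-integrable D (EFin \o f i)) ->
  mu.-integrable D (EFin \o (fun x => \sum_(i <- s | P i) f i x)).
Proof.
move=> mD fi; rewrite (_ : EFin \o _ = (fun x => \sum_(i <- s | P i) (f i x)%:E)%E).
  exact: integrable_sum.
by apply/funext => x /=; rewrite sumEFin.
Qed.

Lemma Rintegral_sum (D : set X) I (s : seq I) (P : pred I) (f : I -> X -> R) :
  measurable D -> (forall i, P i -> mu.-integrable D (EFin \o f i)) ->
  \int[mu]_(x in D) (\sum_(i <- s | P i) f i x) =
  \sum_(i <- s | P i) \int[mu]_(x in D) f i x.
Proof.
move=> mD fi; have fiP i : P i -> mu.-integrable D (fun x => (f i x)%:E) by exact: fi.
rewrite /Rintegral; under eq_integral do rewrite -sumEFin.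
have H i : mu.-integrable D (fun x => if P i then (f i x)%:E else 0%E).
  by case: (P i) (fiP i) => h; [exact: h|exact: integrable0].
under eq_integral do rewrite big_mkcond.
rewrite integral_sum// big_mkcond [in RHS]big_mkcond /=.
rewrite -sum_fine => [|i _]; last exact: integrable_fin_num.
apply: eq_bigr => i _; case: ifPn => // _.
by rewrite integral0.
Qed.

Lemma negligible_bigcup_fin (I : finType) (N : I -> set X) :
  (forall i, mu.-negligible (N i)) -> mu.-negligible (\bigcup_(i in [set: I]) N i).
Proof.
move=> hN; pose M (j : nat) := if unpickle j is Some i then N i else set0.
apply: (@negligibleS _ _ _ _ (\bigcup_j M j)).
  by move=> x [i _ Nx]; exists (pickle i) => //; rewrite /M pickleK.
by apply: negligible_bigcup => j; rewrite /M; case: unpickle => [i|]; [exact: hN|exact: negligible_set0].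
Qed.

Lemma integral_EFin_Rintegral (D : set X) (f : X -> R) : measurable D ->
  mu.-integrable D (EFin \o f) ->
  (\int[mu]_(x in D) (f x)%:E)%E = (\int[mu]_(x in D) f x)%:E.
Proof. by move=> mD fi; rewrite /Rintegral fineK//; exact: integrable_fin_num. Qed.

End integral_tools.

(** * Decomposition of a cell into the cones over its faces *)

Section cell_decomposition.
Context {R : realType} {k : nat}.
Variables (Omega : set 'rV[R]_k.+1) (T : mesh R k.+1).
Hypothesis hT : admissible Omega T.
Implicit Types (K : cell T) (s : face T) (n x y z : 'rV[R]_k.+1).
Local Opaque leb.

Local Notation mleb n := (leb n : {measure set 'rV[R]_n -> \bar R}).
Local Notation pQ s := (face_param (faceset s)).

Lemma cellset_measurable K : measurable (cellset K).
Proof. by apply: open_measurable_rV; exact: (cellset_open hT). Qed.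

Lemma cellset_bounded K : bounded_set (cellset K).
Proof. by case: (cell_polytopal hT K). Qed.

Lemma cellset_nonempty K : cellset K (cellpt K).
Proof. exact: (cellpt_in hT). Qed.

Let oK K : open (cellset K). Proof. exact: (cellset_open hT). Qed.
Let cK K : convex_set (cellset K). Proof. exact: (cellset_convex hT). Qed.

Lemma negligible_set1 x : (leb k.+1).-negligible [set x].
Proof.
pose e : 'rV[R]_k.+1 := delta_mx ord0 ord0.
exists [set y | dot e y = dot e x]; split => [||y ->//].
  exact: measurable_hyperplane.
apply: leb_hyperplane; apply/eqP => /matrixP/(_ ord0 ord0).
by rewrite !mxE !eqxx => /eqP; rewrite oner_eq0.
Qed.

Lemma closure_face_range s : closure (faceset s) `<=` range (param (pQ s)).
Proof.
have [QQ sQ] := face_paramP hT s; have [n nn] := unit_normal_exists (pQ s).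
pose B := dot n @^-1` [set dot n (pQ s).1].
have cB : closed B by apply: preimage_closed; [move=> y _; exact: continuous_dot|exact: closed_eq].
have sB : faceset s `<=` B by move=> y /sQ /(range_paramP y QQ nn).
by move=> y /(closure_sub_closed cB sB) => By; apply/(range_paramP y QQ nn).
Qed.

Lemma face_boundary_null s :
  (leb k).-negligible (param (pQ s) @^-1` (closure (faceset s) `\` faceset s)).
Proof.
have [QQ sQ] := face_paramP hT s.
have fup : finite_union_polyhedra (face_coords s).
  by apply: fup_preimage; case: (face_polytopal hT s).
apply: negligibleS (closure_fup fup) => y [cy ny]; split=> //.
exact: closure_param_preimage.
Qed.

Let F K x s := if s \in faces K then cone_over x (faceset s) else set0.

Let mF K x s : cellset K x -> measurable (F K x s).
Proof. by rewrite /F; case: ifPn => // sK; exact: (cone_measurable hT). Qed.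

Let trivF K x (A : set (face T)) : cellset K x -> trivIset A (F K x).
Proof.
move=> Kx; apply/trivIsetP => s t _ _ st; rewrite /F.
case: ifPn => sK; last by rewrite set0I.
case: ifPn => tK; last by rewrite setI0.
apply: (cone_over_disjoint (@cK K) (@oK K) Kx).
- exact: (face_sub_boundary hT).
- exact: (face_sub_boundary hT).
- by have /trivIsetP := face_disjoint hT; apply.
Qed.

Lemma cone_sub_cell K x s : cellset K x -> s \in faces K ->
  cone_over x (faceset s) `<=` cellset K.
Proof.
move=> Kx sK; apply: (cone_over_sub (@cK K) (@oK K) Kx).
by move=> y /(face_sub_boundary hT sK)[].
Qed.

(** From any apex in K, the open cones over the faces are disjoint and miss only the apex and the
    cones over closure(s) minus s, which are null. *)
Lemma ge0_integral_cell K x (f : 'rV[R]_k.+1 -> \bar R) : cellset K x ->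
  measurable_fun (cellset K) f -> (forall z, cellset K z -> 0 <= f z)%E ->
  (\int[leb k.+1]_(z in cellset K) f z =
   \sum_(s in faces K) \int[leb k.+1]_(z in cone_over x (faceset s)) f z)%E.
Proof.
move=> Kx mf f0; have mK := cellset_measurable K.
pose U := \big[setU/set0]_(s <- enum (face T)) F K x s.
have mU : measurable U by apply: bigsetU_measurable => s _; exact: mF.
have UK : U `<=` cellset K.
  move=> y; rewrite /U -bigcup_seq => -[s _]; rewrite /F; case: ifPn => // sK.
  exact: cone_sub_cell.
have N0 : leb k.+1 (cellset K `\` U) = 0%E.
  apply/negligibleP; first exact: measurableD.
  apply: (@negligibleS _ _ _ _ ([set x] `|` \bigcup_(s in [set: face T])
    (if s \in faces K then cone_over x (closure (faceset s) `\` faceset s) else set0))); last first.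
    apply: negligibleU; first exact: negligible_set1.
    apply: negligible_bigcup_fin => s; case: ifPn => sK; last exact: negligible_set0.
    apply: (cone_null hT sK Kx) (face_boundary_null s).
    by move=> y [/closure_face_range].
  move=> v [Kv nUv].
  have [->|] := cone_over_cover (@cK K) (@oK K) (cellset_bounded K) Kx Kv.
    by left.
  move=> [t t01 [y + Ev]]; rewrite (cell_boundary hT) => -[s /= sK cy].
  have [sy|nsy] := pselect (faceset s y); last first.
    by right; exists s => //; rewrite sK; exists t => //; exists y.
  exfalso; apply: nUv; rewrite /U -bigcup_seq; exists s => /=; first exact: mem_enum.
  by rewrite /F sK; exists t => //; exists y.
have mN : measurable (cellset K `\` U) by exact: measurableD.
rewrite (ge0_negligible_integral mN mK mf f0 N0) setDD setIC setIidl//.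
rewrite ge0_integral_bigsetU//=.
- rewrite big_enum /= [RHS]big_mkcond; apply: eq_bigr => s _.
  by rewrite /F; case: ifPn => // _; rewrite integral_set0.
- by move=> s; exact: mF.
- exact: enum_uniq.
- exact: trivF.
- exact: measurable_funS mf.
- by move=> z /UK /f0.
Qed.

Lemma leb_cell_fin K : mleb k.+1 (cellset K) = (volume (cellset K))%:E.
Proof.
rewrite /volume fineK// ge0_fin_numE//.
exact: (bounded_leb_lty (cellset_bounded K) (cellset_measurable K)).
Qed.

Lemma leb_face_coords s : mleb k (face_coords s) = (area (faceset s))%:E.
Proof. exact: (surface_fin hT). Qed.

Lemma integrable_param_coord s i :
  (leb k).-integrable (face_coords s) (fun y : 'rV[R]_k => (param (pQ s) y ord0 i)%:E).
Proof.
have mS := measurable_face_coords hT s.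
apply: (@measurable_bounded_integrable _ _ _ _ (fun y : 'rV[R]_k => param (pQ s) y ord0 i)) => //.
- by rewrite (leb_face_coords s) ltry.
- apply: measurable_funTS.
  exact: (measurableT_comp (measurable_coord i) (measurable_affine (pQ s).1 (pQ s).2)).
have [[M [Mr HM]] _] := face_polytopal hT s; exists M; split=> // r /HM hr y Sy /=.
exact: le_trans (norm_coord_le _ _) (hr _ Sy).
Qed.

Lemma face_integral_affine s e c :
  (\int[leb k]_(y in face_coords s) (dot e (param (pQ s) y) + c)%:E)%E =
  (area (faceset s) * (dot e (barycenter (faceset s)) + c))%:E.
Proof.
have mS := measurable_face_coords hT s; have a0 := area_gt0 hT s.
have ic : (leb k).-integrable (face_coords s) (EFin \o cst c).
  apply/integrableP; split; first exact/measurable_EFinP.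
  rewrite (eq_integral (cst `|c|%:E))// integral_cst// (leb_face_coords s).
  by rewrite -EFinM ltry.
have ie i : (leb k).-integrable (face_coords s) (EFin \o (fun y : 'rV[R]_k => e ord0 i * param (pQ s) y ord0 i)).
  exact: (integrableZl mS (e ord0 i) (integrable_param_coord s i)).
have isum : (leb k).-integrable (face_coords s) (EFin \o (fun y : 'rV[R]_k => dot e (param (pQ s) y))).
  by rewrite /dot; apply: integrable_sumr => // i _; exact: ie.
have ii : (leb k).-integrable (face_coords s)
    (EFin \o (fun y : 'rV[R]_k => dot e (param (pQ s) y) + c)).
  exact: (integrableD mS isum ic).
rewrite (integral_EFin_Rintegral mS ii).
congr EFin; rewrite RintegralD// Rintegral_sum// Rintegral_cst//.
rewrite mulrDr [X in _ + _ * X](_ : _ = area (faceset s))// [c * _]mulrC.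
congr (_ + _); rewrite /dot mulr_sumr; apply: eq_bigr => i _.
rewrite RintegralZl//; last exact: integrable_param_coord.
by rewrite [barycenter _ _ _]mxE [RHS]mulrCA mulVKf// gt_eqF.
Qed.

(** Weights of the apex and of the barycenter of the base. Their sum is 1/(k+1); multiplied by k+2
    they become 1/(k+1) and 1. *)
Let al : R := k.+1%:R^-1 - k.+2%:R^-1.
Let be : R := k.+2%:R^-1.

Lemma integral_cone_face K s x e c : s \in faces K -> cellset K x ->
  0 <= dot e x + c -> (forall z, faceset s z -> 0 <= dot e z + c) ->
  (\int[leb k.+1]_(z in cone_over x (faceset s)) (dot e z + c)%:E)%E =
  (height K s x * (al * ((dot e x + c) * area (faceset s)) +
    be * (area (faceset s) * (dot e (barycenter (faceset s)) + c))))%:E.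
Proof.
move=> sK Kx ex es; have [QQ sQ] := face_paramP hT s; have [n1 Qn] := normal_unit hT sK.
rewrite (integral_cone_affine QQ n1 Qn _ sQ _ ex es); last 2 first.
- exact: (height_gt0 hT).
- exact: (measurable_face_coords hT).
rewrite face_integral_affine (leb_face_coords s).
by rewrite -!EFinM.
Qed.

Lemma leb_cone K s x : s \in faces K -> cellset K x ->
  mleb k.+1 (cone_over x (faceset s)) = (area (faceset s) * height K s x / k.+1%:R)%:E.
Proof.
move=> sK Kx; have mC := cone_measurable hT sK Kx.
have := @integral_cone_face K s x 0 1 sK Kx; rewrite !dot0l !add0r ler01 => /(_ isT).
under eq_integral do rewrite dot0l add0r.
rewrite integral_cst// mul1e => ->; last by move=> z _; rewrite dot0l add0r.
congr EFin; rewrite /al /be -[k.+2%:R]natr1; set a : R := k.+1%:R.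
have a0' : 0 < a by rewrite ltr0n.
by field; rewrite !gt_eqF// addr_gt0.
Qed.

Lemma sum_area_height K x : cellset K x ->
  \sum_(s in faces K) area (faceset s) * height K s x = k.+1%:R * volume (cellset K).
Proof.
move=> Kx; have := ge0_integral_cell (f := cst 1%E) Kx (measurable_cst _) (fun _ _ => lee01).
rewrite integral_cst; last exact: cellset_measurable.
rewrite mul1e (leb_cell_fin K).
under eq_bigr => s sK.
  rewrite integral_cst; last exact: (cone_measurable hT sK Kx).
  rewrite mul1e (leb_cone sK Kx); over.
rewrite sumEFin => -[->]; rewrite mulr_sumr; apply: eq_bigr => s _.
by rewrite [RHS]mulrC divfK// pnatr_eq0.
Qed.

(** A point of K other than [cellpt K] lies on a cone over the boundary, which is therefore not
    empty. *)
Lemma faces_nonempty K : exists s, s \in faces K.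
Proof.
have Kp := cellset_nonempty K; set x := cellpt K in Kp.
have [e e0 He] := open_ball_sub (@oK K) Kp.
pose v : 'rV[R]_k.+1 := delta_mx ord0 ord0.
have v0 : v != 0.
  by apply/eqP => /matrixP/(_ ord0 ord0); rewrite !mxE !eqxx => /eqP; rewrite oner_eq0.
have nv : 0 < `|v| by rewrite normr_gt0.
pose y := x + (e / 2 / `|v|) *: v.
have Ky : cellset K y.
  apply: He; rewrite /y addrC addKr normrZ ger0_norm ?divr_ge0 ?ltW// divfK ?gt_eqF//.
  by rewrite ltr_pdivrMr// ltr_pMr// ltr1n.
have [yx|[t t01 [z + _]]] := cone_over_cover (@cK K) (@oK K) (cellset_bounded K) Kp Ky.
  exfalso; move: yx => /eqP; rewrite /y -subr_eq0 addrC addKr scaler_eq0 (negbTE v0) orbF.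
  by rewrite gt_eqF// !divr_gt0.
by rewrite (cell_boundary hT) => -[s sK _]; exists s.
Qed.

Lemma volume_gt0 K : 0 < volume (cellset K).
Proof.
have Kx := cellset_nonempty K; have k0 : 0 < k.+1%:R :> R by rewrite ltr0n.
rewrite -(pmulr_rgt0 _ k0) -(sum_area_height Kx).
have [s sK] := faces_nonempty K; rewrite (bigD1 s)//=.
rewrite ltr_pwDl ?mulr_gt0 ?(area_gt0 hT) ?(height_gt0 hT)//.
by apply: sumr_ge0 => t /andP[tK _]; rewrite mulr_ge0// ltW ?(area_gt0 hT) ?(height_gt0 hT).
Qed.

(** V is k+2 times the integral of the affine function over K, a number that does not depend on the
    apex: this uniformity is what the comparison of two apices exploits. *)
Lemma integral_cell_affine K x e c : cellset K x ->
  (forall z, closure (cellset K) z -> 0 <= dot e z + c) ->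
  exists V, forall x, cellset K x ->
    V = volume (cellset K) * (dot e x + c) +
        \sum_(s in faces K) area (faceset s) * height K s x *
           (dot e (barycenter (faceset s)) + c).
Proof.
move=> _ ec; exists (k.+2%:R * \int[leb k.+1]_(z in cellset K) (dot e z + c)) => y Ky.
have mf : measurable_fun (cellset K) (fun z => (dot e z + c)%:E).
  apply/measurable_EFinP; apply: measurable_funTS; apply: measurable_funD => //.
  exact: measurable_dotl.
rewrite /Rintegral (ge0_integral_cell Ky mf); last first.
  by move=> z Kz; rewrite lee_fin ec//; exact: subset_closure.
under eq_bigr => s sK.
  rewrite (integral_cone_face sK Ky); last 2 first.
  - by apply: ec; exact: subset_closure.
  - by move=> z /(face_sub_boundary hT sK)[/ec].
  over.
rewrite sumEFin /= mulr_sumr.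
have E := sum_area_height Ky.
have -> : volume (cellset K) * (dot e y + c) =
    \sum_(s in faces K) k.+1%:R^-1 * (area (faceset s) * height K s y * (dot e y + c)).
  by rewrite -mulr_sumr -mulr_suml E mulrA mulKf// pnatr_eq0.
rewrite -big_split /=; apply: eq_bigr => s _.
rewrite /al /be -[k.+2%:R]natr1; set a : R := k.+1%:R.
have a0' : 0 < a by rewrite ltr0n.
by field; rewrite !gt_eqF// addr_gt0.
Qed.

Lemma height_diff K s x y : height K s x - height K s y = dot (normal K s) (y - x).
Proof. by rewrite /height !dotBr; ring. Qed.

(** A constant is added to the linear form so that the integral formulas for nonnegative functions
    apply; it cancels when two apices are compared. *)
Lemma closure_dot_bound K e : exists c, forall z, closure (cellset K) z -> 0 <= dot e z + c.
Proof.
have [M [_ /(_ (M + 1))]] := cellset_bounded K; rewrite ltrDl ltr01 => /(_ isT) HM.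
exists (enorm e * (Num.sqrt k.+1%:R * (M + 1))).
pose c := enorm e * (Num.sqrt k.+1%:R * (M + 1)).
apply: (@closure_sub_closed _ _ [set z | 0 <= dot e z + c]).
  rewrite (_ : [set z | _] = dot e @^-1` [set r | - c <= r]); last first.
    by apply/seteqP; split => z /=; rewrite -lerBlDr sub0r.
  by apply: preimage_closed; [move=> y _; exact: continuous_dot|exact: closed_ge].
move=> z Kz /=; rewrite -lerBlDr sub0r lerNl (le_trans (ler_norm _))// normrN.
rewrite (le_trans (cauchy_schwarz _ _))// ler_wpM2l ?enorm_ge0//.
by rewrite (le_trans (enorm_le_norm _))// ler_wpM2l ?sqrtr_ge0//; exact: HM.
Qed.

(* Comparing the decomposition of [K] into cones for two apices gives the divergence identity for affine fields *)
Theorem sum_area_normal_barycenter K e w :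
  \sum_(s in faces K) area (faceset s) * dot (normal K s) w *
      dot e (barycenter (faceset s) - cellpt K) = volume (cellset K) * dot e w.
Proof.
have Kp := cellset_nonempty K.
have [c ec] := closure_dot_bound K e.
have [V HV] := integral_cell_affine Kp ec.
have [r r0 Hr] := open_ball_sub (@oK K) Kp.
have [->|w0] := eqVneq w 0.
  by rewrite dot0r mulr0 big1// => s _; rewrite dot0r mulr0 mul0r.
pose t := r / 2 / `|w|.
have nw : 0 < `|w| by rewrite normr_gt0.
have t0 : 0 < t by rewrite !divr_gt0.
have Kq : cellset K (cellpt K - t *: w).
  apply: Hr; rewrite addrAC subrr add0r normrN normrZ gtr0_norm// divfK ?gt_eqF//.
  by rewrite ltr_pdivrMr// ltr_pMr// ltr1n.
have E1 := HV _ Kp; rewrite (HV _ Kq) in E1.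
(* Equating the volume of K computed from the two apices. This removes c and replaces xbar_s by
   xbar_s - x_K. *)
have E0 : \sum_(s in faces K) area (faceset s) * dot (normal K s) w = 0.
  have := sum_area_height Kq; rewrite -(sum_area_height Kp) => /eqP.
  rewrite -subr_eq0 -sumrB => /eqP H.
  apply: (mulfI (lt0r_neq0 t0)); rewrite mulr0 -[RHS]H mulr_sumr; apply: eq_bigr => s _.
  by rewrite -mulrBr height_diff opprB addrC subrK dotZr; ring.
apply: (mulfI (lt0r_neq0 t0)).
have -> : t * (volume (cellset K) * dot e w) =
    volume (cellset K) * (dot e (cellpt K) + c) - volume (cellset K) * (dot e (cellpt K - t *: w) + c).
  by rewrite dotBr dotZr; ring.
set P1 := volume _ * (dot e (cellpt K) + c) in E1 *.
set P2 := volume _ * (dot e (_ - _) + c) in E1 *.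
have -> : P1 - P2 = \sum_(s in faces K)
    area (faceset s) * (t * dot (normal K s) w) * (dot e (barycenter (faceset s)) + c).
  transitivity (\sum_(s in faces K) area (faceset s) * height K s (cellpt K - t *: w) *
      (dot e (barycenter (faceset s)) + c) - \sum_(s in faces K) area (faceset s) *
      height K s (cellpt K) * (dot e (barycenter (faceset s)) + c)).
    by move: E1; lra.
  rewrite -sumrB; apply: eq_bigr => s _.
  rewrite -mulrBl -mulrBr height_diff opprB addrC subrK dotZr//.
rewrite mulr_sumr.
transitivity (\sum_(s in faces K) area (faceset s) * (t * dot (normal K s) w) *
    (dot e (barycenter (faceset s)) + c) -
  t * (dot e (cellpt K) + c) * \sum_(s in faces K) area (faceset s) * dot (normal K s) w).
  by rewrite mulr_sumr -sumrB; apply: eq_bigr => s _; rewrite dotBr; ring.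
by rewrite E0 mulr0 subr0.
Qed.

Lemma sum_volume_cone K :
  \sum_(s in faces K) volume (cone K s) = volume (cellset K).
Proof.
have Kp := cellset_nonempty K; have k0 : k.+1%:R != 0 :> R by rewrite pnatr_eq0.
apply: (mulfI k0); rewrite -(sum_area_height Kp) mulr_sumr; apply: eq_bigr => s sK.
by rewrite /volume [leb _ _](leb_cone sK Kp) /= mulrC divfK.
Qed.

End cell_decomposition.

(** * Test functions and weak derivatives *)

Section flat_functions.
Context {R : realType}.

(* All derivatives of [flat 0] are combinations of the [flat k], hence smoothness *)
Definition flat (k : nat) (x : R) : R := if 0 < x then x^-1 ^+ k * expR (- x^-1) else 0.

Lemma flat_ge0 k x : 0 <= flat k x.
Proof.
rewrite /flat; case: ifPn => // x0; rewrite mulr_ge0 ?expR_ge0// exprn_ge0// invr_ge0 ltW//.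
Qed.

(** From exp(s) >= s^(k+2) / (k+2)! at s = 1/x. A quadratic bound at 0 is what makes the derivative
    there vanish. *)
Lemma flat_le k x : flat k x <= (k.+2)`!%:R * x ^+ 2.
Proof.
rewrite /flat; case: ifPn => x0; last by rewrite mulr_ge0// sqr_ge0.
have s0 : 0 < x^-1 by rewrite invr_gt0.
have /(le_trans _) := expR_ge1Dxn k.+1 (ltW s0) => /(_ (x^-1 ^+ k.+2 / (k.+2)`!%:R)).
rewrite lerDr ler01 => /(_ isT).
rewrite ler_pdivrMr ?ltr0n ?fact_gt0// => H.
rewrite expRN ler_pdivrMr ?expR_gt0//.
have -> : x^-1 ^+ k = x ^+ 2 * x^-1 ^+ k.+2.
  by rewrite !exprS; field; rewrite gt_eqF.
rewrite (_ : _ * expR _ = x ^+ 2 * (expR x^-1 * (k.+2)`!%:R)); last by ring.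
by rewrite ler_wpM2l ?sqr_ge0.
Qed.

Let flat_derive0 k : is_derive (0 : R) 1 (flat k) 0.
Proof.
have L : (fun h => h^-1 *: ((flat k \o shift (0 : R)) (h *: (1 : R)) - flat k 0)) @ 0^' --> (0 : R).
  apply/cvgrPdist_lt => e e0.
  exists (e / (k.+2)`!%:R); first by rewrite /= divr_gt0// ltr0n fact_gt0.
  move=> h /= he h0; rewrite sub0r normrN.
  rewrite [flat k 0]/flat ltxx subr0 addr0 /GRing.scale /= mulr1.
  rewrite normrM normfV (ger0_norm (flat_ge0 _ _)).
  have nh : 0 < `|h| by rewrite normr_gt0.
  rewrite mulrC ltr_pdivrMr// (le_lt_trans (flat_le _ _))//.
  rewrite -real_normK ?num_real// expr2 mulrA ltr_pM2r// mulrC.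
  by move: he; rewrite sub0r normrN ltr_pdivlMr ?ltr0n ?fact_gt0// mulrC.
by apply: DeriveDef; [apply/cvg_ex; exists 0|exact: (cvg_lim _ L)].
Qed.

(** For x > 0 this is the product rule for x^-k exp(-1/x), for x < 0 everything is locally zero, and
    at 0 the quadratic bound applies. *)
Lemma flat_derive (k : nat) (x : R) : is_derive x (1 : R) (flat k) (flat k.+2 x - k%:R * flat k.+1 x).
Proof.
have [x0|x0|->] := ltgtP x 0.
- rewrite /flat [0 < x]ltNge ltW//= mulr0 subr0.
  apply: (@near_eq_is_derive _ _ _ (cst 0)).
    near=> y; rewrite ifF//; apply/negbTE; rewrite -leNgt.
    apply: ltW; near: y; exact: lt_nbhsl.
- rewrite /flat x0.
  apply: (@near_eq_is_derive R R R (fun y : R => y^-1 ^+ k * expR (- y^-1) : R)).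
    near=> y; rewrite ifT//.
    near: y; exact: lt_nbhsr.
  have xn0 : x != 0 by rewrite gt_eqF.
  have dV : is_derive x (1 : R) (fun y : R => y^-1) (- x ^- 2 *: 1).
    exact: (is_deriveV (f := id)).
  have dE : is_derive x (1 : R) (expR \o (fun y : R => - y^-1)) (expR (- x^-1) * (- (- x ^- 2 *: 1))).
    exact: (is_derive1_comp (is_derive_expR _) (is_deriveN dV)).
  have := is_deriveM (is_deriveX k dV) dE.
  rewrite (_ : _ * _ = (fun y : R => y^-1 ^+ k * expR (- y^-1))); last first.
    by apply/funext => y; rewrite mulrfctE exprfctE.
  rewrite exprfctE /GRing.scale /= !mulr1 => H.
  apply: is_derive_eq; case: k {H} => [|j]; first by rewrite !expr0 !mul0r mulr0 addr0 subr0; field.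
  by rewrite !exprS /=; field.
- rewrite /flat ltxx mulr0 subr0; exact: flat_derive0.
Unshelve. all: by end_near.
Qed.

Lemma flat_continuous k : continuous (flat k).
Proof.
move=> x; apply/differentiable_continuous/derivable1_diffP.
by have [] := flat_derive k x.
Qed.

End flat_functions.

(** * Smooth bumps on boxes *)

Section smooth_class.
Context {R : realType} {n : nat}.
Implicit Types (f g : 'rV[R]_n -> R) (x v : 'rV[R]_n).

Lemma is_derive_line f x v df s :
  is_derive (x + s *: v) v f df <-> is_derive s 1 (fun t : R => f (x + t *: v)) df.
Proof.
have E : (fun h : R => h^-1 *: ((f \o shift (x + s *: v)) (h *: v) - f (x + s *: v))) =
  (fun h : R => h^-1 *: (((fun t : R => f (x + t *: v)) \o shift s) (h *: (1 : R)) -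
     (fun t : R => f (x + t *: v)) s)).
  apply/funext => h /=; rewrite [in RHS](_ : h *: (1 : R) = h); last exact: mulr1.
  by rewrite scalerDl addrCA.
by split=> -[]; rewrite /derivable /derive ?E => d1 d2; apply: DeriveDef; rewrite /derivable /derive ?E.
Qed.

(** An algebra of continuous functions closed under directional derivatives: closure gives
    smoothness for all iterated partial derivatives at once. *)
Inductive bump_class : ('rV[R]_n -> R) -> Prop :=
| bump_cst c : bump_class (cst c)
| bump_flat k i a b : bump_class (fun x => flat k (a * x ord0 i + b))
| bump_add f g : bump_class f -> bump_class g -> bump_class (fun x => f x + g x)
| bump_mul f g : bump_class f -> bump_class g -> bump_class (fun x => f x * g x).

Lemma bump_class_continuous f : bump_class f -> continuous f.
Proof.
elim=> {f} [c|k i a b|f g _ cf _ cg|f g _ cf _ cg] x.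
- exact: cst_continuous.
- apply: (@continuous_comp _ _ _ (fun x : 'rV[R]_n => a * x ord0 i + b) (flat k)); last exact: flat_continuous.
  apply: (@continuous_comp _ _ _ (fun x : 'rV[R]_n => x ord0 i) (fun t => a * t + b)).
    exact: coord_continuous.
  by apply: cvgD; [exact: mulrl_continuous|exact: cst_continuous].
- exact: (@continuousD _ _ _ f g x (cf x) (cg x)).
- exact: (@continuousM _ _ f g x (cf x) (cg x)).
Qed.

Lemma bump_class_derive f v : bump_class f ->
  exists2 g, bump_class g & forall x, is_derive x v f (g x).
Proof.
elim=> {f} [c|k i a b|f1 f2 _ [g1 b1 d1] _ [g2 b2 d2]|f1 f2 h1 [g1 b1 d1] h2 [g2 b2 d2]].
- by exists (cst 0); [exact: bump_cst|move=> x; exact: is_derive_cst].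
- exists (fun x => a * v ord0 i * (flat k.+2 (a * x ord0 i + b) + (- k%:R) * flat k.+1 (a * x ord0 i + b))).
    apply: bump_mul (bump_cst _) _; apply: bump_add; first exact: bump_flat.
    by apply: bump_mul (bump_cst _) _; exact: bump_flat.
  move=> x; rewrite -[x in is_derive x]addr0 -(scale0r v); apply/is_derive_line.
  pose u (t : R) := (a * v ord0 i) * t + (a * x ord0 i + b).
  have du : is_derive (0 : R) 1 u (a * v ord0 i).
    have := is_deriveD (is_deriveZ (a * v ord0 i) (is_derive_id (0 : R) (1 : R)))
      (is_derive_cst (a * x ord0 i + b) (0 : R) (1 : R)).
    by rewrite addr0 /GRing.scale /= mulr1.
  have -> : (fun t : R => flat k (a * (x + t *: v) ord0 i + b)) = flat k \o u.
    by apply/funext => t; rewrite /u !mxE /=; congr flat; ring.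
  have u0 : u 0 = a * x ord0 i + b by rewrite /u mulr0 add0r.
  have := is_derive1_comp (flat_derive k (u 0)) du.
  by rewrite u0 mulrC mulNr.
- by exists (fun x => g1 x + g2 x); [exact: bump_add|move=> x; exact: is_deriveD].
- exists (fun x => f1 x * g2 x + f2 x * g1 x); last by move=> x; exact: is_deriveM.
  by apply: bump_add; exact: bump_mul.
Qed.

Lemma bump_class_partials (s : seq 'I_n) f : bump_class f -> bump_class (partials s f).
Proof.
move=> bf; elim: s => //= i s IH.
have [g bg dg] := bump_class_derive (delta_mx ord0 i) IH.
by rewrite (_ : partial _ _ = g)//; apply/funext => x; have [] := dg x.
Qed.

Lemma bump_class_smooth f : bump_class f -> smooth f.
Proof.
move=> bf s; have bs := bump_class_partials s bf; split.
  exact: bump_class_continuous.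
move=> i x; have [g _ dg] := bump_class_derive (delta_mx ord0 i) bs.
by have [] := dg x.
Qed.

Lemma bump_class_prod I (r : seq I) (F : I -> 'rV[R]_n -> R) :
  (forall i, bump_class (F i)) -> bump_class (fun x => \prod_(i <- r) F i x).
Proof.
move=> bF; elim: r => [|i r IH].
  by rewrite (_ : (fun _ => _) = cst 1); [exact: bump_cst|apply/funext => x; rewrite big_nil].
rewrite (_ : (fun _ => _) = (fun x => F i x * \prod_(j <- r) F j x)); first exact: bump_mul.
by apply/funext => x; rewrite big_cons.
Qed.

Definition open_box (a b : 'rV[R]_n) : set 'rV[R]_n :=
  box (fun i => `]a ord0 i, b ord0 i[%classic).

(** Bounded by 1, zero outside the box, and tending to 1 inside it as j grows, because exp(-1/(j y))
    tends to 1 for y > 0: these functions approximate the indicator of the box. *)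
Definition box_bump (a b : 'rV[R]_n) (j : nat) (x : 'rV[R]_n) : R :=
  \prod_(i < n) (flat 0 (j%:R * x ord0 i + - (j%:R * a ord0 i)) *
                 flat 0 ((- j%:R) * x ord0 i + j%:R * b ord0 i)).

Lemma box_bump_smooth a b j : smooth (box_bump a b j).
Proof.
by apply: bump_class_smooth; apply: bump_class_prod => i; apply: bump_mul; exact: bump_flat.
Qed.

Lemma flat0_le1 (t : R) : flat 0 t <= 1.
Proof.
rewrite /flat; case: ifPn => // t0; rewrite expr0 mul1r -expR0 ler_expR oppr_le0 invr_ge0.
exact: ltW.
Qed.

Lemma box_bump_itv a b j x : 0 <= box_bump a b j x <= 1.
Proof.
rewrite /box_bump; apply/andP; split.
  by apply: prodr_ge0 => i _; rewrite mulr_ge0 ?flat_ge0.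
apply: prodr_ile1 => i _; rewrite mulr_ge0 ?flat_ge0//= mulr_ile1 ?flat_ge0//; exact: flat0_le1.
Qed.

Lemma box_bump_out a b j x : ~ open_box a b x -> box_bump a b j x = 0.
Proof.
move=> nb; have [i ni] : exists i, ~ (x ord0 i \in `]a ord0 i, b ord0 i[).
  by apply/existsNP => H; apply: nb => i; exact: H.
have j0 : 0 <= j%:R :> R by [].
apply/eqP; rewrite /box_bump prodf_seq_eq0; apply/hasP; exists i; first by rewrite mem_index_enum.
move: ni => /negP; rewrite in_itv /= negb_and -!leNgt mulf_eq0 => /orP[h|h].
- have -> : flat 0 (j%:R * x ord0 i + - (j%:R * a ord0 i)) = 0; last by rewrite eqxx.
  rewrite -mulrBr /flat ifF//; apply/negbTE; rewrite -leNgt.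
  by apply: mulr_ge0_le0 => //; rewrite subr_le0.
- have -> : flat 0 (- j%:R * x ord0 i + j%:R * b ord0 i) = 0; last by rewrite eqxx orbT.
  rewrite mulNr addrC -mulrBr /flat ifF//; apply/negbTE; rewrite -leNgt.
  by apply: mulr_ge0_le0 => //; rewrite subr_le0.
Qed.

Lemma flat0_cvg (y : R) : 0 < y -> flat 0 (j%:R * y) @[j --> \oo] --> (1 : R).
Proof.
move=> y0; apply/cvgrPdist_le => e e0; near=> j.
have j0 : 0 < j%:R :> R by near: j; exact: nbhs_infty_gtr.
have jy : 0 < j%:R * y by exact: mulr_gt0.
rewrite ger0_norm ?subr_ge0 ?flat0_le1// /flat jy expr0 mul1r.
apply: (@le_trans _ _ (j%:R * y)^-1).
  by rewrite lerBlDr -lerBlDl; have := expR_ge1Dx (- (j%:R * y)^-1).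
rewrite invfM -ler_pdivlMr ?invr_gt0// invrK -[leRHS]invrK lef_pV2 ?posrE ?invr_gt0 ?mulr_gt0//.
by apply/ltW; near: j; exact: nbhs_infty_gtr.
Unshelve. all: by end_near.
Qed.

Lemma box_bump_cvg a b x : box_bump a b j x @[j --> \oo] --> (\1_(open_box a b) x : R).
Proof.
rewrite indicE; have [bx|nbx] := boolP (x \in open_box a b); last first.
  rewrite (_ : (fun j => _) = cst 0); first exact: cvg_cst.
  by apply/funext => j; rewrite box_bump_out// => /mem_set; apply/negP.
have -> : (true%:R : R) = \prod_(i < n) (1 * 1) by rewrite big1// => i _; rewrite mulr1.
apply: cvg_big => [|i _]; first exact: mul_continuous.
have := set_mem bx i; rewrite /= in_itv /= => /andP[ax xb].
apply: cvgM.
  rewrite (_ : (fun j => _) = (fun j => flat 0 (j%:R * (x ord0 i - a ord0 i)))).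
    by apply: flat0_cvg; rewrite subr_gt0.
  by apply/funext => j; rewrite mulrBr.
rewrite (_ : (fun j => _) = (fun j => flat 0 (j%:R * (b ord0 i - x ord0 i)))).
  by apply: flat0_cvg; rewrite subr_gt0.
by apply/funext => j; rewrite mulrBr addrC mulNr.
Qed.

Lemma measurable_open_box a b : measurable (open_box a b).
Proof. by apply: measurable_box => i; exact: measurable_itv. Qed.

Lemma compact_closed_ball_rV (c : 'rV[R]_n) r : compact [set x | `|x - c| <= r].
Proof.
apply: bounded_closed_compact.
  exists (`|c| + r); split=> [|M cM x /= xr]; first exact: num_real.
  rewrite (le_trans _ (ltW cM))// -(subrK c x) (le_trans (ler_normD _ _))//.
  by rewrite addrC lerD2l.
apply: (@preimage_closed _ _ (fun x : 'rV[R]_n => `|x - c|) [set t | t <= r]); last exact: closed_le.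
move=> x _.
have idc : {for x, continuous (@idfun 'rV[R]_n)} by exact: cvg_id.
have cc : {for x, continuous (@cst 'rV[R]_n 'rV[R]_n c)} by exact: cst_continuous.
apply: (@continuous_comp _ _ _ (fun y : 'rV[R]_n => y - c) (fun y => `|y|)); last exact: norm_continuous.
exact: (continuousB idc cc).
Qed.

Lemma test_box_bump Omega a b c r j : [set x | `|x - c| <= r] `<=` Omega ->
  open_box a b `<=` [set x | `|x - c| < r] -> test_function Omega (box_bump a b j).
Proof.
move=> cO ab; split; first exact: box_bump_smooth.
exists [set x | `|x - c| <= r]; first exact: compact_closed_ball_rV.
by split=> // x nx; apply: box_bump_out => /ab /ltW.
Qed.

End smooth_class.

(** * Open boxes as a generating family stable under intersection *)

Section generated_boxes.
Context {R : realType} {n : nat}.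

Let G : set (set 'rV[R]_n) := [set open_box a b | a in setT & b in setT].

(** With stability under intersection, this allows Dynkin induction from boxes to all measurable
    sets. *)
Lemma measurable_rV_open_box : @measurable _ 'rV[R]_n = <<s G >>.
Proof.
apply/seteqP; split; last first.
  apply: smallest_sub; first exact: sigma_algebra_measurable.
  by move=> _ [a _ [b _ <-]]; exact: measurable_open_box.
move=> A mA.
(* It suffices that the identity be measurable from the sigma-algebra of boxes, which is checked
   coordinatewise: a half-space x_i > u is a countable union of boxes. *)
pose TG : measurableType _ := g_sigma_algebraType G.
have mid : @measurable_fun _ _ TG 'rV[R]_n setT id.
  apply: measurable_fun_rV => i.
  apply: (measurability _ (RGenOInfty.measurableE R)) => _ [_ [u ->] <-].
  rewrite setTI.
  pose a (k : nat) : 'rV[R]_n := \row_j (if j == i then u else - k%:R).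
  pose b (k : nat) : 'rV[R]_n := \row_j k%:R.
  rewrite (_ : _ @^-1` _ = \bigcup_k (open_box (a k) (b k) : set TG)).
    apply: (@bigcupT_measurable _ TG) => k; apply: sub_sigma_algebra.
    by exists (a k) => //; exists (b k).
  apply/seteqP; split => [x /=|x [k _ /(_ i)]]; last first.
    by rewrite /= !mxE eqxx !in_itv /= andbT => /andP[].
  rewrite in_itv /= andbT => ux; have [k xk] : exists k : nat, `|x| < k%:R.
    by exists (Num.bound `|x|); exact: archi_boundP.
  exists k => // j; rewrite /= !mxE in_itv /=.
  have := le_lt_trans (norm_coord_le x j) xk; rewrite ltr_norml => /andP[h1 ->].
  by rewrite andbT; case: eqP => [->|].
by have := mid measurableT A mA; rewrite setTI.
Qed.

Lemma open_box_setI : setI_closed G.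
Proof.
move=> _ _ [a _ [b _ <-]] [a' _ [b' _ <-]].
exists (\row_i Num.max (a ord0 i) (a' ord0 i)) => //.
exists (\row_i Num.min (b ord0 i) (b' ord0 i)) => //.
apply/seteqP; split => [x H|x [H1 H2] i].
  by split=> i; have := H i; rewrite /= !mxE !in_itv /= gt_max lt_min => /andP[/andP[h1 h2] /andP[h3 h4]]; rewrite ?h1 ?h2 ?h3 ?h4.
have := H1 i; have := H2 i; rewrite /= !mxE !in_itv /= gt_max lt_min.
by move=> /andP[-> ->] /andP[-> ->].
Qed.

End generated_boxes.

(** * The fundamental lemma of the calculus of variations *)

Section fundamental_lemma.
Context {R : realType} {n : nat}.
Let mu : {measure set 'rV[R]_n -> \bar R} := leb n.
Implicit Types (Omega : set 'rV[R]_n) (g : 'rV[R]_n -> R).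

(** The bumps of the box are test functions, and dominated convergence with bound |g| passes to its
    indicator. *)
Let integral_box_eq0 Omega g c r a b : measurable Omega ->
  mu.-integrable Omega (EFin \o g) ->
  (forall psi, test_function Omega psi -> \int[mu]_(x in Omega) (g x * psi x) = 0) ->
  [set x | `|x - c| <= r] `<=` Omega ->
  open_box a b `<=` [set x | `|x - c| < r] ->
  (\int[mu]_(x in open_box a b) (g x)%:E = 0)%E.
Proof.
move=> mO gi H cO ab.
have mg : measurable_fun Omega g by apply/measurable_EFinP; exact: measurable_int gi.
have mb j : measurable_fun Omega (box_bump a b j).
  apply: measurable_funTS; apply: continuous_measurable_rV.
  by have [+ _] := box_bump_smooth a b j [::].
have mgb j : measurable_fun Omega (fun x => (g x * box_bump a b j x)%:E).
  by apply/measurable_EFinP; exact: measurable_funM.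
have le j x : (`|(g x * box_bump a b j x)%:E| <= `|(g x)%:E|)%E.
  rewrite !abse_EFin lee_fin normrM ler_piMr//.
  by have /andP[b0 b1] := box_bump_itv a b j x; rewrite ger0_norm.
have gbi j : mu.-integrable Omega (EFin \o (fun x => g x * box_bump a b j x)).
  apply: (le_integrable mO (mgb j) _ gi) => x _; exact: le.
have I0 j : (\int[mu]_(x in Omega) (g x * box_bump a b j x)%:E = 0)%E.
  by rewrite (integral_EFin_Rintegral mO (gbi j)) H//; exact: test_box_bump cO ab.
have := @dominated_cvg _ _ _ mu _ mO (fun j x => (g x * box_bump a b j x)%:E)
  (fun x => (g x * \1_(open_box a b) x)%:E) (fun x => `|(g x)%:E|%E) mgb.
rewrite (_ : (fun j => integral _ _ _) = cst 0%E); last by apply/funext => j; exact: I0.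
have C x : Omega x -> (g x * box_bump a b j x)%:E @[j --> \oo] --> (g x * \1_(open_box a b) x)%:E.
  move=> _; apply: cvg_EFin; first exact: nearW.
  by apply: cvgM; [exact: cvg_cst|exact: box_bump_cvg].
move=> /(_ C) /(_ (fun x _ => isT)) /(_ (integrable_abse gi)) /(_ (fun j x _ => le j x)) L.
have -> : open_box a b = Omega `&` open_box a b.
  by apply/seteqP; split=> [x bx|x []//]; split=> //; apply: cO; apply/ltW; exact: ab.
rewrite integral_mkcondr (_ : _ \_ _ = (fun x => (g x * \1_(open_box a b) x)%:E)).
  by apply: cvg_unique L _ => //; exact: cvg_cst.
by apply/funext => x; rewrite patchE indicE; case: ifPn; rewrite ?mulr1 ?mulr0.
Qed.

Let open_box_ball (c : 'rV[R]_n) r : 0 < r ->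
  [set x | `|x - c| < r] = open_box (\row_i (c ord0 i - r)) (\row_i (c ord0 i + r)).
Proof.
move=> r0; apply/seteqP; split=> x.
  by move/(norm_lt_coord _ r0) => h i; have := h i; rewrite !mxE /= in_itv /= ltr_distl.
by move=> h; apply/(norm_lt_coord _ r0) => i; have := h i; rewrite !mxE /= in_itv /= ltr_distl.
Qed.

(** Omega is a countable union of balls of the maximum norm, which are boxes. In such a ball B, the
    integral of g over A and B vanishes for boxes A, then for all measurable A by Dynkin induction,
    so g is zero almost everywhere in B. *)
Lemma fundamental_lemma Omega g : open Omega -> mu.-integrable Omega (EFin \o g) ->
  (forall psi, test_function Omega psi -> \int[mu]_(x in Omega) (g x * psi x) = 0) ->
  {ae mu, forall x, Omega x -> g x = 0}.
Proof.
move=> oO gi H; have mO : measurable Omega by exact: open_measurable_rV.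
have [c [r [rO OE]]] := open_bigcup_ball oO.
suff B k : {ae mu, forall x, `|x - c k| < r k -> g x = 0}.
  have := @negligible_bigcup _ _ _ mu (fun k => ~` [set x | `|x - c k| < r k -> g x = 0]) B.
  apply: negligibleS => x /= /not_implyP[]; rewrite OE => -[k _ /= xk] gx.
  by exists k => // /(_ xk).
have [r0|r0] := ltP 0 (r k); last first.
  by apply: aeW => x xr; have := lt_le_trans xr r0; rewrite ltNge normr_ge0.
pose B := [set x | `|x - c k| < r k].
have BO : B `<=` Omega by move=> x /ltW; exact: rO.
have mB : measurable B by exact: measurable_norm_lt.
have giB : mu.-integrable B (EFin \o g) by exact: integrableS gi.
have gIB A : measurable A -> mu.-integrable (A `&` B) (EFin \o g).
  by move=> mA; apply: integrableS giB => //; exact: measurableI.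
have mg A : measurable A -> A `<=` B -> measurable_fun A (EFin \o g).
  by move=> mA AB; apply: measurable_funS (measurable_int _ giB).
have B0 : (\int[mu]_(x in B) (g x)%:E = 0)%E.
  by rewrite /B open_box_ball//; apply: integral_box_eq0 gi H (rO k) _; rewrite // -open_box_ball.
have P A : measurable A -> (\int[mu]_(x in A `&` B) (g x)%:E = 0)%E.
  rewrite measurable_rV_open_box.
  move: A; apply: (dynkin_induction (P := fun A => (\int[mu]_(x in A `&` B) (g x)%:E = 0)%E) measurable_rV_open_box open_box_setI).
  - by rewrite setTI.
  - move=> _ [a _ [b _ <-]].
    have [] := @open_box_setI R n (open_box a b) B.
    + by exists a => //; exists b.
    + by rewrite /B open_box_ball//; eexists => //; eexists.
    move=> a' _ [b' _ E]; rewrite -E; apply: integral_box_eq0 gi H (rO k) _ => //.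
    by rewrite E => x [].
  - move=> S mS S0; have mCB := measurableI _ _ (measurableC mS) mB.
    (* Complements are taken relative to B, over which the integral of g is already known to be
       zero. *)
    have BE : B = (S `&` B) `|` (~` S `&` B) by rewrite -setIUl setUv setTI.
    have dS : [disjoint S `&` B & ~` S `&` B].
      by apply/disj_setPS => x [[Sx _] [/(_ Sx)]].
    have mgS : measurable_fun (S `&` B `|` ~` S `&` B) (EFin \o g).
      by rewrite -BE; exact: mg.
    have := integral_setU mu (measurableI _ _ mS mB) mCB mgS dS.
    by rewrite -BE /= B0 S0 add0e => <-.
  - move=> F mF tF F0; rewrite setI_bigcupl integral_bigcup.
    + by rewrite eseries0// => i _ _; exact: F0.
    + by apply: trivIset_setIr.
    + by move=> i; exact: measurableI.
    + by rewrite -setI_bigcupl; apply: gIB; exact: bigcupT_measurable.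
have [||N [mN N0 HN]] := @integral_ae_eq _ _ _ mu B mB (cst 0%E) (EFin \o g) giB.
- exact: measurable_cst.
- by move=> E EB mE; rewrite integral0 -(setIidl EB) P.
exists N; split=> //; apply: subset_trans HN => x /= h Hx; apply: h => xB.
by have [] := Hx xB.
Qed.

End fundamental_lemma.

(** * Square-integrable functions on a measurable set *)

Section L2_theory.
Context {R : realType} {n : nat}.
Let mu : {measure set 'rV[R]_n -> \bar R} := leb n.
Variable Omega : set 'rV[R]_n.
Hypothesis mO : measurable Omega.
Implicit Types (u v : 'rV[R]_n -> R).

Let sq_patch u x : (`|((u \_ Omega) x)%:E| `^ 2)%E = ((fun x => ((u x) ^+ 2)%:E) \_ Omega) x.
Proof.
rewrite abse_EFin poweR_EFin powR_mulrn ?normr_ge0// !patchE -normrX ger0_norm ?sqr_ge0//.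
by case: ifP => // _; rewrite expr0n.
Qed.

Lemma L2normE u : L2norm Omega u = ((\int[mu]_(x in Omega) ((u x) ^+ 2)%:E) `^ 2^-1)%E.
Proof.
rewrite /L2norm unlock [in RHS]integral_mkcond; congr (_ `^ _)%E.
by apply: eq_integral => x _; exact: sq_patch.
Qed.

Lemma L2norm_ge0 u : (0 <= L2norm Omega u)%E.
Proof. by rewrite L2normE poweR_ge0. Qed.

Lemma L2normK u : (L2norm Omega u `^ 2 = \int[mu]_(x in Omega) ((u x) ^+ 2)%:E)%E.
Proof.
rewrite L2normE -poweRrM mulVf// poweRe1//.
by apply: integral_ge0 => x _; rewrite lee_fin sqr_ge0.
Qed.

Lemma le_L2norm u (c : \bar R) : (0 <= c)%E ->
  (\int[mu]_(x in Omega) ((u x) ^+ 2)%:E <= c `^ 2)%E -> (L2norm Omega u <= c)%E.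
Proof.
move=> c0 h; have I0 : (0 <= \int[mu]_(x in Omega) ((u x) ^+ 2)%:E)%E.
  by rewrite integral_ge0// => x _; rewrite lee_fin sqr_ge0.
rewrite L2normE -[leRHS]poweRe1// -[X in (c `^ X)%E](@divff _ (2 : R))// poweRrM.
have i0 (z : \bar R) : (0 <= z)%E -> z \in `[0%E, +oo%E] by rewrite in_itv /= leey andbT.
by apply: gt0_ler_poweR; rewrite ?i0 ?poweR_ge0 ?invr_ge0.
Qed.

Lemma L2P u : L2 Omega u <->
  measurable_fun Omega u /\ (\int[mu]_(x in Omega) ((u x) ^+ 2)%:E < +oo)%E.
Proof.
have E : (\int[mu]_(x in Omega) ((u x) ^+ 2)%:E < +oo)%E <-> (L2norm Omega u < +oo)%E.
  by rewrite L2normE; split; [exact: poweR_lty|apply: lty_poweRy; rewrite invr_neq0].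
rewrite /L2; split => [/andP[]|[um /E u2]].
  by rewrite !inE /= => /(measurable_restrictT _ mO) h /E.
by apply/andP; split; rewrite inE /=; [exact: (measurable_restrictT _ mO).1|].
Qed.

Lemma L2_measurable u : L2 Omega u -> measurable_fun Omega u.
Proof. by move/L2P => []. Qed.

Lemma L2_sqr_integrable u : L2 Omega u -> mu.-integrable Omega (fun x => ((u x) ^+ 2)%:E).
Proof.
move=> /L2P[um u2]; apply/integrableP; split.
  by apply/measurable_EFinP; exact: measurable_funX.
under eq_integral => x _ do rewrite gee0_abs ?lee_fin ?sqr_ge0//.
exact: u2.
Qed.

Lemma integrable_sqr_L2 u : measurable_fun Omega u ->
  mu.-integrable Omega (fun x => ((u x) ^+ 2)%:E) -> L2 Omega u.
Proof.
move=> um /integrableP[_]; under eq_integral => x _ do rewrite gee0_abs ?lee_fin ?sqr_ge0//.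
by move=> u2; apply/L2P.
Qed.

(** Domination by u^2 + v^2. *)
Lemma L2_mul_integrable u v : L2 Omega u -> L2 Omega v ->
  mu.-integrable Omega (EFin \o (fun x => u x * v x)).
Proof.
move=> hu hv; have := integrableD mO (L2_sqr_integrable hu) (L2_sqr_integrable hv).
apply: le_integrable => //.
  by apply/measurable_EFinP; apply: measurable_funM; exact: L2_measurable.
move=> x _; rewrite /= !lee_fin normrM (ger0_norm (addr_ge0 (sqr_ge0 _) (sqr_ge0 _))).
rewrite -(real_normK (num_real (u x))) -(real_normK (num_real (v x))).
have := sqr_ge0 (`|u x| - `|v x|); have := mulr_ge0 (normr_ge0 (u x)) (normr_ge0 (v x)).
nra.
Qed.

Lemma L2D u v : L2 Omega u -> L2 Omega v -> L2 Omega (fun x => u x + v x).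
Proof.
move=> hu hv; apply: integrable_sqr_L2.
  by apply: measurable_funD; exact: L2_measurable.
have := integrableD mO (integrableD mO (L2_sqr_integrable hu) (L2_sqr_integrable hv))
  (integrableD mO (L2_mul_integrable hu hv) (L2_mul_integrable hu hv)).
congr (_.-integrable _ _); apply/funext => x /=; rewrite -!EFinD; congr EFin; ring.
Qed.

Lemma L2Z (a : R) u : L2 Omega u -> L2 Omega (fun x => a * u x).
Proof.
move=> hu; apply: integrable_sqr_L2.
  by apply: measurable_funM => //; exact: L2_measurable.
have := integrableZl mO (a ^+ 2) (L2_sqr_integrable hu).
by congr (_.-integrable _ _); apply/funext => x /=; rewrite exprMn EFinM.
Qed.

Lemma L2N u : L2 Omega u -> L2 Omega (fun x => - u x).
Proof.
by move=> /(L2Z (-1)); congr L2; apply/funext => x; rewrite mulN1r.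
Qed.

Lemma L2B u v : L2 Omega u -> L2 Omega v -> L2 Omega (fun x => u x - v x).
Proof. by move=> hu hv; apply: L2D => //; exact: L2N. Qed.

Lemma L2_sum I (r : seq I) (P : pred I) (u : I -> 'rV[R]_n -> R) :
  (forall i, P i -> L2 Omega (u i)) -> L2 Omega (fun x => \sum_(i <- r | P i) u i x).
Proof.
move=> h; elim: r => [|i r IH].
  rewrite (_ : (fun _ => _) = cst 0); last by apply/funext => x; rewrite big_nil.
  apply/L2P; split; first exact: measurable_cst.
  by under eq_integral do rewrite /= expr0n; rewrite integral0.
rewrite (_ : (fun _ => _) = (fun x => (if P i then u i x else 0) + \sum_(j <- r | P j) u j x)).
  case: (boolP (P i)) => Pi; first by apply: L2D => //; exact: h.
  by rewrite (_ : (fun _ => _) = (fun x => \sum_(j <- r | P j) u j x))//; apply/funext => x; rewrite add0r.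
by apply/funext => x; rewrite big_cons; case: ifP => //; rewrite add0r.
Qed.

(** Domination by 1 + u^2. *)
Lemma L2_integrable u : (mu Omega < +oo)%E -> L2 Omega u -> mu.-integrable Omega (EFin \o u).
Proof.
move=> Ofin hu.
have c1 : mu.-integrable Omega (EFin \o (fun=> 1 : R)).
  by apply/integrableP; split; [by apply/measurable_EFinP; exact: measurable_cst|rewrite [ltLHS](integral_cst mu mO) /= normr1 mul1e].
apply: le_integrable (integrableD mO c1 (L2_sqr_integrable hu)) => //.
  by apply/measurable_EFinP; exact: L2_measurable.
move=> x _ /=; rewrite lee_fin [leRHS]ger0_norm ?addr_ge0 ?sqr_ge0//.
rewrite -(real_normK (num_real (u x))); have := sqr_ge0 (`|u x| - 1); have := normr_ge0 (u x).
nra.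
Qed.

Lemma L2_bounded u (M : R) : (mu Omega < +oo)%E -> measurable_fun Omega u ->
  (forall x, `|u x| <= M) -> L2 Omega u.
Proof.
move=> Ofin mu0 uM; apply/L2P; split=> //.
have M0 : 0 <= M by rewrite (le_trans (normr_ge0 _) (uM 0)).
apply: (@le_lt_trans _ _ (\int[mu]_(x in Omega) (M ^+ 2)%:E)%E).
  apply: ge0_le_integral => //.
  - by move=> x _; rewrite lee_fin sqr_ge0.
  - by apply/measurable_EFinP; exact: measurable_funX.
  - by move=> x _; rewrite lee_fin -(real_normK (num_real (u x))) ler_pXn2r ?nnegrE.
by rewrite integral_cst// lte_mul_pinfty// lee_fin sqr_ge0.
Qed.

Lemma L2normD u v : measurable_fun Omega u -> measurable_fun Omega v ->
  (L2norm Omega (fun x => (u x + v x)%R) <= L2norm Omega u + L2norm Omega v)%E.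
Proof.
move=> /(measurable_restrictT _ mO) um /(measurable_restrictT _ mO) vm.
have := minkowski_EFin mu um vm (ler1n _ 2).
rewrite /L2norm; congr (_ <= _)%E; congr ('N[_]_ _ [_ ])%E.
apply/funext => x; rewrite /= !patchE; case: ifP => //; rewrite addr0//.
Qed.

Lemma L2norm_fin u : L2 Omega u -> L2norm Omega u \is a fin_num.
Proof.
move=> /L2P[_ h]; rewrite ge0_fin_numE ?L2norm_ge0// L2normE.
exact: poweR_lty.
Qed.

Lemma Rintegral_mul_le_L2norm u v : L2 Omega u -> L2 Omega v ->
  `|\int[mu]_(x in Omega) (u x * v x)| <= fine (L2norm Omega u) * fine (L2norm Omega v).
Proof.
move=> hu hv; rewrite -lee_fin EFinM !fineK ?L2norm_fin//.
have um := (measurable_restrictT _ mO).1 (L2_measurable hu).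
have vm := (measurable_restrictT _ mO).1 (L2_measurable hv).
have two : (2^-1 + 2^-1 = 1 :> R)%R by have := splitr (1 : R); rewrite mul1r.
apply: (le_trans _ (hoelder mu um vm (ltr0n _ 2) (ltr0n _ 2) two)).
rewrite Lnorm1 (@le_trans _ _ (\int[mu]_(x in Omega) `|(u x * v x)%:E|)%E)//.
  have uvi := L2_mul_integrable hu hv.
  rewrite -abse_EFin -integral_EFin_Rintegral//.
  by apply: le_abse_integral => //; exact: measurable_int uvi.
rewrite [leLHS]integral_mkcond le_eqVlt; apply/orP; left; apply/eqP.
apply: eq_integral => x _; rewrite /= !patchE; case: ifP => // _.
by rewrite mul0r normr0.
Qed.

End L2_theory.

(** * Derivatives of compactly supported functions integrate to zero *)

Section compactly_supported.
Context {R : realType} {n : nat}.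
Let mu : {measure set 'rV[R]_n -> \bar R} := leb n.
Implicit Types (C : set 'rV[R]_n) (f : 'rV[R]_n -> R).

Lemma integral_leb_shift (c : 'rV[R]_n) f : mu.-integrable setT (EFin \o f) ->
  (\int[mu]_x (f (x + c)%R)%:E = \int[mu]_x (f x)%:E)%E.
Proof.
move=> fi; have mf := measurable_int _ fi.
rewrite integralE [RHS]integralE; congr (_ - _)%E.
  rewrite -[RHS](ge0_integral_leb_shift c (measurable_funepos mf) (fun=> funepos_ge0 _ _)).
  by apply: eq_integral => x _; rewrite !funeposE.
rewrite -[RHS](ge0_integral_leb_shift c (measurable_funeneg mf) (fun=> funeneg_ge0 _ _)).
by apply: eq_integral => x _; rewrite !funenegE.
Qed.

Lemma compact_supp_bounded C f : compact C -> continuous f -> (forall x, ~ C x -> f x = 0) ->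
  exists2 M, 0 <= M & forall x, `|f x| <= M.
Proof.
move=> cC cf f0.
have : compact (f @` C) by apply: continuous_compact => //; exact: continuous_subspaceT.
move=> /compact_bounded[M [_ /(_ (`|M| + 1)) MC]].
have M1 : M < `|M| + 1 by rewrite (le_lt_trans (ler_norm _))// ltrDl.
exists (`|M| + 1); first by rewrite addr_ge0.
move=> x; have [Cx|nCx] := pselect (C x); last by rewrite f0// normr0 addr_ge0.
by apply: MC => //; exists x.
Qed.

Lemma compact_measurable_rV C : compact C -> measurable C.
Proof. by move=> /compact_closed cC; apply: closed_measurable_rV; exact: cC. Qed.

Lemma leb_compact_lty C : compact C -> (mu C < +oo)%E.
Proof. move=> cC; exact: (bounded_leb_lty (compact_bounded cC) (compact_measurable_rV cC)). Qed.

Lemma integrable_bounded_supp (D C : set 'rV[R]_n) f M : measurable D -> measurable C -> (mu C < +oo)%E ->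
  measurable_fun D f -> (forall x, `|f x| <= M * \1_C x) -> mu.-integrable D (EFin \o f).
Proof.
move=> mD mC Cfin mf fM.
have : mu.-integrable D (EFin \o (fun x => M * \1_C x)).
  have i1 : mu.-integrable D (EFin \o \1_C).
    apply: (integrableS measurableT) => //; apply/integrableP; split.
      by apply/measurable_EFinP; exact: measurable_indic.
    under eq_integral do rewrite gee0_abs ?lee_fin//.
    by rewrite integral_indic// setIT.
  have := integrableZl mD M i1.
  by congr (_.-integrable _ _); apply/funext => x.
apply: le_integrable => //; first exact/measurable_EFinP.
by move=> x _; rewrite !abse_EFin lee_fin (le_trans (fM x))// ler_norm.
Qed.

Lemma compact_supp_integrable C f : compact C -> continuous f ->
  (forall x, ~ C x -> f x = 0) -> mu.-integrable setT (EFin \o f).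
Proof.
move=> cC cf f0; have [M M0 fM] := compact_supp_bounded cC cf f0.
apply: (@integrable_bounded_supp _ C _ M) => //.
- exact: compact_measurable_rV.
- exact: leb_compact_lty.
- exact: continuous_measurable_rV.
- move=> x; rewrite indicE; have [_|nCx] := boolP (x \in C); first by rewrite mulr1.
  by rewrite mulr0 f0 ?normr0// => Cx; move/negP: nCx; apply; exact/mem_set.
Qed.

Lemma partial_supp C f i : closed C -> (forall x, ~ C x -> f x = 0) ->
  forall x, ~ C x -> partial i f x = 0.
Proof.
move=> cC f0 x nCx; rewrite /partial (@near_eq_derive _ _ _ f (cst 0)).
  exact: derive_cst.
near=> y; apply: f0; near: y.
by apply: open_nbhs_nbhs; split => //; exact: closed_openC.
Unshelve. all: by end_near.
Qed.

Lemma mvt_bound f (M : R) (v : 'rV[R]_n) : continuous f -> (forall x, derivable f x v) ->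
  (forall x, `|'D_v f x| <= M) -> forall x h, 0 < h -> `|f (x + h *: v) - f x| <= M * h.
Proof.
move=> cf df dM x h h0.
have dl s : is_derive s (1 : R) (fun t : R => f (x + t *: v)) ('D_v f (x + s *: v)).
  by apply/is_derive_line; exact: derivableP.
have [|c _] := @MVT R (fun t : R => f (x + t *: v)) (fun s => 'D_v f (x + s *: v)) 0 h h0 (fun s _ => dl s).
  apply: continuous_subspaceT => s.
  by apply/differentiable_continuous/derivable1_diffP; have [] := dl s.
rewrite scale0r addr0 subr0 => ->.
by rewrite normrM (gtr0_norm h0) ler_wpM2r// ltW.
Qed.

(** Difference quotients have integral zero by translation invariance. The mean value theorem bounds
    them by M on a fixed ball, so dominated convergence carries this to the derivative. *)
Lemma integral_partial_eq0 C f i : compact C -> continuous f -> (forall x, ~ C x -> f x = 0) ->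
  (forall x, derivable f x (delta_mx ord0 i)) -> continuous (partial i f) ->
  (\int[mu]_x (partial i f x)%:E = 0)%E.
Proof.
move=> cC cf f0 df cdf; set e := delta_mx ord0 i : 'rV[R]_n.
have clC : closed C by apply: compact_closed => //; exact: norm_hausdorff.
have [M M0 dM] := compact_supp_bounded cC cdf (partial_supp i clC f0).
have [r [_ rC]] := compact_bounded cC.
pose r1 := `|r| + 1.
have Cr x : C x -> `|x| <= r1.
  by apply: rC; rewrite (le_lt_trans (ler_norm _))// ltrDl.
(* The steps h j are at most 1, so this ball contains the supports of all the difference
   quotients. *)
pose B := [set x : 'rV[R]_n | `|x - 0| <= r1 + `|e|].
have cB : compact B by exact: compact_closed_ball_rV.
pose h (j : nat) : R := j.+1%:R^-1.
have h0 j : 0 < h j by rewrite invr_gt0.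
have h1 j : h j <= 1 by rewrite invf_le1// ler1n.
pose D j x := (h j)^-1 * (f (x + h j *: e) - f x).
have fi := compact_supp_integrable cC cf f0.
have mf : measurable_fun setT f by exact: continuous_measurable_rV.
have fsi c : mu.-integrable setT (EFin \o (fun x => f (x + c))).
  apply: (@compact_supp_integrable [set x | `|x - (- c)| <= r1]).
  - exact: compact_closed_ball_rV.
  - move=> x; apply: (@continuous_comp _ _ _ (fun y : 'rV[R]_n => y + c) f); last exact: cf.
    have idc : {for x, continuous (@idfun 'rV[R]_n)} by exact: cvg_id.
    have cc : {for x, continuous (@cst 'rV[R]_n 'rV[R]_n c)} by exact: cst_continuous.
    exact: (continuousD idc cc).
  - by move=> x /=; rewrite opprK => xr; apply: f0 => /Cr.
have D0 j : (\int[mu]_x (D j x)%:E = 0)%E.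
  under eq_integral do rewrite EFinM.
  rewrite integralZl//; last exact: (integrableB measurableT (fsi _) fi).
  by rewrite (integralB_EFin measurableT (fsi _) fi) integral_leb_shift// subee ?mule0// integrable_fin_num.
have mD j : measurable_fun setT (fun x => (D j x)%:E).
  have := measurable_int _ (integrableZl measurableT (h j)^-1 (integrableB measurableT (fsi (h j *: e)) fi)).
  by [].
have le j x : (`|(D j x)%:E| <= (M * \1_B x)%:E)%E.
  rewrite abse_EFin lee_fin indicE; have [_|nBx] := boolP (x \in B).
    rewrite mulr1 normrM ger0_norm ?invr_ge0 ?(ltW (h0 j))// mulrC ler_pdivrMr//.
    exact: mvt_bound.
  have nB : r1 + `|e| < `|x|.
    by rewrite ltNge -[x in X in ~~ X]subr0; apply: contra nBx => ?; exact/mem_set.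
  rewrite mulr0 /D f0 ?f0 ?subrr ?mulr0 ?normr0//.
    by move=> /Cr; apply/negP; rewrite -ltNge (le_lt_trans _ nB)// lerDl.
  move=> /Cr; apply/negP; rewrite -ltNge.
  have : `|x| <= `|x + h j *: e| + `|h j *: e|.
    by rewrite -{1}(addrK (h j *: e) x) (le_trans (ler_normB _ _)).
  have : `|h j *: e| <= `|e| by rewrite normrZ gtr0_norm// ler_piMl.
  by move: nB; lra.
have C0 x : setT x -> (D j x)%:E @[j --> \oo] --> (partial i f x)%:E.
  move=> _; apply: cvg_EFin; first exact: nearW.
  have hd : h @ \oo --> (0 : R)^'.
    move=> A [eps eps0 HA]; have : \forall j \near \oo, `|0 - h j| < eps.
      by have /cvgrPdist_lt := @cvg_harmonic R; exact.
    by apply: filterS => j ?; apply: HA => //; rewrite gt_eqF.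
  have := cvg_comp _ _ hd (df x).
  apply: cvg_trans; apply: near_eq_cvg; apply: nearW => j /=.
  by rewrite /D [x + _]addrC.
have iB : mu.-integrable setT (fun x => (M * \1_B x)%:E).
  have i1 : mu.-integrable setT (EFin \o \1_B).
    have mB := compact_measurable_rV cB.
    apply: (@integrable_bounded_supp _ B _ 1) => //.
    - exact: leb_compact_lty.
    - by move=> x; rewrite mul1r ger0_norm.
  by have := integrableZl measurableT M i1.
have := @dominated_cvg _ _ _ mu _ measurableT (fun j x => (D j x)%:E)
  (fun x => (partial i f x)%:E) (fun x => (M * \1_B x)%:E) mD C0 (fun x _ => isT) iB (fun j x _ => le j x).
rewrite (_ : (fun j => integral _ _ _) = cst 0%E); last by apply/funext => j; exact: D0.
by move=> L; apply/esym; apply: cvg_unique L => //; exact: cvg_cst.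
Qed.

End compactly_supported.

(** * Weak gradients and divergences up to null sets *)

Section weak_derivatives.
Context {R : realType} {n : nat}.
Let mu : {measure set 'rV[R]_n -> \bar R} := leb n.
Variable Omega : set 'rV[R]_n.
Hypotheses (oO : open Omega) (Ofin : (mu Omega < +oo)%E).
Let mO : measurable Omega. Proof. exact: open_measurable_rV. Qed.
Implicit Types (u psi phi : 'rV[R]_n -> R) (g F : 'rV[R]_n -> 'rV[R]_n).

Lemma ae_Rintegral u v : measurable_fun Omega u -> measurable_fun Omega v ->
  {ae mu, forall x, Omega x -> u x = v x} ->
  \int[mu]_(x in Omega) u x = \int[mu]_(x in Omega) v x.
Proof.
move=> um vm uv; rewrite /Rintegral; congr fine; apply: ae_eq_integral => //.
- exact/measurable_EFinP.
- exact/measurable_EFinP.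
- by apply: filterS uv => x uv Ox; rewrite uv.
Qed.

Lemma ae_L2norm u v : measurable_fun Omega u -> measurable_fun Omega v ->
  {ae mu, forall x, Omega x -> u x = v x} -> L2norm Omega u = L2norm Omega v.
Proof.
move=> um vm uv; rewrite !L2normE; congr (_ `^ _)%E; apply: ae_eq_integral => //.
- by apply/measurable_EFinP; exact: measurable_funX.
- by apply/measurable_EFinP; exact: measurable_funX.
- by apply: filterS uv => x uv Ox; rewrite uv.
Qed.

Let cont_mul psi phi : continuous psi -> continuous phi -> continuous (fun x => psi x * phi x).
Proof. by move=> c1 c2 x; exact: (@continuousM _ _ psi phi x (c1 x) (c2 x)). Qed.

Let cont_add psi phi : continuous psi -> continuous phi -> continuous (fun x => psi x + phi x).
Proof. by move=> c1 c2 x; exact: (@continuousD _ _ _ psi phi x (c1 x) (c2 x)). Qed.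

Let test_cont psi : test_function Omega psi -> continuous psi.
Proof. by move=> [/(_ [::])[+ _] _]. Qed.

Let test_derivable psi i x : test_function Omega psi -> derivable psi x (delta_mx ord0 i).
Proof. by move=> [/(_ [::])[_ +] _]; exact. Qed.

Let test_partial_cont psi i : test_function Omega psi -> continuous (partial i psi).
Proof. by move=> [/(_ [:: i])[+ _] _]. Qed.

Let L2_compact_supp u C : compact C -> continuous u -> (forall x, ~ C x -> u x = 0) -> L2 Omega u.
Proof.
move=> cC cu u0; have [M M0 uM] := compact_supp_bounded cC cu u0.
apply: L2_bounded uM => //; apply: measurable_funTS; exact: continuous_measurable_rV.
Qed.

Lemma test_L2 psi : test_function Omega psi -> L2 Omega psi.
Proof.
by move=> tp; have [_ [C cC [_ C0]]] := tp; apply: L2_compact_supp cC (test_cont tp) C0.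
Qed.

Lemma test_grad_L2 psi i : test_function Omega psi -> L2 Omega (partial i psi).
Proof.
move=> tp; have [_ [C cC [_ C0]]] := tp.
have clC : closed C by apply: compact_closed => //; exact: norm_hausdorff.
exact: L2_compact_supp cC (@test_partial_cont _ i tp) (partial_supp i clC C0).
Qed.

(** The product is supported in a compact subset of Omega, so the integral of its derivative over
    Omega is the integral over the whole space, which is zero. *)
Lemma test_integration_by_parts psi phi i : test_function Omega psi -> test_function Omega phi ->
  \int[mu]_(x in Omega) (psi x * partial i phi x) =
  - \int[mu]_(x in Omega) (partial i psi x * phi x).
Proof.
move=> tp tq; have [_ [C cC [CO C0]]] := tp.
have clC : closed C by apply: compact_closed => //; exact: norm_hausdorff.
pose chi x := psi x * phi x.
have dE x : partial i chi x = psi x * partial i phi x + partial i psi x * phi x.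
  rewrite /partial /chi (deriveM (@test_derivable _ i x tp) (@test_derivable _ i x tq)).
  by congr (_ + _); exact: mulrC.
have chi0 x : ~ C x -> chi x = 0 by move=> /C0; rewrite /chi => ->; rewrite mul0r.
have I0 : (\int[mu]_x (partial i chi x)%:E = 0)%E.
  apply: (integral_partial_eq0 cC _ chi0).
  - exact: (cont_mul (test_cont tp) (test_cont tq)).
  - by move=> x; exact: (@derivableM _ _ psi phi x _ (@test_derivable _ i x tp) (@test_derivable _ i x tq)).
  - rewrite (_ : partial i chi = fun x => psi x * partial i phi x + partial i psi x * phi x).
      apply: cont_add; first exact: (cont_mul (test_cont tp) (@test_partial_cont _ i tq)).
      exact: (cont_mul (@test_partial_cont _ i tp) (test_cont tq)).
    exact/funext.
have IO : \int[mu]_(x in Omega) partial i chi x = 0.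
  rewrite /Rintegral integral_mkcond; rewrite -[RHS](_ : fine 0%E = 0)// -I0; congr fine.
  apply: eq_integral => x _; rewrite patchE; case: ifPn => // nO.
  rewrite (partial_supp i clC chi0)// => /CO /mem_set.
  exact/negP.
apply/eqP; rewrite -subr_eq0 opprK -IO; apply/eqP.
rewrite -RintegralD//.
- by apply: eq_Rintegral => x _; rewrite dE.
- by apply: L2_mul_integrable => //; [exact: test_L2|exact: test_grad_L2].
- by apply: L2_mul_integrable => //; [exact: test_grad_L2|exact: test_L2].
Qed.

Lemma test_is_weak_grad psi : test_function Omega psi -> is_weak_grad Omega psi (grad psi).
Proof.
move=> tp; split=> [i|phi tq i].
  rewrite (_ : (fun _ => _) = partial i psi); first exact: test_grad_L2.
  by apply/funext => x; rewrite mxE.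
rewrite test_integration_by_parts//; congr (- _).
by apply: eq_Rintegral => x _; rewrite mxE.
Qed.

Lemma weak_gradP u : H1 Omega u -> is_weak_grad Omega u (weak_grad Omega u).
Proof. by move=> [_ ex]; exact: (getPex ex). Qed.

Let fundamental_L2 u v : L2 Omega u -> L2 Omega v ->
  (forall psi, test_function Omega psi ->
    \int[mu]_(x in Omega) (u x * psi x) = \int[mu]_(x in Omega) (v x * psi x)) ->
  {ae mu, forall x, Omega x -> u x = v x}.
Proof.
move=> hu hv uv.
have := @fundamental_lemma R n Omega (fun x => u x - v x) oO
  (L2_integrable mO Ofin (L2B mO hu hv)).
move=> H; have {H} : {ae mu, forall x, Omega x -> u x - v x = 0}.
  apply: H => psi tp.
  under eq_Rintegral do rewrite mulrBl.
  rewrite RintegralB//; last 2 first.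
  - exact: L2_mul_integrable (test_L2 tp).
  - exact: L2_mul_integrable (test_L2 tp).
  by rewrite uv// subrr.
by apply: filterS => x h /h /eqP; rewrite subr_eq0 => /eqP.
Qed.

(** The chosen representative and g have the same integrals against test functions, coordinate by
    coordinate. *)
Lemma ae_weak_grad u g : is_weak_grad Omega u g ->
  {ae mu, forall x, Omega x -> weak_grad Omega u x = g x}.
Proof.
move=> hg; have [h2 hw] : is_weak_grad Omega u (weak_grad Omega u).
  by apply: (getPex (ex_intro _ g hg)).
case: hg => g2 hg.
have : {ae mu, forall x, forall i, Omega x -> weak_grad Omega u x ord0 i = g x ord0 i}.
  apply: filter_forall => i; apply: fundamental_L2 => // psi tp.
  by apply: oppr_inj; rewrite -hw// -hg.
by apply: filterS => x h Ox; apply/rowP => i; exact: h.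
Qed.

Lemma ae_weak_div F u : is_weak_div Omega F u ->
  {ae mu, forall x, Omega x -> weak_div Omega F x = u x}.
Proof.
move=> hu; have [h2 hw] : is_weak_div Omega F (weak_div Omega F).
  by apply: (getPex (ex_intro _ u hu)).
case: hu => u2 hu; apply: fundamental_L2 => // psi tp.
by apply: oppr_inj; rewrite -hw// -hu.
Qed.

Lemma weak_divP F u : is_weak_div Omega F u -> is_weak_div Omega F (weak_div Omega F).
Proof. by move=> hu; apply: (getPex (ex_intro _ u hu)). Qed.

Lemma L2v_dot F g : L2v Omega F -> L2v Omega g ->
  mu.-integrable Omega (EFin \o (fun x => dot (F x) (g x))).
Proof.
move=> hF hg; rewrite (_ : EFin \o _ = fun x => (\sum_(i < n) (F x ord0 i * g x ord0 i)%:E)%E).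
  by apply: integrable_sum => // i _; exact: L2_mul_integrable.
by apply/funext => x; rewrite /= /dot sumEFin.
Qed.

Lemma L2v_measurable F : L2v Omega F -> measurable_fun Omega (fun x => dot (F x) (F x)).
Proof.
move=> hF; apply: measurable_sum => i; apply: measurable_funM; exact: L2_measurable.
Qed.

Lemma L2v_enorm F : L2v Omega F -> L2 Omega (fun x => enorm (F x)).
Proof.
move=> hF; apply: integrable_sqr_L2 => //.
  rewrite (_ : (fun _ => _) = @Num.sqrt R \o (fun x => dot (F x) (F x)))//.
  by apply: measurableT_comp; [exact: (continuous_measurable_fun (@sqrt_continuous R))|exact: L2v_measurable].
have := L2v_dot hF hF; congr (_.-integrable _ _).
by apply/funext => x; rewrite /= enorm_sqr.
Qed.

Lemma L2vD F g : L2v Omega F -> L2v Omega g -> L2v Omega (fun x => F x + g x).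
Proof.
move=> hF hg i; rewrite (_ : (fun _ => _) = fun x => F x ord0 i + g x ord0 i); first exact: L2D.
by apply/funext => x; rewrite mxE.
Qed.

Lemma L2vN F : L2v Omega F -> L2v Omega (fun x => - F x).
Proof.
move=> hF i; rewrite (_ : (fun _ => _) = fun x => - F x ord0 i); first exact: L2N.
by apply/funext => x; rewrite mxE.
Qed.

Lemma grad_L2v psi : test_function Omega psi -> L2v Omega (grad psi).
Proof. by move=> /test_is_weak_grad[]. Qed.

(** The approximating sequence is constant. Its gradient error vanishes only almost everywhere,
    because the definition compares it with the chosen weak gradient. *)
Lemma test_H10 psi : test_function Omega psi -> H10 Omega psi.
Proof.
move=> tp; have hg := test_is_weak_grad tp.
have h1 : H1 Omega psi by split; [exact: test_L2|exists (grad psi)].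
split => //; exists (fun=> psi); split=> //.
  rewrite (_ : L2norm _ _ = 0%E); first exact: cvg_cst.
  rewrite L2normE; under eq_integral do rewrite subrr expr0n.
  by rewrite integral0 poweR0r// invr_neq0.
rewrite /L2normv (@ae_L2norm _ (cst 0)).
- rewrite L2normE; under eq_integral do rewrite /= expr0n.
  by rewrite integral0 poweR0r ?invr_neq0//; exact: cvg_cst.
- apply: L2_measurable => //; apply: L2v_enorm; apply: L2vD; first exact: grad_L2v.
  by apply: L2vN; have [] := weak_gradP h1.
- exact: measurable_cst.
- by apply: filterS (ae_weak_grad hg) => x h Ox; rewrite h// subrr enorm0.
Qed.

(** Test functions are admissible in the variational problem, which then reads div(grad u + F) =
    -f. *)
Lemma weak_solution_div (f u : 'rV[R]_n -> R) F : L2 Omega f -> L2v Omega F ->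
  weak_solution Omega f F u ->
  is_weak_div Omega (fun x => weak_grad Omega u x + F x) (fun x => - f x).
Proof.
move=> hf hF [[hu _] sol]; split; first exact: L2N.
have [hg _] := weak_gradP hu.
move=> psi tp; have := sol psi (test_H10 tp).
have wg := ae_weak_grad (test_is_weak_grad tp).
have w2 : L2v Omega (weak_grad Omega psi) by have [] := weak_gradP (test_H10 tp).1.
have mi v : mu.-integrable Omega (EFin \o v) -> measurable_fun Omega v.
  by move=> vi; apply/measurable_EFinP; exact: measurable_int vi.
have fi : mu.-integrable Omega (EFin \o (fun x => f x * psi x)).
  exact: L2_mul_integrable (test_L2 tp).
have Gg := L2v_dot hg (grad_L2v tp); have Fg := L2v_dot hF (grad_L2v tp).
(* Here and in the next rewriting, the chosen weak gradient of psi is replaced by its classical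
   gradient. *)
rewrite (@ae_Rintegral _ (fun x => dot (weak_grad Omega u x) (grad psi x))).
rewrite (@ae_Rintegral (fun x => f x * psi x - _) (fun x => f x * psi x - dot (F x) (grad psi x))).
rewrite RintegralB// => E.
rewrite (_ : \int[mu]_(x in Omega) dot _ _ = \int[mu]_(x in Omega)
  (dot (weak_grad Omega u x) (grad psi x) + dot (F x) (grad psi x))).
  rewrite RintegralD// E subrK; under [in RHS]eq_Rintegral do rewrite mulNr -mulN1r.
  by rewrite RintegralZl// mulN1r opprK.
by apply: eq_Rintegral => x _; rewrite dotDl.
- apply: mi; exact: (integrableB mO fi (L2v_dot hF w2)).
- apply: mi; exact: (integrableB mO fi Fg).
- by apply: filterS wg => x h Ox; rewrite h.
- exact: (mi _ (L2v_dot hg w2)).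
- exact: mi Gg.
- by apply: filterS wg => x h Ox; rewrite h.
Qed.

End weak_derivatives.

(** * Error estimates *)

Section piecewise.
Context {R : realType} {k : nat}.
Variables (Omega : set 'rV[R]_k.+1) (T : mesh R k.+1).
Hypotheses (hT : admissible Omega T) (oO : open Omega).
Local Notation mu := (leb k.+1 : {measure set 'rV[R]_k.+1 -> \bar R}).
Hypothesis Ofin : (mu Omega < +oo)%E.
Let mO : measurable Omega. Proof. exact: open_measurable_rV. Qed.
Implicit Types (K L : cell T) (s t : face T) (x y : 'rV[R]_k.+1) (h : 'rV[R]_k.+1 -> R).
Local Opaque leb.

Let mK K : measurable (cellset K). Proof. exact: (cellset_measurable hT). Qed.
Let KO K : cellset K `<=` Omega. Proof. exact: (@cell_sub _ _ _ _ hT). Qed.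

Lemma mesh_cone_measurable K s : s \in faces K -> measurable (cone K s).
Proof. by move=> sK; exact: (cone_measurable hT sK (cellset_nonempty hT K)). Qed.

Lemma mesh_cone_sub K s : s \in faces K -> cone K s `<=` cellset K.
Proof. by move=> sK; exact: (cone_sub_cell hT (cellset_nonempty hT K) sK). Qed.

Lemma mesh_cone_subO K s : s \in faces K -> cone K s `<=` Omega.
Proof. by move=> sK x /(mesh_cone_sub sK); exact: KO. Qed.

Lemma cell_eq K L x : cellset K x -> cellset L x -> K = L.
Proof.
by move=> Kx Lx; apply: (cell_disjoint hT) => //; exists x.
Qed.

Lemma cone_face_eq K s t x : s \in faces K -> t \in faces K -> cone K s x -> cone K t x -> s = t.
Proof.
move=> sK tK sx tx; apply: contrapT => /eqP st.
have /trivIsetP/(_ s t I I st) st0 := face_disjoint hT.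
have := @cone_over_disjoint _ _ _ _ _ _ (@cell_convex _ _ _ _ hT K) (@cell_open _ _ _ _ hT K)
  (cellset_nonempty hT K) (face_sub_boundary hT sK) (face_sub_boundary hT tK) st0.
move=> E; have : (cone K s `&` cone K t) x by [].
by rewrite [_ `&` _]E.
Qed.

(** Common form of [GT] and [calGT]: piecewise constant functions on the cones of the mesh. *)
Definition cone_fun (f : cell T -> face T -> R) x : R :=
  \sum_K \sum_(s in faces K) f K s * \1_(cone K s) x.

Lemma cone_funE f K s x : s \in faces K -> cone K s x -> cone_fun f x = f K s.
Proof.
move=> sK cx; rewrite /cone_fun (bigD1 K)//= (bigD1 s)//= indicE mem_set// mulr1.
rewrite !big1 ?addr0//.
- move=> L LK; rewrite big1// => t tL; rewrite indicE memNset ?mulr0// => tx.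
  by case/eqP: LK; apply: (cell_eq (mesh_cone_sub tL tx)); exact: mesh_cone_sub cx.
- move=> t /andP[tK ts]; rewrite indicE memNset ?mulr0// => tx.
  by case/eqP: ts; exact: cone_face_eq tK sK tx cx.
Qed.

Lemma cone_fun_out f x : (forall K s, s \in faces K -> ~ cone K s x) -> cone_fun f x = 0.
Proof.
move=> nx; rewrite /cone_fun big1// => K _; rewrite big1// => s sK.
by rewrite indicE memNset ?mulr0//; exact: nx.
Qed.

(** At most one cone contains x; the condition on q covers the points outside all cones, where both
    functions are zero. *)
Lemma cone_fun_map (q : R -> R -> R) f g x : q 0 0 = 0 ->
  q (cone_fun f x) (cone_fun g x) = cone_fun (fun K s => q (f K s) (g K s)) x.
Proof.
move=> q0; have [[K [s [sK cx]]]|nx] := pselect (exists K s, s \in faces K /\ cone K s x).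
  by rewrite !(cone_funE _ sK cx).
have nx' K s : s \in faces K -> ~ cone K s x by move=> sK cx; apply: nx; exists K, s.
by rewrite !(cone_fun_out _ nx').
Qed.

Lemma L2_indic (c : R) C : measurable C -> L2 Omega (fun x => c * \1_C x).
Proof.
move=> mC; apply: L2Z => //; apply: (@L2_bounded _ _ _ mO _ 1) => //.
by move=> x; rewrite ger0_norm// indicE lern1 leq_b1.
Qed.

Lemma L2_cone_fun f : L2 Omega (cone_fun f).
Proof.
apply: L2_sum => // K _; apply: L2_sum => // s sK; apply: L2_indic.
exact: mesh_cone_measurable.
Qed.

Lemma integral_mul_indic h C : measurable C -> C `<=` Omega ->
  \int[mu]_(x in Omega) (h x * \1_C x) = \int[mu]_(x in C) h x.
Proof.
move=> mC CO; rewrite -[in RHS](setIidl CO) setIC Rintegral_mkcondr.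
by apply: eq_Rintegral => x _; rewrite patchE indicE; case: ifPn; rewrite ?mulr1 ?mulr0.
Qed.

Lemma integrable_mul_indic h C : measurable C -> mu.-integrable Omega (EFin \o h) ->
  mu.-integrable Omega (EFin \o (fun x => h x * \1_C x)).
Proof.
move=> mC hi; apply: (le_integrable mO _ _ hi).
  apply/measurable_EFinP; apply: measurable_funM; last exact: measurable_indic.
  by apply/measurable_EFinP; exact: measurable_int hi.
by move=> x _; rewrite !abse_EFin lee_fin normrM indicE; case: (_ \in _); rewrite ?normr1 ?normr0 ?mulr1 ?mulr0.
Qed.

Lemma Rintegral_mul_cone_fun (h : cell T -> face T -> 'rV[R]_k.+1 -> R) f :
  (forall K s, s \in faces K -> mu.-integrable Omega (EFin \o h K s)) ->
  \int[mu]_(x in Omega) (\sum_K \sum_(s in faces K) h K s x * (f K s * \1_(cone K s) x)) =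
  \sum_K \sum_(s in faces K) f K s * \int[mu]_(x in cone K s) h K s x.
Proof.
move=> hi.
have fi K s : s \in faces K ->
    mu.-integrable Omega (EFin \o (fun x => h K s x * (f K s * \1_(cone K s) x))).
  move=> sK; have := integrableZl mO (f K s) (integrable_mul_indic (mesh_cone_measurable sK) (hi K s sK)).
  by congr (_.-integrable _ _); apply/funext => x /=; rewrite -EFinM mulrCA.
rewrite Rintegral_sum//; last by move=> K _; apply: integrable_sumr => // s sK; exact: fi.
apply: eq_bigr => K _; rewrite Rintegral_sum//; last by move=> s sK; exact: fi.
apply: eq_bigr => s sK; under eq_Rintegral do rewrite mulrCA.
rewrite RintegralZl//; last exact: integrable_mul_indic (mesh_cone_measurable sK) (hi K s sK).
by rewrite integral_mul_indic//; [exact: mesh_cone_measurable|exact: mesh_cone_subO].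
Qed.

Lemma Rintegral_cone_fun f :
  \int[mu]_(x in Omega) cone_fun f x = \sum_K \sum_(s in faces K) f K s * volume (cone K s).
Proof.
have i1 : mu.-integrable Omega (EFin \o (cst 1 : 'rV[R]_k.+1 -> R)).
  by apply: L2_integrable => //; apply: (@L2_bounded _ _ _ mO _ 1) => // x; rewrite normr1.
have := @Rintegral_mul_cone_fun (fun _ _ => cst 1) f (fun K s _ => i1).
rewrite (_ : (fun x => _) = cone_fun f); last first.
  by apply/funext => x; apply: eq_bigr => K _; apply: eq_bigr => s _; rewrite mul1r.
move=> ->; apply: eq_bigr => K _; apply: eq_bigr => s sK.
by rewrite Rintegral_cst ?mul1r//; exact: mesh_cone_measurable.
Qed.

Definition cell_fun (f : cell T -> 'rV[R]_k.+1 -> R) x : R :=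
  \sum_K f K x * \1_(cellset K) x.

Lemma cell_funE f K x : cellset K x -> cell_fun f x = f K x.
Proof.
move=> Kx; rewrite /cell_fun (bigD1 K)//= indicE mem_set// mulr1 big1 ?addr0// => L LK.
rewrite indicE memNset ?mulr0// => Lx; case/eqP: LK; exact: cell_eq Lx Kx.
Qed.

Lemma Rintegral_cell_fun f : (forall K, mu.-integrable Omega (EFin \o f K)) ->
  \int[mu]_(x in Omega) cell_fun f x = \sum_K \int[mu]_(x in cellset K) f K x.
Proof.
move=> fi; rewrite Rintegral_sum//; last by move=> K _; exact: integrable_mul_indic.
by apply: eq_bigr => K _; rewrite integral_mul_indic.
Qed.

Lemma integrable_cell_fun f : (forall K, mu.-integrable Omega (EFin \o f K)) ->
  mu.-integrable Omega (EFin \o cell_fun f).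
Proof. by move=> fi; apply: integrable_sumr => // K _; exact: integrable_mul_indic. Qed.

Lemma negligible_face_closure s : mu.-negligible (closure (faceset s)).
Proof.
have [QQ _] := face_paramP hT s; have [n nn] := unit_normal_exists (face_param (faceset s)).
exists [set x | dot n x = dot n (face_param (faceset s)).1]; split.
- exact: measurable_hyperplane.
- apply: leb_hyperplane; apply/eqP => n0; have [] := nn.
  by rewrite n0 dot0l => /eqP; rewrite eq_sym oner_eq0.
- by move=> x /(closure_face_range hT) /(range_paramP _ QQ nn).
Qed.

(** The closure of a finite union is the union of the closures, so a point of Omega in no cell is on
    the boundary of one, hence on one of finitely many hyperplanes. *)
Lemma ae_mem_cell : {ae mu, forall x, Omega x -> exists K, cellset K x}.
Proof.
have := negligible_bigcup_fin (fun s : face T => negligible_face_closure s).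
apply: negligibleS => x /= /not_implyP[Ox nK].
have clU : closed (\bigcup_(K in [set: cell T]) closure (cellset K)).
  apply: closed_bigcup => //; first exact: finite_finset.
  by move=> K _; exact: closed_closure.
have : closure (\bigcup_(K in [set: cell T]) cellset K) x.
  by rewrite (mesh_closure hT); exact: subset_closure.
move=> /(closure_sub_closed clU) [|K _ cKx].
  by move=> y [K _ Ky]; exists K => //; exact: subset_closure.
have : (closure (cellset K) `\` cellset K) x by split=> // Kx; apply: nK; exists K.
by rewrite (cell_boundary hT) => -[s _ sx]; exists s.
Qed.

End piecewise.

(** * Consequences of the regularity parameter *)

Section mesh_regularity.
Context {R : realType} {k : nat}.
Variables (Omega : set 'rV[R]_k.+1) (T : mesh R k.+1).
Hypotheses (hT : admissible Omega T).
Implicit Types (K L : cell T) (s t : face T) (x y e : 'rV[R]_k.+1).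
Local Opaque leb.

Lemma enorm_le_diam n (A : set 'rV[R]_n) (x y : 'rV[R]_n) : bounded_set A -> A x -> A y ->
  enorm (x - y) <= diam A.
Proof.
move=> [M [_ /(_ (M + 1))]]; rewrite ltrDl ltr01 => /(_ isT) HM Ax Ay.
apply: ub_le_sup; last by exists x => //; exists y.
exists (Num.sqrt n%:R * ((M + 1) + (M + 1))) => _ [z Az [w Aw <-]].
apply: le_trans (enorm_le_norm _) _; rewrite ler_wpM2l ?sqrtr_ge0//.
by rewrite (le_trans (ler_normB _ _))// lerD//; exact: HM.
Qed.

Lemma dot_closure_le_diam K x e : closure (cellset K) x ->
  dot e (x - cellpt K) <= enorm e * diam (cellset K).
Proof.
have Kp := cellset_nonempty hT K.
pose B := dot e @^-1` [set t | t <= dot e (cellpt K) + enorm e * diam (cellset K)].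
have cB : closed B by apply: preimage_closed; [move=> y _; exact: continuous_dot|exact: closed_le].
have KB : cellset K `<=` B.
  move=> y Ky; rewrite /B /= -lerBlDl -dotBr (le_trans (dot_le_enorm _ _))//.
  by rewrite ler_wpM2l ?enorm_ge0// enorm_le_diam//; exact: (cellset_bounded hT).
by move=> /(closure_sub_closed cB KB); rewrite /B /= dotBr lerBlDl.
Qed.

(** With b = xbar_s - x_K, the number b . b is the mean over y in the face of b . (y - x_K), which
    is at most |b| diam K; dividing by |b| concludes. *)
Lemma barycenter_le_diam K s : s \in faces K ->
  enorm (barycenter (faceset s) - cellpt K) <= diam (cellset K).
Proof.
move=> sK; set b := barycenter _ - _.
have [->|b0] := eqVneq b 0.
  have Kp := cellset_nonempty hT K.
  by rewrite enorm0 -(enorm0 (n := k.+1)) -(subrr (cellpt K)) enorm_le_diam//; exact: (cellset_bounded hT).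
rewrite -(@ler_pM2l _ (enorm b)) ?enorm_gt0// -expr2 enorm_sqr -subr_ge0.
rewrite -(pmulr_rge0 _ (area_gt0 hT s)).
set c := dot b (cellpt K) + enorm b * diam (cellset K).
have -> : enorm b * diam (cellset K) - dot b b = dot (- b) (barycenter (faceset s)) + c.
  by rewrite {3}/b dotBr dotNl /c; ring.
rewrite -lee_fin -(face_integral_affine hT); apply: integral_ge0 => y sy.
rewrite lee_fin dotNl /c addrA [- _ + _]addrC -opprB -dotBr addrC subr_ge0.
apply: dot_closure_le_diam; have [+ _] := face_sub_boundary hT sK sy; exact.
Qed.

Lemma diam_gt0 K : 0 < diam (cellset K).
Proof.
have Kp := cellset_nonempty hT K.
have [e e0 He] := open_ball_sub (@cell_open _ _ _ _ hT K) Kp.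
pose v : 'rV[R]_k.+1 := (e / 2) *: delta_mx ord0 ord0.
have v0 : v != 0.
  rewrite scaler_eq0 negb_or mulf_neq0 ?gt_eqF//=.
  by apply/eqP => /rowP /(_ ord0); rewrite !mxE !eqxx => /eqP; rewrite oner_eq0.
have Kv : cellset K (cellpt K + v).
  apply: He; rewrite addrAC subrr add0r; apply/(norm_lt_coord _ e0) => i.
  rewrite !mxE eqxx /=; case: (i == ord0); rewrite ?mulr1 ?mulr0 ?normr0//.
  by rewrite gtr0_norm ?divr_gt0// ltr_pdivrMr// mulr_natr mulr2n ltrDl.
apply: (@lt_le_trans _ _ (enorm v)); first by rewrite enorm_gt0.
have := enorm_le_diam (cellset_bounded hT K) Kv Kp.
by rewrite addrAC subrr add0r.
Qed.

Hypothesis hne : Omega !=set0.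

Lemma cell_exists : exists K : cell T, True.
Proof.
apply: contrapT => nK; have [x Ox] := hne.
have : closure (\bigcup_(K in [set: cell T]) cellset K) x.
  by rewrite (mesh_closure hT); exact: subset_closure.
rewrite (_ : \bigcup_(K in _) _ = set0) ?closure0//.
by rewrite -subset0 => y [K]; exfalso; apply: nK; exists K.
Qed.

Let ratio_gt0 K s : s \in faces K -> 0 < dKs K s / diam (cellset K).
Proof. by move=> sK; rewrite divr_gt0 ?diam_gt0//; exact: (dKs_gt0 hT). Qed.

(** The infimum is over a finite family of positive ratios. The family is nonempty because Omega is,
    and an infimum of the empty set would be 0. *)
Lemma theta_gt0 : 0 < theta T.
Proof.
(* The default value 1 can only lower the minimum, and a positive lower bound is enough. *)
pose m := \big[Order.min/1]_(p : cell T * face T | p.2 \in faces p.1) (dKs p.1 p.2 / diam (cellset p.1)).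
have m0 : 0 < m.
  apply: lt_bigmin => // -[K s] /= sK; exact: ratio_gt0.
apply: (lt_le_trans m0); apply: lb_le_inf.
  have [K _] := cell_exists; have [s sK] := faces_nonempty hT K.
  by exists (dKs K s / diam (cellset K)); exists K, s.
by move=> _ [K [s [sK ->]]]; have := @bigmin_le_cond _ _ _ 1 (K, s) (fun p : cell T * face T => p.2 \in faces p.1) (fun p => dKs p.1 p.2 / diam (cellset p.1)) sK.
Qed.

Lemma theta_le K s : s \in faces K -> theta T * diam (cellset K) <= dKs K s.
Proof.
move=> sK; rewrite -ler_pdivlMr ?diam_gt0//; apply: ge_inf; last by exists K, s.
by exists 0 => _ [L [t [tL ->]]]; rewrite ltW// ratio_gt0.
Qed.

Lemma area_dKs K s : s \in faces K -> area (faceset s) * dKs K s = k.+1%:R * volume (cone K s).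
Proof.
move=> sK; rewrite /volume [leb _ _](leb_cone hT sK (cellset_nonempty hT K)) /= (dKsE hT sK).
by rewrite [RHS]mulrC divfK// pnatr_eq0.
Qed.

Lemma area_barycenter_le K s : s \in faces K ->
  area (faceset s) * enorm (barycenter (faceset s) - cellpt K) <=
  k.+1%:R / theta T * volume (cone K s).
Proof.
move=> sK; rewrite mulrAC ler_pdivlMr ?theta_gt0// -(area_dKs sK) -mulrA.
rewrite ler_wpM2l ?(ltW (area_gt0 hT s))// (le_trans _ (theta_le sK))// mulrC.
by rewrite ler_wpM2l ?(ltW theta_gt0)// barycenter_le_diam.
Qed.

End mesh_regularity.

Section L2norm_order.
Context {R : realType} {n : nat}.
Local Notation mu := (leb n : {measure set 'rV[R]_n -> \bar R}).
Variable Omega : set 'rV[R]_n.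
Hypothesis mO : measurable Omega.
Implicit Types (u v : 'rV[R]_n -> R).

Lemma le_L2norm_ae u v : measurable_fun Omega u -> measurable_fun Omega v ->
  {ae mu, forall x, Omega x -> `|u x| <= `|v x|} -> (L2norm Omega u <= L2norm Omega v)%E.
Proof.
move=> um vm uv; rewrite !L2normE.
have I0 w : (0 <= \int[mu]_(x in Omega) ((w x) ^+ 2)%:E)%E.
  by apply: integral_ge0 => x _; rewrite lee_fin sqr_ge0.
have i0 (z : \bar R) : (0 <= z)%E -> z \in `[0%E, +oo%E] by rewrite in_itv /= leey andbT.
apply: gt0_ler_poweR; rewrite ?i0 ?I0 ?invr_ge0//.
apply: ae_ge0_le_integral => //.
- by move=> x _; rewrite lee_fin sqr_ge0.
- by apply/measurable_EFinP; exact: measurable_funX.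
- by move=> x _; rewrite lee_fin sqr_ge0.
- by apply/measurable_EFinP; exact: measurable_funX.
apply: filterS uv => x uv Ox; rewrite lee_fin -(real_normK (num_real (u x))) -(real_normK (num_real (v x))).
by rewrite ler_pXn2r ?nnegrE// uv.
Qed.

Lemma L2normZ (c : R) u : measurable_fun Omega u -> 0 <= c ->
  (L2norm Omega (fun x => (c * u x)%R) = c%:E * L2norm Omega u)%E.
Proof.
move=> um c0; rewrite !L2normE.
under eq_integral do rewrite exprMn EFinM.
rewrite ge0_integralZl_EFin ?sqr_ge0//; last 2 first.
- by move=> x _; rewrite lee_fin sqr_ge0.
- by apply/measurable_EFinP; exact: measurable_funX.
rewrite poweRM ?lee_fin ?sqr_ge0//; last by apply: integral_ge0 => x _; rewrite lee_fin sqr_ge0.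
by rewrite poweR_EFin -[c ^+ 2]powR_mulrn// -powRrM mulfV// powRr1.
Qed.

End L2norm_order.

(** * Error of the consistent discrete gradient *)

Section discrete_gradient_error.
Context {R : realType} {k : nat}.
Variables (Omega : set 'rV[R]_k.+1) (T : mesh R k.+1).
Hypotheses (hT : admissible Omega T) (oO : open Omega) (hne : Omega !=set0).
Local Notation mu := (leb k.+1 : {measure set 'rV[R]_k.+1 -> \bar R}).
Hypothesis Ofin : (mu Omega < +oo)%E.
Let mO : measurable Omega. Proof. exact: open_measurable_rV. Qed.
Implicit Types (K L : cell T) (s t : face T) (x y v : 'rV[R]_k.+1).
Local Opaque leb.
Variables (phi : 'rV[R]_k.+1 -> 'rV[R]_k.+1) (u : discrete T).
Hypothesis hphi : L2v Omega phi.

Let mK K : measurable (cellset K). Proof. exact: (cellset_measurable hT). Qed.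
Let KO K : cellset K `<=` Omega. Proof. exact: (@cell_sub _ _ _ _ hT). Qed.

Let L2cst (c : R) : L2 Omega (fun=> c).
Proof. by apply: (@L2_bounded _ _ _ mO _ `|c|). Qed.

Let L2vcst v : L2v Omega (fun=> v). Proof. by move=> i; exact: L2cst. Qed.

Let L2v_sub v : L2v Omega (fun y => phi y - v).
Proof. by apply: L2vD => //; apply: L2vN => //; exact: L2vcst. Qed.

Let OK K f : mu.-integrable Omega f -> mu.-integrable (cellset K) f.
Proof. by apply: integrableS => //; exact: KO. Qed.

Let dist x y : R := enorm (phi y - phi x).

Let dist_L2 x : L2 Omega (dist x).
Proof. by apply: L2v_enorm => //; exact: L2v_sub. Qed.

Definition mean_sqr_dist K x : R :=
  \int[mu]_(y in cellset K) ((volume (cellset K))^-1 * enorm (phi y - phi x) ^+ 2).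

Let msd_integrable x : mu.-integrable Omega (EFin \o (fun y => enorm (phi y - phi x) ^+ 2)).
Proof. exact: (L2_sqr_integrable mO (dist_L2 x)). Qed.

Lemma mean_sqr_dist_ge0 K x : 0 <= mean_sqr_dist K x.
Proof.
apply: Rintegral_ge0 => y _; rewrite mulr_ge0 ?sqr_ge0// invr_ge0 ltW//; exact: (volume_gt0 hT).
Qed.

Let dot_integrable v : mu.-integrable Omega (EFin \o (fun y => dot (phi y) v)).
Proof. by apply: (@L2v_dot _ _ _ oO phi (fun=> v)) => //; exact: L2vcst. Qed.

(** Expanding the square exhibits a polynomial of degree two in [phi x], so that measurability and
    integrability in x follow without any joint measurability in (x, y). *)
Lemma mean_sqr_distE K x : mean_sqr_dist K x =
  (volume (cellset K))^-1 * (\int[mu]_(y in cellset K) dot (phi y) (phi y))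
  - 2 * (volume (cellset K))^-1 *
    dot (\row_i \int[mu]_(y in cellset K) phi y ord0 i) (phi x)
  + dot (phi x) (phi x).
Proof.
have V0 := volume_gt0 hT K.
have pi i : mu.-integrable (cellset K) (EFin \o (fun y => phi y ord0 i)).
  by apply: OK; apply: L2_integrable.
have ip : mu.-integrable (cellset K) (EFin \o (fun y => dot (phi y) (phi y))).
  by apply: OK; exact: L2v_dot.
have iv : mu.-integrable (cellset K) (EFin \o (fun y => dot (phi y) (phi x))).
  by apply: OK; exact: dot_integrable.
have ic c : mu.-integrable (cellset K) (EFin \o (fun=> c : R)).
  by apply: OK; apply: L2_integrable.
rewrite /mean_sqr_dist RintegralZl//; last by apply: OK; exact: msd_integrable.
have -> : \int[mu]_(y in cellset K) (enorm (phi y - phi x) ^+ 2) =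
    \int[mu]_(y in cellset K) (dot (phi y) (phi y) - 2 * dot (phi y) (phi x) + dot (phi x) (phi x)).
  apply: eq_Rintegral => y _; rewrite enorm_sqr dotBl !dotBr (dotC (phi x) (phi y)); ring.
have i2 : mu.-integrable (cellset K) (EFin \o (fun y => 2 * dot (phi y) (phi x))).
  exact: (integrableZl (mK K) 2 iv).
have iB := integrableB (mK K) ip i2.
rewrite (RintegralD (mK K) iB (ic _)) (RintegralB (mK K) ip i2) (RintegralZl _ (mK K) iv).
rewrite Rintegral_cst// -/(volume (cellset K)).
have -> : \int[mu]_(y in cellset K) dot (phi y) (phi x) =
    dot (\row_i \int[mu]_(y in cellset K) phi y ord0 i) (phi x).
  rewrite /dot Rintegral_sum//; last first.
    move=> i _; have := integrableZl (mK K) (phi x ord0 i) (pi i).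
    by congr (_.-integrable _ _); apply/funext => y /=; rewrite -EFinM mulrC.
  by apply: eq_bigr => i _; rewrite mxE RintegralZr.
rewrite !mulrDr mulrN [_^-1 * (dot _ _ * _)]mulrCA mulVf ?mulr1 ?gt_eqF//.
by congr (_ - _ + _); ring.
Qed.

Lemma mean_sqr_dist_integrable K : mu.-integrable Omega (EFin \o mean_sqr_dist K).
Proof.
rewrite (_ : mean_sqr_dist K = fun x => (volume (cellset K))^-1 * (\int[mu]_(y in cellset K) dot (phi y) (phi y))
  - 2 * (volume (cellset K))^-1 *
    dot (\row_i \int[mu]_(y in cellset K) phi y ord0 i) (phi x)
  + dot (phi x) (phi x)); last by apply/funext => x; exact: mean_sqr_distE.
set c1 := _ * _; set c2 := 2 * _; set w := \row_i _.
have i1 : mu.-integrable Omega (EFin \o (fun=> c1)) by exact: L2_integrable.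
have i2 : mu.-integrable Omega (EFin \o (fun x => c2 * dot w (phi x))).
  have := integrableZl mO c2 (dot_integrable w).
  by congr (_.-integrable _ _); apply/funext => y /=; rewrite -EFinM dotC.
exact: (integrableD mO (integrableB mO i1 i2) (L2v_dot oO hphi hphi)).
Qed.

Let B x : R := cell_fun (fun K x => Num.sqrt (mean_sqr_dist K x)) x.

Let sqrt_msd_L2 K : L2 Omega (fun x => Num.sqrt (mean_sqr_dist K x)).
Proof.
apply: integrable_sqr_L2 => //.
  apply: measurableT_comp; first exact: (continuous_measurable_fun (@sqrt_continuous R)).
  by apply/measurable_EFinP; exact: measurable_int (mean_sqr_dist_integrable K).
have := mean_sqr_dist_integrable K; congr (_.-integrable _ _).
by apply/funext => x /=; rewrite sqr_sqrtr// mean_sqr_dist_ge0.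
Qed.

Lemma cell_fun_map (q : R -> R) (f : cell T -> 'rV[R]_k.+1 -> R) x : q 0 = 0 ->
  q (cell_fun f x) = cell_fun (fun K x => q (f K x)) x.
Proof.
move=> q0; have [[K Kx]|nx] := pselect (exists K, cellset K x).
  by rewrite !(cell_funE hT _ Kx).
rewrite /cell_fun !big1// => K _; rewrite indicE memNset ?mulr0// => Kx; apply: nx; by exists K.
Qed.

Lemma L2_cell_fun f : (forall K, L2 Omega (f K)) -> L2 Omega (@cell_fun _ _ T f).
Proof.
move=> hf; apply: L2_sum => // K _; apply: integrable_sqr_L2 => //.
  by apply: measurable_funM; [exact: L2_measurable|exact: measurable_indic].
have := integrable_mul_indic oO (mK K) (L2_sqr_integrable mO (hf K)).
congr (_.-integrable _ _).
by apply/funext => x /=; rewrite exprMn indicE; case: (_ \in _); rewrite ?expr1n ?expr0n.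
Qed.

Let msd_EFin K y : (mean_sqr_dist K y)%:E =
  (\int[mu]_(x in cellset K) ((volume (cellset K))^-1 * enorm (phi y - phi x) ^+ 2)%:E)%E.
Proof.
have i1 := integrableZl mO (volume (cellset K))^-1 (msd_integrable y).
have := integral_EFin_Rintegral (mK K) (@OK K _ i1).
rewrite -/(mean_sqr_dist K y) => <-; apply: eq_integral => x _.
by rewrite -(enormN (phi x - _)) opprB.
Qed.

Lemma L2norm_mean_dist : L2norm Omega B = Theta T phi.
Proof.
rewrite L2normE /Theta; congr (_ `^ _)%E.
under eq_integral do rewrite /B (cell_fun_map (q := fun r => r ^+ 2)) ?expr0n//.
have E : cell_fun (fun K x => Num.sqrt (mean_sqr_dist K x) ^+ 2) = cell_fun mean_sqr_dist.
  by apply/funext => x; apply: eq_bigr => K _; rewrite sqr_sqrtr// mean_sqr_dist_ge0.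
rewrite E integral_EFin_Rintegral//; last first.
  exact: (integrable_cell_fun hT oO mean_sqr_dist_integrable).
rewrite (Rintegral_cell_fun hT oO mean_sqr_dist_integrable) -sumEFin.
apply: eq_bigr => K _; rewrite -integral_EFin_Rintegral//; last first.
  by apply: OK; exact: mean_sqr_dist_integrable.
by apply: eq_integral => y _; rewrite msd_EFin.
Qed.

Definition cone_mean K s : R :=
  (volume (cone K s))^-1 * \int[mu]_(y in cone K s) dot (phi y) (normal K s).

Let c K s : R := slope u K s - cone_mean K s.

(** The mean over K of the absolute difference between [GT u] and the cone means of [phi]. *)
Let a K : R := (volume (cellset K))^-1 * \sum_(s in faces K) volume (cone K s) * `|c K s|.

Let vc_ge0 K s : 0 <= volume (cone K s). Proof. by rewrite fine_ge0. Qed.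

Lemma volume_cone_gt0 K s : s \in faces K -> 0 < volume (cone K s).
Proof.
move=> sK; rewrite -(@pmulr_rgt0 _ k.+1%:R) ?ltr0n// -(area_dKs hT sK).
by rewrite mulr_gt0 ?(area_gt0 hT)// (dKs_gt0 hT).
Qed.

Let a_ge0 K : 0 <= a K.
Proof.
rewrite /a mulr_ge0 ?invr_ge0 ?fine_ge0//.
by apply: sumr_ge0 => s _; rewrite mulr_ge0.
Qed.

(** The difference of the two sides is the variance Sum_s |D_s| (|c_s| - a)^2, where the |D_s| add
    up to |K|. *)
Let a_sqr K : a K ^+ 2 * volume (cellset K) <= \sum_(s in faces K) c K s ^+ 2 * volume (cone K s).
Proof.
have V0 := volume_gt0 hT K.
have aV : \sum_(s in faces K) volume (cone K s) * `|c K s| = a K * volume (cellset K).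
  by rewrite /a mulrAC mulVf ?mul1r// gt_eqF.
have : 0 <= \sum_(s in faces K) volume (cone K s) * (`|c K s| - a K) ^+ 2.
  by apply: sumr_ge0 => s _; rewrite mulr_ge0 ?sqr_ge0.
rewrite (_ : \sum_(s in _) _ = \sum_(s in faces K) c K s ^+ 2 * volume (cone K s)
   - 2 * a K * (\sum_(s in faces K) volume (cone K s) * `|c K s|) +
   a K ^+ 2 * \sum_(s in faces K) volume (cone K s)).
  by rewrite aV (sum_volume_cone hT); nra.
rewrite !mulr_sumr -sumrB -big_split /=; apply: eq_bigr => s _.
rewrite -[c K s ^+ 2](real_normK (num_real _)); ring.
Qed.

Let A x : R := cell_fun (fun K _ => a K) x.

Let GTE x : GT u x - cone_fun cone_mean x = cone_fun c x.
Proof. by apply: (@cone_fun_map _ _ _ _ hT (fun p q => p - q)); rewrite subr0. Qed.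

Lemma L2norm_cell_mean : (L2norm Omega A <= L2norm Omega (fun x => (GT u x - cone_fun cone_mean x)%R))%E.
Proof.
apply: le_L2norm; first exact: L2norm_ge0.
rewrite L2normK.
under eq_integral do rewrite /A (cell_fun_map (q := fun r => r ^+ 2)) ?expr0n//.
have E : (fun x => (GT u x - cone_fun cone_mean x) ^+ 2) = cone_fun (fun K s => c K s ^+ 2).
  apply/funext => x; rewrite GTE.
  by apply: (@cone_fun_map _ _ _ _ hT (fun p q => p ^+ 2) c c); rewrite expr0n.
under [leRHS]eq_integral => x _ do rewrite [(_ - _) ^+ 2](congr1 (@^~ x) E).
have i1 K : mu.-integrable Omega (EFin \o (fun=> a K ^+ 2)) by exact: L2_integrable.
rewrite integral_EFin_Rintegral//; last exact: (integrable_cell_fun hT oO i1).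
rewrite integral_EFin_Rintegral//; last by apply: L2_integrable => //; exact: (L2_cone_fun hT oO Ofin).
rewrite lee_fin (Rintegral_cell_fun hT oO i1) (Rintegral_cone_fun hT oO Ofin).
by apply: ler_sum => K _; rewrite Rintegral_cst//; exact: a_sqr.
Qed.

Let cone_mean_dist K s x : s \in faces K ->
  volume (cone K s) * `|cone_mean K s - dot (normal K s) (phi x)| <= \int[mu]_(y in cone K s) dist x y.
Proof.
move=> sK; have V0 := volume_cone_gt0 sK; have mC := mesh_cone_measurable hT sK.
have CK : cone K s `<=` Omega by exact: (mesh_cone_subO hT sK).
have i1 : mu.-integrable (cone K s) (EFin \o (fun y => dot (phi y) (normal K s))).
  by apply: integrableS CK _ => //; exact: dot_integrable.
have i0 : mu.-integrable (cone K s) (EFin \o (fun=> dot (phi x) (normal K s))).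
  by apply: integrableS CK _ => //; exact: L2_integrable.
have id : mu.-integrable (cone K s) (EFin \o dist x).
  by apply: integrableS CK _ => //; apply: L2_integrable.
have -> : volume (cone K s) * `|cone_mean K s - dot (normal K s) (phi x)| =
    `|\int[mu]_(y in cone K s) (dot (phi y) (normal K s) - dot (phi x) (normal K s))|.
  rewrite RintegralB// Rintegral_cst// -[fine _]/(volume (cone K s)).
  rewrite -{1}(gtr0_norm V0) -normrM /cone_mean mulrBr mulrA mulfV ?gt_eqF// mul1r.
  by rewrite [dot (normal _ _) _]dotC [dot (phi x) _ * _]mulrC.
have iB := integrableB mC i1 i0.
apply: (le_trans (le_normr_Rintegral mC iB)); apply: le_Rintegral => //.
- exact: (integrable_norm iB).
- move=> y _; rewrite -dotBl (le_trans (cauchy_schwarz _ _))//.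
  by have [n1 _ _] := normalP hT sK; rewrite n1 mulr1.
Qed.

Let dist_integrable K x : mu.-integrable (cellset K) (EFin \o dist x).
Proof. by apply: OK; exact: L2_integrable. Qed.

Let sum_cone_dist K x :
  \sum_(s in faces K) \int[mu]_(y in cone K s) dist x y = \int[mu]_(y in cellset K) dist x y.
Proof.
have := @ge0_integral_cell _ _ _ _ hT K (cellpt K) (EFin \o dist x) (cellset_nonempty hT K)
  (measurable_int _ (dist_integrable K x)).
move=> /(_ (fun y _ => enorm_ge0 _)) E; apply: EFin_inj.
rewrite -integral_EFin_Rintegral// E -sumEFin; apply: eq_bigr => s sK.
rewrite -integral_EFin_Rintegral//; first exact: (mesh_cone_measurable hT sK).
by apply: integrableS (dist_integrable K x) => //; [exact: (mesh_cone_measurable hT sK)|exact: (mesh_cone_sub hT sK)].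
Qed.

(** Again a variance: the integral over K of (dist - I/V)^2 is nonnegative, where I/V is the mean
    distance. *)
Let mean_dist_le K x : \int[mu]_(y in cellset K) dist x y <=
  volume (cellset K) * Num.sqrt (mean_sqr_dist K x).
Proof.
have V0 := volume_gt0 hT K; set V := volume _ in V0 *.
have id := dist_integrable K x; set I := \int[mu]_(y in _) _.
have i2 : mu.-integrable (cellset K) (EFin \o (fun y => dist x y ^+ 2)) by apply: OK; exact: msd_integrable.
have E : \int[mu]_(y in cellset K) (dist x y ^+ 2) = V * mean_sqr_dist K x.
  by rewrite /mean_sqr_dist RintegralZl// mulrA mulfV ?mul1r// gt_eqF.
have i1 : mu.-integrable (cellset K) (EFin \o (fun y => 2 * (I / V) * dist x y)).
  exact: (integrableZl (mK K) (2 * (I / V)) id).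
have ic : mu.-integrable (cellset K) (EFin \o (fun=> (I / V) ^+ 2)).
  by apply: OK; exact: L2_integrable.
have : 0 <= \int[mu]_(y in cellset K) ((dist x y - I / V) ^+ 2).
  by apply: Rintegral_ge0 => y _; exact: sqr_ge0.
have -> : \int[mu]_(y in cellset K) ((dist x y - I / V) ^+ 2) =
    \int[mu]_(y in cellset K) (dist x y ^+ 2 - 2 * (I / V) * dist x y + (I / V) ^+ 2).
  by apply: eq_Rintegral => y _; ring.
rewrite (RintegralD (mK K) (integrableB (mK K) i2 i1) ic) (RintegralB (mK K) i2 i1).
rewrite (RintegralZl _ (mK K) id) -/I Rintegral_cst// -[fine _]/V E => H.
have I0 : 0 <= I by apply: Rintegral_ge0 => y _; exact: enorm_ge0.
rewrite mulrC -ler_pdivrMr// -(@ler_pXn2r _ 2)// ?nnegrE ?sqrtr_ge0 ?divr_ge0 ?(ltW V0)//.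
rewrite sqr_sqrtr ?mean_sqr_dist_ge0// -(ler_pM2l V0).
have J : I = (I / V) * V by rewrite divfK// gt_eqF.
by move: H; rewrite {2}J; set q := I / V; nra.
Qed.

Let nablahat_cell K x : cellset K x -> nablahatT u x =
  (volume (cellset K))^-1 *: \sum_(s in faces K)
       (area (faceset s) * slope u K s) *: (barycenter (faceset s) - cellpt K).
Proof.
move=> Kx; rewrite /nablahatT (bigD1 K)//= indicE mem_set// scale1r [X in _ + X]big1 ?addr0// => L LK.
rewrite indicE memNset ?scale0r// => Lx; case/eqP: LK; exact: (cell_eq hT Lx Kx).
Qed.

(** Pairing the error D with itself makes the affine identity a scalar one, with e = D and w = phi
    x. The result bounds |K| |D|^2 by |D| times the desired quantity. *)
Lemma discrete_gradient_pointwise K x : cellset K x ->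
  enorm (nablahatT u x - phi x) <= k.+1%:R / theta T * (a K + Num.sqrt (mean_sqr_dist K x)).
Proof.
move=> Kx; set D := _ - _; set C := _ / _.
have C0 : 0 <= C by rewrite divr_ge0// ltW// (theta_gt0 hT hne).
have [->|D0] := eqVneq D 0.
  by rewrite enorm0 mulr_ge0// addr_ge0// sqrtr_ge0.
have V0 := volume_gt0 hT K.
set q := fun s => slope u K s - dot (normal K s) (phi x).
have H1 : volume (cellset K) * dot D D =
    \sum_(s in faces K) area (faceset s) * q s * dot D (barycenter (faceset s) - cellpt K).
  rewrite {2}/D dotBr mulrBr (nablahat_cell Kx) dotZr mulrA mulfV ?gt_eqF// mul1r.
  rewrite -(sum_area_normal_barycenter hT) dotC dot_suml -sumrB; apply: eq_bigr => s _.
  by rewrite dotZl [dot (_ - _) D]dotC /q; ring.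
have H2 : volume (cellset K) * dot D D <= enorm D * (C * \sum_(s in faces K) volume (cone K s) * `|q s|).
  rewrite H1 mulr_sumr mulr_sumr; apply: ler_sum => s sK.
  set b := barycenter _ - _.
  apply: (@le_trans _ _ (area (faceset s) * `|q s| * (enorm D * enorm b))).
    rewrite -!mulrA ler_wpM2l ?(ltW (area_gt0 hT s))// (le_trans (ler_norm _))// normrM.
    by rewrite ler_wpM2l// cauchy_schwarz.
  have := area_barycenter_le hT hne sK; rewrite -/b -/C => Hb.
  rewrite (_ : _ * _ * _ = enorm D * `|q s| * (area (faceset s) * enorm b)); last by ring.
  rewrite [leRHS](_ : _ = enorm D * `|q s| * (C * volume (cone K s))); last by ring.
  by rewrite ler_wpM2l// mulr_ge0 ?enorm_ge0.
have H3 : \sum_(s in faces K) volume (cone K s) * `|q s| <=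
    volume (cellset K) * (a K + Num.sqrt (mean_sqr_dist K x)).
  have aV : volume (cellset K) * a K = \sum_(s in faces K) volume (cone K s) * `|c K s|.
    by rewrite /a mulrA mulfV ?mul1r// gt_eqF.
  rewrite mulrDr aV (le_trans _ (lerD (lexx _) (mean_dist_le K x)))//.
  rewrite -sum_cone_dist -big_split /=; apply: ler_sum => s sK.
  rewrite (le_trans _ (lerD (lexx _) (cone_mean_dist x sK)))// -mulrDr.
  by rewrite ler_wpM2l// (le_trans _ (ler_normD _ _))// /c /q addrA subrK.
rewrite -(ler_pM2l V0) -(ler_pM2l (_ : 0 < enorm D)) ?enorm_gt0//.
rewrite mulrCA -expr2 enorm_sqr (le_trans H2)// ler_wpM2l ?enorm_ge0//.
by rewrite mulrCA ler_wpM2l.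
Qed.

Lemma L2v_nablahat : L2v Omega (nablahatT u).
Proof.
move=> i; rewrite (_ : (fun _ => _) = cell_fun (fun K _ => ((volume (cellset K))^-1 *:
     \sum_(s in faces K) (area (faceset s) * slope u K s) *:
         (barycenter (faceset s) - cellpt K)) ord0 i)).
  by apply: L2_cell_fun => K; exact: L2cst.
by apply/funext => x; rewrite /nablahatT summxE; apply: eq_bigr => K _; rewrite mxE mulrC.
Qed.

Theorem discrete_gradient_error :
  (L2normv Omega (fun x => (nablahatT u x - phi x)%R) <=
   (k.+1%:R / theta T)%:E *
   (L2norm Omega (fun x => (GT u x - cone_fun cone_mean x)%R) + Theta T phi))%E.
Proof.
have A2 : L2 Omega A by apply: L2_cell_fun => K; exact: L2cst.
have B2 : L2 Omega B by apply: L2_cell_fun.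
have C0 : 0 <= k.+1%:R / theta T by rewrite divr_ge0// ltW// (theta_gt0 hT hne).
have mAB : measurable_fun Omega (fun x => A x + B x).
  by apply: L2_measurable => //; exact: L2D.
apply: (@le_trans _ _ (L2norm Omega (fun x => (k.+1%:R / theta T * (A x + B x))%R))).
  apply: le_L2norm_ae => //.
  - apply: L2_measurable => //; apply: L2v_enorm => //; apply: L2vD => //; first exact: L2v_nablahat.
    exact: L2vN.
  - exact: measurable_funM.
  apply: filterS (ae_mem_cell hT) => x h /h[K Kx].
  rewrite ger0_norm ?enorm_ge0// (le_trans (discrete_gradient_pointwise Kx))//.
  by rewrite /A /B !(cell_funE hT _ Kx) ler_norm.
rewrite L2normZ//; apply: lee_wpmul2l; first by rewrite lee_fin.
apply: (le_trans (L2normD mO (L2_measurable mO A2) (L2_measurable mO B2))).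
by rewrite L2norm_mean_dist; apply: leeD => //; exact: L2norm_cell_mean.
Qed.

End discrete_gradient_error.

(** * Error of the scheme *)

Section scheme_error.
Context {R : realType} {k : nat}.
Variables (Omega : set 'rV[R]_k.+1) (T : mesh R k.+1).
Hypotheses (hT : admissible Omega T) (oO : open Omega) (hne : Omega !=set0).
Hypothesis bO : bounded_set Omega.
Local Notation mu := (leb k.+1 : {measure set 'rV[R]_k.+1 -> \bar R}).
Let mO : measurable Omega. Proof. exact: open_measurable_rV. Qed.
Let Ofin : (mu Omega < +oo)%E. Proof. exact: (bounded_leb_lty bO mO). Qed.
Implicit Types (K L : cell T) (s t : face T) (x y : 'rV[R]_k.+1) (v w : discrete T).
Local Opaque leb.
Variables (f : 'rV[R]_k.+1 -> R) (F : 'rV[R]_k.+1 -> 'rV[R]_k.+1)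
  (ubar : 'rV[R]_k.+1 -> R) (u : discrete T).
Hypotheses (hf : L2 Omega f) (hF : L2v Omega F)
  (hubar : weak_solution Omega f F ubar) (hu : scheme_solution Omega f F u).

Let phi := weak_grad Omega ubar.
Let Phi x := weak_grad Omega ubar x + F x.
Let G0 := calGT Omega T ubar.
Let d : R := k.+1%:R.

Let hphi : L2v Omega phi.
Proof. by have [+ _] := hubar => -[+ _] => /weak_gradP[]. Qed.

Let hdiv : is_weak_div Omega Phi (fun x => - f x).
Proof. exact: (weak_solution_div oO Ofin hf hF hubar). Qed.

Let L2wd : L2 Omega (weak_div Omega Phi).
Proof. by have [] := weak_divP hdiv. Qed.

Let L2rec v : L2 Omega (reconstruct v).
Proof.
apply: (L2_cell_fun (f := fun K _ => v.1 K) hT oO) => K.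
by apply: (@L2_bounded _ _ _ mO _ `|v.1 K|).
Qed.

Let L2GT v : L2 Omega (GT v). Proof. exact: (L2_cone_fun hT oO Ofin). Qed.
Let L2G0 : L2 Omega G0. Proof. exact: (L2_cone_fun hT oO Ofin). Qed.

Let L2v_nablaT v : L2v Omega (nablaT v).
Proof.
move=> i; have := L2_cone_fun hT oO Ofin (fun K s => d * slope v K s * normal K s ord0 i).
congr L2; apply/funext => x; rewrite /nablaT summxE; apply: eq_bigr => K _.
rewrite summxE; apply: eq_bigr => s _; rewrite mxE -/d; ring.
Qed.

(** On each cone the discrete gradient is constant and normal to the face, so psi enters only
    through its mean normal component. *)
Let integral_dot_nablaT (psi : 'rV[R]_k.+1 -> 'rV[R]_k.+1) v : L2v Omega psi ->
  \int[mu]_(x in Omega) dot (psi x) (nablaT v x) =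
  d * \int[mu]_(x in Omega) (cone_fun (@cone_mean _ _ T psi) x * GT v x).
Proof.
move=> hpsi.
have hi K s : s \in faces K -> mu.-integrable Omega (EFin \o (fun x => dot (psi x) (normal K s))).
  move=> _; apply: (@L2v_dot _ _ _ oO psi (fun=> normal K s)) => // i.
  by apply: (@L2_bounded _ _ _ mO _ `|normal K s ord0 i|).
have := Rintegral_mul_cone_fun hT oO (fun K s => d * slope v K s) hi.
under eq_Rintegral => x _.
  rewrite (_ : \sum_K _ = dot (psi x) (nablaT v x)).
  over.
  rewrite dotC /nablaT dot_suml; apply: eq_bigr => K _; rewrite dot_suml; apply: eq_bigr => s _.
  by rewrite dotZl dotC mulrC.
move=> ->.
have -> : \int[mu]_(x in Omega) (cone_fun (@cone_mean _ _ T psi) x * GT v x) =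
    \int[mu]_(x in Omega) cone_fun (fun K s => cone_mean psi K s * slope v K s) x.
  apply: eq_Rintegral => x _.
  by apply: (@cone_fun_map _ _ _ _ hT (fun p q => p * q)); rewrite mulr0.
rewrite (Rintegral_cone_fun hT oO Ofin) mulr_sumr; apply: eq_bigr => K _.
rewrite mulr_sumr; apply: eq_bigr => s sK; rewrite /cone_mean.
have V0 := volume_cone_gt0 hT sK.
set I := \int[_]_(_ in _) _; set a := slope v K s.
by field; rewrite gt_eqF.
Qed.

Let J v := \int[mu]_(x in Omega) (weak_div Omega Phi x * reconstruct v x + dot (Phi x) (nablaT v x)).

(** The divergence contributes -f almost everywhere, and the scheme cancels the terms in f and F
    against d int G u G v. *)
Let residual v : XT v -> J v = d * \int[mu]_(x in Omega) ((G0 x - GT u x) * GT v x).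
Proof.
move=> Xv; have [_ /(_ v Xv) sol] := hu.
have hPhi : L2v Omega Phi by exact: L2vD.
have i1 := L2_mul_integrable mO L2wd (L2rec v).
have i2 := L2v_dot oO hPhi (L2v_nablaT v).
have i3 := L2_mul_integrable mO hf (L2rec v).
have i4 := L2v_dot oO hF (L2v_nablaT v).
have i5 := L2v_dot oO hphi (L2v_nablaT v).
have i6 := L2_mul_integrable mO L2G0 (L2GT v).
have i7 := L2_mul_integrable mO (L2GT u) (L2GT v).
have E1 : \int[mu]_(x in Omega) (weak_div Omega Phi x * reconstruct v x) =
    - \int[mu]_(x in Omega) (f x * reconstruct v x).
  rewrite (@ae_Rintegral _ _ _ oO _ (fun x => - 1 * (f x * reconstruct v x))).
  - by rewrite (RintegralZl _ mO i3) mulN1r.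
  - by apply/measurable_EFinP; exact: measurable_int i1.
  - by apply: measurable_funM => //; apply/measurable_EFinP; exact: measurable_int i3.
  - by apply: filterS (ae_weak_div oO Ofin hdiv) => x h Ox; rewrite h// mulN1r mulNr.
have E2 : \int[mu]_(x in Omega) dot (Phi x) (nablaT v x) =
    \int[mu]_(x in Omega) dot (phi x) (nablaT v x) + \int[mu]_(x in Omega) dot (F x) (nablaT v x).
  by rewrite -(RintegralD mO i5 i4); apply: eq_Rintegral => x _; rewrite dotDl.
have E3 : \int[mu]_(x in Omega) ((G0 x - GT u x) * GT v x) =
    \int[mu]_(x in Omega) (G0 x * GT v x) - \int[mu]_(x in Omega) (GT u x * GT v x).
  by rewrite -(RintegralB mO i6 i7); apply: eq_Rintegral => x _; rewrite mulrBl.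
rewrite /J (RintegralD mO i1 i2) E1 E2 E3 mulrBr [d * \int[_]_(_ in _) (GT u _ * _)]sol.
rewrite (RintegralB mO i3 i4) (integral_dot_nablaT _ hphi) -[cone_fun _]/G0.
ring.
Qed.

Let nrm (h : 'rV[R]_k.+1 -> R) : R := fine (L2norm Omega h).

Let nrmE h : L2 Omega h -> L2norm Omega h = (nrm h)%:E.
Proof. by move=> hh; rewrite fineK// L2norm_fin. Qed.

Let nrm_ge0 h : 0 <= nrm h. Proof. by rewrite fine_ge0// L2norm_ge0. Qed.

Let scale (c : R) v : discrete T := (fun K => c * v.1 K, fun s => c * v.2 s).

Let GT_scale c v x : GT (scale c v) x = c * GT v x.
Proof.
rewrite /GT mulr_sumr; apply: eq_bigr => K _; rewrite mulr_sumr; apply: eq_bigr => s _.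
by rewrite /slope /= -mulrBr -!mulrA.
Qed.

Let XT_scale c v : XT v -> XT (scale c v).
Proof. by move=> Xv s sT; rewrite /= Xv// mulr0. Qed.

Let sqrtd_ge1 : 1 <= Num.sqrt d.
Proof. by rewrite -[leLHS]sqrtr1 ler_sqrt// ler1n. Qed.

Let J_scale c v : XT v -> J (scale c v) = c * J v.
Proof.
move=> Xv; rewrite !residual//; last exact: XT_scale.
have i := L2_mul_integrable mO (L2B mO L2G0 (L2GT u)) (L2GT v).
rewrite mulrCA -(RintegralZl _ mO i); congr (_ * _); apply: eq_Rintegral => x _.
by rewrite GT_scale mulrCA.
Qed.

Let J_le_zeta v : XT v -> 0 < nrm (GT v) ->
  ((J v / (Num.sqrt d * nrm (GT v)))%:E <= zeta Omega T Phi)%E.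
Proof.
move=> Xv v0; have N0 : 0 < Num.sqrt d * nrm (GT v) by rewrite mulr_gt0// (lt_le_trans ltr01).
rewrite mulrC -J_scale//; apply: ereal_sup_ubound; exists (scale (Num.sqrt d * nrm (GT v))^-1 v) => //.
split; first exact: XT_scale.
rewrite /normT (_ : GT (scale _ _) = fun x => (Num.sqrt d * nrm (GT v))^-1 * GT v x); last first.
  by apply/funext => x; rewrite GT_scale.
rewrite L2normZ//; last 2 first.
- exact: L2_measurable (L2GT v).
- by rewrite invr_ge0 ltW.
by rewrite nrmE// -!EFinM mulrCA mulVf// gt_eqF.
Qed.

Let cone_sum_gt0 (g : cell T -> face T -> R) :
  (forall K s, s \in faces K -> 0 < g K s) -> 0 < \sum_K \sum_(s in faces K) g K s.
Proof.
move=> g0; have [K _] := cell_exists hT hne; have [s sK] := faces_nonempty hT K.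
rewrite (bigD1 K)//=; apply: ltr_wpDr.
  by apply: sumr_ge0 => L _; apply: sumr_ge0 => t tL; exact/ltW/g0.
rewrite (bigD1 s)//=; apply: ltr_wpDr; last exact: g0.
by apply: sumr_ge0 => t /andP[tK _]; exact/ltW/g0.
Qed.

(** A supremum over no function would be -oo, so some v of nonzero norm is needed. As J is odd, the
    normalization of v or of -v then has a nonnegative value. *)
Let zeta_ge0 : (0 <= zeta Omega T Phi)%E.
Proof.
(* One on the cells and zero on the faces: every slope is -1/d_{K,s}, which is nonzero. *)
pose v : discrete T := (fun=> 1, fun=> 0).
have Xv : XT v by [].
have v0 : 0 < nrm (GT v).
  rewrite lt0r nrm_ge0 andbT; apply/eqP => n0.
  have : (L2norm Omega (GT v) `^ 2 = 0)%E by rewrite nrmE// n0 poweR0r.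
  have gE x : GT v x ^+ 2 = cone_fun (fun K s => slope v K s ^+ 2) x.
    by apply: (@cone_fun_map _ _ _ _ hT (fun p q => p ^+ 2) (slope v) (slope v)); rewrite expr0n.
  rewrite L2normK; under eq_integral do rewrite gE.
  rewrite (integral_EFin_Rintegral mO (L2_integrable mO Ofin (L2_cone_fun hT oO Ofin _))).
  move=> E; have /eqP := @EFin_inj _ _ _ E; apply/negP; rewrite gt_eqF// (Rintegral_cone_fun hT oO Ofin).
  have p0 K s : s \in faces K -> 0 < slope v K s ^+ 2 * volume (cone K s).
    move=> sK; rewrite mulr_gt0 ?(volume_cone_gt0 hT)// exprn_even_gt0//= /slope /= sub0r.
    by rewrite mulNr oppr_eq0 mul1r invr_eq0 gt_eqF// (dKs_gt0 hT).
  exact: cone_sum_gt0 p0.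
have N0 : 0 < Num.sqrt d * nrm (GT v) by rewrite mulr_gt0// (lt_le_trans ltr01).
have [J0|J0] := leP 0 (J v).
  by apply: le_trans (J_le_zeta Xv v0); rewrite lee_fin divr_ge0// ltW.
have nE : nrm (GT (scale (-1) v)) = nrm (GT v).
  rewrite /nrm !L2normE; congr (fine (_ `^ _)); apply: eq_integral => x _.
  by rewrite GT_scale mulN1r sqrrN.
have := J_le_zeta (XT_scale (-1) Xv); rewrite nE J_scale// => /(_ v0).
by apply: le_trans; rewrite lee_fin divr_ge0 ?(ltW N0)// mulN1r oppr_ge0 ltW.
Qed.

(** With v = w - u, one e comes from the triangle inequality between G u and calG ubar, the other
    from the bound |G v| <= z + e. *)
Let err w z : XT w -> zeta Omega T Phi = z%:E -> 0 <= z ->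
  nrm (fun x => GT u x - G0 x) <= z + 2 * nrm (fun x => G0 x - GT w x).
Proof.
move=> Xw zE z0; pose v : discrete T := (fun K => w.1 K - u.1 K, fun s => w.2 s - u.2 s).
have Xv : XT v by move=> s sT; have [Xu _] := hu; rewrite /= Xw// Xu// subrr.
have vE x : GT v x = GT w x - GT u x.
  rewrite /GT -sumrB; apply: eq_bigr => K _; rewrite -sumrB; apply: eq_bigr => s _.
  by rewrite /slope /=; ring.
have L0u := L2B mO L2G0 (L2GT u); have L0w := L2B mO L2G0 (L2GT w); have Lv := L2GT v.
set e := nrm (fun x => G0 x - GT w x); set g := nrm (GT v).
have e0 : 0 <= e by exact: nrm_ge0.
have tri : nrm (fun x => GT u x - G0 x) <= g + e.
  have Lu0 := L2B mO (L2GT u) L2G0.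
  have := L2normD mO (L2_measurable mO Lv) (L2_measurable mO L0w).
  rewrite (_ : L2norm _ (fun x => _) = L2norm Omega (fun x => (GT u x - G0 x)%R)); last first.
    rewrite !L2normE; congr (_ `^ _)%E; apply: eq_integral => x _; rewrite vE; congr EFin; ring.
  by rewrite !nrmE// -EFinD lee_fin.
suff gz : g <= z + e by apply: (le_trans tri); lra.
have [g0|] := ltP 0 g; last by move=> g0; apply: (le_trans g0); exact: addr_ge0.
have Jz := J_le_zeta Xv g0; rewrite zE lee_fin ler_pdivrMr in Jz; last first.
  by rewrite mulr_gt0// (lt_le_trans ltr01).
have g2 : g ^+ 2 = \int[mu]_(x in Omega) (GT v x * GT v x).
  apply: EFin_inj; have := L2normK Omega (GT v); rewrite nrmE// -/g poweR_EFin powR_mulrn ?(ltW g0)// => ->.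
  rewrite -(integral_EFin_Rintegral mO (L2_mul_integrable mO Lv Lv)).
  by apply: eq_integral => x _; rewrite expr2.
have i1 := L2_mul_integrable mO L0u Lv; have i2 := L2_mul_integrable mO L0w Lv.
(* Since G v = (calG ubar - G u) - (calG ubar - G w), the first integral is the residual, bounded
   through zeta, and the second is bounded by Cauchy-Schwarz. *)
have g2E : g ^+ 2 = \int[mu]_(x in Omega) ((G0 x - GT u x) * GT v x) -
    \int[mu]_(x in Omega) ((G0 x - GT w x) * GT v x).
  rewrite g2 -(RintegralB mO i1 i2); apply: eq_Rintegral => x _; rewrite vE; ring.
set I2 := \int[mu]_(x in Omega) ((G0 x - GT w x) * GT v x) in g2E.
have CS : - I2 <= e * g.
  by rewrite (le_trans (ler_norm (- I2)))// normrN; exact: Rintegral_mul_le_L2norm.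
have d0 : 0 < d by rewrite ltr0n.
(* The norm of v is sqrt d times g; enlarging sqrt d to d cancels the factor d of the residual. *)
have Jd : J v <= z * (d * g).
  apply: (le_trans Jz); rewrite ler_wpM2l// ler_wpM2r ?(ltW g0)//.
  rewrite -[leRHS]sqr_sqrtr ?(ltW d0)// expr2 ler_peMl// (le_trans ler01)//.
have dI : \int[mu]_(x in Omega) ((G0 x - GT u x) * GT v x) <= z * g.
  by rewrite -(ler_pM2l d0) -residual// (le_trans Jd)// mulrCA.
by rewrite -(ler_pM2r g0) -expr2 g2E mulrDl; apply: lerD.
Qed.

Let diam_ge0 : 0 <= diam Omega.
Proof.
have [x Ox] := hne; apply: (le_trans _ (enorm_le_diam bO Ox Ox)); exact: enorm_ge0.
Qed.

(** The gradient term of [delta] alone dominates e. With A the norm on the left and C the constant,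
    A/C - z is a lower bound of all [delta], hence of their infimum; an infinite zeta makes the
    bound trivial. *)
Lemma scheme_error : (L2norm Omega (fun x => (GT u x - calGT Omega T ubar x)%R) <=
  (2 * (1 + diam Omega))%:E * (zeta Omega T (fun x => (weak_grad Omega ubar x + F x)%R)
    + ereal_inf [set delta Omega ubar v | v in @XT R k.+1 T]))%E.
Proof.
rewrite -/Phi; have C0 : 0 < 2 * (1 + diam Omega) by rewrite mulr_gt0// ltr_pwDl.
have ge0 v : (0 <= delta Omega ubar v)%E.
  by rewrite adde_ge0// mule_ge0 ?L2norm_ge0// lee_fin ?invr_ge0 ?sqrtr_ge0.
have inf0 : (0 <= ereal_inf [set delta Omega ubar v | v in @XT R k.+1 T])%E.
  by apply: le_ereal_inf_tmp => _ [v _ <-].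
have Lu0 := L2B mO (L2GT u) L2G0; rewrite -/G0 (nrmE Lu0).
set A := nrm _; set C := 2 * _ in C0 *.
case E : (zeta Omega T Phi) => [z||]; last by have := zeta_ge0; rewrite E.
- have z0 : 0 <= z by have := zeta_ge0; rewrite E lee_fin.
  have H : ((A / C - z)%:E <= ereal_inf [set delta Omega ubar v | v in @XT R k.+1 T])%E.
    apply: le_ereal_inf_tmp => _ [w Xw <-].
    have L0w := L2B mO L2G0 (L2GT w).
    rewrite /delta -/d -/G0 (nrmE L0w) -EFinM.
    have := err Xw E z0; rewrite -/A; set e := nrm _ => Ae.
    have e0 : 0 <= e by exact: nrm_ge0.
    apply: (@le_trans _ _ (Num.sqrt d * e)%:E); last first.
      by apply: leeDr; rewrite mule_ge0 ?L2norm_ge0// lee_fin invr_ge0.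
    rewrite lee_fin lerBlDr ler_pdivrMr//; apply: (le_trans Ae).
    have se : e <= Num.sqrt d * e by rewrite ler_peMl.
    have C2 : 2 <= C by rewrite /C ler_peMr// lerDl.
    apply: (@le_trans _ _ ((e + z) * 2)); first by lra.
    by apply: ler_pM => //; [exact: addr_ge0|exact: lerD].
  have -> : A%:E = (C%:E * (A / C)%:E)%E by rewrite -EFinM mulrCA mulfV ?mulr1// gt_eqF.
  apply: lee_wpmul2l; first by rewrite lee_fin ltW.
  rewrite EFinB leeBlDl// in H; exact: H.
- rewrite addye; last by rewrite gt_eqF// (lt_le_trans _ inf0).
  by rewrite gt0_muley ?leey// lte_fin.
Qed.

End scheme_error.

Theorem lemma3p5 (R : realType) (d : nat) (Omega : set 'rV[R]_d) (T : mesh R d)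
    (hd : d = 2%N \/ d = 3%N) (hne : Omega !=set0) (hopen : open Omega)
    (hpoly : polytopal Omega) (hT : admissible Omega T) :
  (forall (ubar : 'rV[R]_d -> R) (u : discrete T),
     H10 Omega ubar -> XT u ->
     (L2normv Omega (fun x => nablahatT u x - weak_grad Omega ubar x)%R
      <= (d%:R / theta T)%:E *
         (L2norm Omega (fun x => GT u x - calGT Omega T ubar x)%R
          + Theta T (weak_grad Omega ubar)))%E)
  /\
  (forall (f : 'rV[R]_d -> R) (F : 'rV[R]_d -> 'rV[R]_d)
          (ubar : 'rV[R]_d -> R) (u : discrete T),
     L2 Omega f -> L2v Omega F ->
     weak_solution Omega f F ubar -> scheme_solution Omega f F u ->
     (L2normv Omega (fun x => nablahatT u x - weak_grad Omega ubar x)%R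
      <= (d%:R / theta T)%:E *
         ((2 * (1 + diam Omega))%:E *
            (zeta Omega T (fun x => weak_grad Omega ubar x + F x)%R
             + ereal_inf [set delta Omega ubar v | v in @XT R d T])
          + Theta T (weak_grad Omega ubar)))%E).
Proof.
have [k dk] : exists k, d = k.+1 by case: hd => ->; eexists.
(* The dimension is replaced by a successor in all dependent types at once, so that faces live in
   dimension k. *)
case: _ / (esym dk) Omega T hne hopen hpoly hT {hd} => Omega T hne hopen [bO _] hT.
have Ofin := bounded_leb_lty bO (open_measurable_rV hopen).
have part1 ubar (u : discrete T) : H10 Omega ubar ->
    (L2normv Omega (fun x => nablahatT u x - weak_grad Omega ubar x)%R
      <= (k.+1%:R / theta T)%:E *
         (L2norm Omega (fun x => GT u x - calGT Omega T ubar x)%R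
          + Theta T (weak_grad Omega ubar)))%E.
  by move=> [/weak_gradP[L2g _] _]; exact: (discrete_gradient_error hT hopen hne Ofin u L2g).
split=> [ubar u hubar _|f F ubar u hf hF hubar hu]; first exact: part1.
apply: (le_trans (part1 _ u hubar.1)); apply: lee_wpmul2l.
  by rewrite lee_fin divr_ge0// ltW// (theta_gt0 hT hne).
apply: leeD => //; exact: (scheme_error hT hopen hne bO hf hF hubar hu).
Qed.
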